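(* For any $n\in\mathbb{N}$ with $n>1$, there exists a finitely generated polynomial semigroup $G_n=\langle h_1,\ldots,h_{2n}\rangle$ in $\mathcal{G}$ satisfying $\sharp(\hat{\mathcal{J}}_{G_n})=n$. In fact, let $0<\epsilon<\frac12$ and for each $j=1,\ldots,n$ set $\alpha_j(z):=\frac1j z^2$ and $\beta_j(z):=\frac1j(z-\epsilon)^2+\epsilon$. Then, for any sufficiently large $l\in\mathbb{N}$, there exists an open neighborhood $V$ of $(\alpha_1^l,\ldots,\alpha_n^l,\beta_1^l,\ldots,\beta_n^l)$ in $(\mathrm{Poly})^{2n}$ such that for any $(h_1,\ldots,h_{2n})\in V$, the semigroup $G=\langle h_1,\ldots,h_{2n}\rangle$ satisfies $G\in\mathcal{G}$ and $\sharp(\hat{\mathcal{J}}_G)=n$.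
   Context: $\hat{\mathbb{C}}$ is the Riemann sphere. Poly is the set of non-constant polynomial maps $\hat{\mathbb{C}}\to\hat{\mathbb{C}}$ with the topology of uniform convergence on $\hat{\mathbb{C}}$ with respect to the spherical distance. $g^l$ denotes the $l$-th iterate of $g$. A polynomial semigroup is a semigroup, under composition, generated by a non-empty family of elements of Poly; $\langle h_1,\ldots,h_k\rangle$ is the semigroup generated by $h_1,\ldots,h_k$. The Fatou set $F(G)$ is the set of $z\in\hat{\mathbb{C}}$ having a neighborhood on which $G$ is a normal family; the Julia set is $J(G)=\hat{\mathbb{C}}\setminus F(G)$. $CV(g)$ is the set of critical values of $g:\hat{\mathbb{C}}\to\hat{\mathbb{C}}$, $P(G)=\overline{\bigcup_{g\in G}CV(g)}$ (closure in $\hat{\mathbb{C}}$), and $P^{\ast}(G)=P(G)\setminus\{\infty\}$. $\mathcal{G}$ is the set of all polynomial semigroups $G$ such that each element of $G$ has degree at least two and $P^{\ast}(G)$ is bounded in $\mathbb{C}$. $\hat{\mathcal{J}}_G$ is the set of all connected components of $J(G)$. *)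

(* Defs.v *)
From HB Require Import structures.
From mathcomp Require Import all_boot all_order all_algebra.
From mathcomp Require Import complex.
From mathcomp Require Import all_classical all_reals all_analysis.
From mathcomp Require Import ring lra.

Set Implicit Arguments.
Unset Strict Implicit.
Unset Printing Implicit Defensive.

Import Order.TTheory GRing.Theory Num.Theory.
Import numFieldNormedType.Exports.

Local Open Scope classical_set_scope.
Local Open Scope ring_scope.
Local Open Scope complex_scope.

(* [Some z] is the finite point [z] and [None] is the point at infinity. *)
Definition rsphere (R : realType) : Type := option R[i].

HB.instance Definition _ (R : realType) := Choice.on (rsphere R).
HB.instance Definition _ (R : realType) := Pointed.on (rsphere R).

(* Inverse stereographic projection onto the unit sphere of [R^3]. *)
Definition stereo (R : realType) (z : rsphere R) : R * R * R :=
  if z is Some (x +i* y) then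
    let s := x ^+ 2 + y ^+ 2 in
    (2 * x / (s + 1), 2 * y / (s + 1), (s - 1) / (s + 1))
  else (0, 0, 1).

Definition dot3 (R : realType) (u v : R * R * R) : R :=
  u.1.1 * v.1.1 + u.1.2 * v.1.2 + u.2 * v.2.

(* Length of the great-circle arc between the two projected points. *)
Definition spherical_dist (R : realType) (z w : rsphere R) : R :=
  acos (dot3 (stereo z) (stereo w)).

Section SphericalMetric.
Variable R : realType.
Implicit Types z w : rsphere R.

Lemma dot3C (u v : R * R * R) : dot3 u v = dot3 v u.
Proof. by rewrite /dot3; ring. Qed.

Lemma stereo_unit z : dot3 (stereo z) (stereo z) = 1.
Proof.
case: z => [[x y]|]; last by rewrite /dot3 /=; ring.
rewrite /dot3 /=.
have s0 : x ^+ 2 + y ^+ 2 + 1 != 0.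
  by rewrite lt0r_neq0// ltr_wpDl// addr_ge0// sqr_ge0.
by field.
Qed.

Lemma stereo_inj : injective (@stereo R).
Proof.
have s1 (x y : R) : 0 < x ^+ 2 + y ^+ 2 + 1.
  by rewrite ltr_wpDl// addr_ge0// sqr_ge0.
move=> [[x y]|] [[x' y']|] //=; last 2 first.
- case=> _ _ /eqP; rewrite -(inj_eq (mulIf (lt0r_neq0 (s1 x y)))).
  by rewrite divfK ?lt0r_neq0// mul1r => /eqP h; exfalso; lra.
- case=> _ _ /esym /eqP; rewrite -(inj_eq (mulIf (lt0r_neq0 (s1 x' y')))).
  by rewrite divfK ?lt0r_neq0// mul1r => /eqP h; exfalso; lra.
case.
have := lt0r_neq0 (s1 x y); have := lt0r_neq0 (s1 x' y').
set s := _ + _ + 1; set t := _ + _ + 1 => s0 t0 ex ey ez.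
have et : x ^+ 2 + y ^+ 2 - 1 = t - 2 by rewrite /t; ring.
have es : x' ^+ 2 + y' ^+ 2 - 1 = s - 2 by rewrite /s; ring.
rewrite et es in ez.
have st : s^-1 = t^-1.
  move: ez; rewrite !mulrBl !divff// => ez; lra.
have {}st : s = t by apply: invr_inj.
have cancel2 (a b : R) : 2 * a / t = 2 * b / t -> a = b.
  move/(mulIf (invr_neq0 t0)); lra.
rewrite st in ex ey.
by rewrite (cancel2 _ _ ex) (cancel2 _ _ ey).
Qed.

(* The difference of the two sides is the square of a determinant. *)
Lemma gram3_ge0 (u v w : R * R * R) : dot3 u u = 1 -> dot3 v v = 1 -> dot3 w w = 1 ->
  (dot3 u w - dot3 u v * dot3 v w) ^+ 2 <=
  (1 - dot3 u v ^+ 2) * (1 - dot3 v w ^+ 2).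
Proof.
move=> u1 v1 w1; rewrite -subr_ge0.
have -> : (1 - dot3 u v ^+ 2) * (1 - dot3 v w ^+ 2) -
    (dot3 u w - dot3 u v * dot3 v w) ^+ 2 =
    dot3 u u * dot3 v v * dot3 w w + 2 * dot3 u v * dot3 v w * dot3 u w
    - dot3 u u * dot3 v w ^+ 2 - dot3 v v * dot3 u w ^+ 2
    - dot3 w w * dot3 u v ^+ 2.
  by rewrite u1 v1 w1; ring.
have -> : dot3 u u * dot3 v v * dot3 w w + 2 * dot3 u v * dot3 v w * dot3 u w
    - dot3 u u * dot3 v w ^+ 2 - dot3 v v * dot3 u w ^+ 2
    - dot3 w w * dot3 u v ^+ 2 =
    (u.1.1 * (v.1.2 * w.2 - v.2 * w.1.2) - u.1.2 * (v.1.1 * w.2 - v.2 * w.1.1)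
     + u.2 * (v.1.1 * w.1.2 - v.1.2 * w.1.1)) ^+ 2.
  by rewrite /dot3; ring.
exact: sqr_ge0.
Qed.

Lemma dot3_itv (u v : R * R * R) : dot3 u u = 1 -> dot3 v v = 1 -> -1 <= dot3 u v <= 1.
Proof.
move=> u1 v1.
have hm : 0 <= dot3 u u + dot3 v v - 2 * dot3 u v.
  have -> : dot3 u u + dot3 v v - 2 * dot3 u v =
    (u.1.1 - v.1.1) ^+ 2 + (u.1.2 - v.1.2) ^+ 2 + (u.2 - v.2) ^+ 2.
    by rewrite /dot3; ring.
  by rewrite !addr_ge0// sqr_ge0.
have hp : 0 <= dot3 u u + dot3 v v + 2 * dot3 u v.
  have -> : dot3 u u + dot3 v v + 2 * dot3 u v =
    (u.1.1 + v.1.1) ^+ 2 + (u.1.2 + v.1.2) ^+ 2 + (u.2 + v.2) ^+ 2.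
    by rewrite /dot3; ring.
  by rewrite !addr_ge0// sqr_ge0.
by rewrite u1 v1 in hm hp; lra.
Qed.

Lemma stereo_dot_itv z w : -1 <= dot3 (stereo z) (stereo w) <= 1.
Proof. by apply: dot3_itv; exact: stereo_unit. Qed.

Lemma spherical_distxx z : spherical_dist z z = 0.
Proof. by rewrite /spherical_dist stereo_unit acos1. Qed.

Lemma spherical_dist_sym z w : spherical_dist z w = spherical_dist w z.
Proof. by rewrite /spherical_dist dot3C. Qed.

Lemma spherical_dist_eq0 z w : spherical_dist z w = 0 -> z = w.
Proof.
move=> zw; apply: stereo_inj.
have d1 : dot3 (stereo z) (stereo w) = 1.
  by rewrite -[LHS]acosK ?in_itv/= ?stereo_dot_itv// -/(spherical_dist z w) zw cos0.
move: d1 (stereo_unit z) (stereo_unit w).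
move: (stereo z) (stereo w) => [[a b] c] [[a' b'] c']; rewrite /dot3 /= => h h1 h2.
have : (a - a') ^+ 2 + (b - b') ^+ 2 + (c - c') ^+ 2 = 0.
  transitivity ((a * a + b * b + c * c) + (a' * a' + b' * b' + c' * c')
    - 2 * (a * a' + b * b' + c * c')); first by ring.
  by rewrite h h1 h2; ring.
move/eqP; rewrite paddr_eq0 ?addr_ge0 ?sqr_ge0// paddr_eq0 ?sqr_ge0//.
by rewrite !sqrf_eq0 !subr_eq0 => /andP[/andP[/eqP -> /eqP ->] /eqP ->].
Qed.

Lemma spherical_dist_triangle w z z' :
  spherical_dist z z' <= spherical_dist z w + spherical_dist w z'.
Proof.
have h := gram3_ge0 (stereo_unit z) (stereo_unit w) (stereo_unit z').
move: (stereo_dot_itv z w) (stereo_dot_itv w z') (stereo_dot_itv z z') h.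
rewrite /spherical_dist.
move: (dot3 _ _) (dot3 _ _) (dot3 _ _) => c b a ha hb hc h.
have [pab|pab] := ltP pi (acos a + acos b).
  by rewrite (le_trans _ (ltW pab))// acos_lepi.
rewrite leNgt -ltr_cos ?in_itv/= ?addr_ge0 ?acos_ge0 ?acos_lepi// -leNgt.
rewrite cosD !acosK ?in_itv/=// !sin_acos//.
have a2 : 0 <= 1 - a ^+ 2 by case/andP: ha => *; nra.
rewrite -sqrtrM// lerBlDr -lerBlDl.
by rewrite (le_trans (ler_norm _))// -sqrtr_sqr ler_wsqrtr// -sqrrN opprB.
Qed.

End SphericalMetric.

HB.instance Definition _ (R : realType) :=
  @isMetric.Build R (rsphere R) (@spherical_dist R) (@spherical_distxx R)
    (@spherical_dist_eq0 R) (@spherical_dist_sym R)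
    (@spherical_dist_triangle R).

(* A non-constant polynomial map is represented by its polynomial, which the
   map determines since the field of complex numbers is infinite. *)
Definition cpoly (R : realType) : Type :=
  {p : {poly R[i]} | (1 < size p)%N}.

Definition CPoly (R : realType) (p : {poly R[i]}) (p1 : (1 < size p)%N) :
  cpoly R := exist _ p p1.

Definition cpoly_deg (R : realType) (g : cpoly R) : nat := (size (val g)).-1.

Definition cpoly_map (R : realType) (g : cpoly R) (z : rsphere R) : rsphere R :=
  if z is Some c then Some (val g).[c] else None.

HB.instance Definition _ (R : realType) := Choice.on (cpoly R).
HB.instance Definition _ (R : realType) :=
  Topological.copy (cpoly R)
    (initial_topology
      (@cpoly_map R : cpoly R -> {uniform rsphere R -> rsphere R})).

Section Composition.
Variable R : realType.
Implicit Types g h : cpoly R.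

Lemma size_cpoly_comp g h : (1 < size (val g \Po val h))%N.
Proof.
case: g h => [p p1] [q q1] /=.
have pred_gt0 k : (1 < k)%N = (0 < k.-1)%N by case: k => [|[|]].
by rewrite pred_gt0 size_comp_poly muln_gt0 -!pred_gt0 p1 q1.
Qed.

Definition cpoly_comp g h : cpoly R := CPoly (size_cpoly_comp g h).

Lemma cpoly_mapE g h : cpoly_map (cpoly_comp g h) = cpoly_map g \o cpoly_map h.
Proof. by apply/funext => -[c|] //=; rewrite horner_comp. Qed.

Lemma size_cpoly_id : (1 < size ('X : {poly R[i]}))%N.
Proof. by rewrite size_polyX. Qed.

Definition cpoly_id : cpoly R := CPoly size_cpoly_id.

Definition cpoly_iter (l : nat) g : cpoly R := iter l (cpoly_comp g) cpoly_id.

Lemma cpoly_map_iter l g : cpoly_map (cpoly_iter l g) = iter l (cpoly_map g).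
Proof.
apply/funext => z; elim: l => [|l IHl] /=; last by rewrite cpoly_mapE /= IHl.
by case: z => [c|] //=; rewrite hornerX.
Qed.

End Composition.

Section Semigroups.
Variable R : realType.
Implicit Types (g h : cpoly R) (S G : set (cpoly R)) (U : set (rsphere R)).

Definition semigroup_gen S : set (cpoly R) :=
  smallest [set G | forall g h, G g -> G h -> G (cpoly_comp g h)] S.

Definition polynomial_semigroup G : Prop :=
  exists2 S, S !=set0 & G = semigroup_gen S.

(* Meant for open [U]: local uniform convergence on [U] is uniform convergence
   on the compact subsets of [U], since the sphere is locally compact. *)
Definition normal_on G U : Prop :=
  forall g_ : nat -> cpoly R, (forall k, G (g_ k)) ->
  exists phi : nat -> nat, {homo phi : i j / (i < j)%N} /\
  exists f : rsphere R -> rsphere R,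
  forall K, compact K -> K `<=` U ->
    {uniform K, (fun k => cpoly_map (g_ (phi k))) @ \oo --> f}.

Definition fatou_set G : set (rsphere R) :=
  [set z | exists2 U, open_nbhs z U & normal_on G U].

Definition julia_set G : set (rsphere R) := ~` fatou_set G.

Definition julia_components G : set (set (rsphere R)) :=
  connected_component (julia_set G) @` julia_set G.

(* In the coordinate [1/z] at infinity, a polynomial map of degree [d] is
   [w |-> w ^+ d * u w] with [u 0 != 0], so infinity is critical iff [1 < d]. *)
Definition critical_point g : set (rsphere R) :=
  [set z | if z is Some c then root (val g)^`() c else (1 < cpoly_deg g)%N].

Definition critical_values g : set (rsphere R) :=
  cpoly_map g @` critical_point g.

Definition postcritical_set G : set (rsphere R) :=
  closure (\bigcup_(g in G) critical_values g).

(* The postcritical set without infinity, as a subset of the plane. *)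
Definition planar_postcritical_set G : set R[i] :=
  Some @^-1` postcritical_set G.

(* [bounded_set] over the field [R[i]] quantifies over real bounds only: for the
   order of [R[i]], an element greater than a real is real. *)
Definition postcritically_bounded G : Prop :=
  [/\ polynomial_semigroup G,
      forall g, G g -> (2 <= cpoly_deg g)%N &
      bounded_set (planar_postcritical_set G : set R[i]^o)].

End Semigroups.

Section Generators.
Variable R : realType.

(* The index is shifted by one: [j : 'I_n] stands for [j + 1] in [1, ..., n]. *)

Lemma size_alpha (j : nat) : (1 < size (j.+1%:R^-1 *: 'X^2 : {poly R[i]})%R)%N.
Proof. by rewrite size_scale ?invr_eq0 ?pnatr_eq0// size_polyXn. Qed.

Definition alpha (j : nat) : cpoly R := CPoly (size_alpha j).

Lemma size_beta (a : R[i]) (j : nat) :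
  (1 < size (j.+1%:R^-1 *: ('X - a%:P) ^+ 2 + a%:P)%R)%N.
Proof.
have s3 : size (j.+1%:R^-1 *: ('X - a%:P) ^+ 2) = 3%N.
  by rewrite size_scale ?invr_eq0 ?pnatr_eq0// size_exp_XsubC.
by rewrite size_polyDl s3// size_polyC; case: (a == 0).
Qed.

Definition beta (eps : R) (j : nat) : cpoly R :=
  CPoly (size_beta eps%:C j).

(* The tuple (alpha_1^l, ..., alpha_n^l, beta_1^l, ..., beta_n^l). *)
Definition base_tuple (n : nat) (eps : R) (l : nat) : 'I_(n + n) -> cpoly R :=
  fun i => match fintype.split i with
           | inl j => cpoly_iter l (alpha j)
           | inr j => cpoly_iter l (beta eps j)
           end.

End Generators.

(* Main.v *)
(* Near the base tuple with l large, every generator is c + a (z - c)^d plus a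
   tiny polynomial, with c = 0 or eps and d = 2^l.  It maps the disk of radius
   1/2 into a smaller disk, which contains all the critical values, and it
   expands outside the disk of radius n + 1.  So the Julia set J lies in the
   annulus between them, and it is the union over j of the pieces
   J_j = alpha_j^-1 J `|` beta_j^-1 J, which lie within about eps of the circle of
   radius j; since eps < 1/2, these pieces are disjoint.

   In the coordinate log z the inverse branches of the generators become
   globally defined contractions phi of small ratio, one for each generator:
   translating the argument of phi by 2 pi i runs through all its branches.
   Hence the lift of J_j is the union of the images phi (lift of J_m), where phi
   comes from alpha_j or beta_j and m is arbitrary.  If every lift is connected
   by chains of step delta, each of these images is connected by chains of a much
   smaller step.  An image under alpha_j and one under beta_j both cross the strip
   0 <= Im <= pi, and their left/right order is opposite at the two ends, since
   the circles |z| = j and |z - eps| = j cross; therefore they come close to each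
   other.  So the lifts are connected by chains of step delta / 2 and, by
   iteration, of arbitrarily small step; by compactness each J_j is connected.

   That a uniform neighborhood in the spherical metric controls the degree and
   the coefficients follows from averages over roots of unity. *)

Require Import Defs.
From HB Require Import structures.
From mathcomp Require Import all_boot all_order all_algebra.
From mathcomp Require cyclic.
From mathcomp Require Import complex.
From mathcomp Require Import all_classical all_reals all_analysis.
From mathcomp Require Import ring lra zify.

Set Implicit Arguments.
Unset Strict Implicit.
Unset Printing Implicit Defensive.

Import Order.TTheory GRing.Theory Num.Theory.
Import numFieldNormedType.Exports.

Local Open Scope classical_set_scope.
Local Open Scope ring_scope.
Local Open Scope complex_scope.

Local Notation nm := Normc.normc.
Local Notation Re := complex.Re.
Local Notation Im := complex.Im.

(** * The Riemann sphere *)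

(** Write a generator as p(z) = c + a (z - c)^d + e(z). Taking logarithms in p(e^u) = e^s gives d
    log(e^u - c) + ln a = log(e^s - c - e(e^u)), where each logarithm is its variable plus a
    single-valued correction ([shift_log]). The left side expands by a factor of order d and the
    right side is Lipschitz, so s determines u with any prescribed contraction ratio once d is
    large; that every s is reached follows by counting roots modulo d. Neither holomorphic inverse
    functions nor covering theory is used. The ratio 1/12 comes from the crossing: two chains of
    step t that exchange sides come within 6 t of each other, and this must be at most half the old
    step. The crossing is discrete, in the manner of Sperner's lemma, because the pieces are only
    known to be connected by chains and contain no explicit curves. The order of choice is:
    tolerances from n and eps, then the contraction ratio, then l, and last the size of the
    perturbation, which has to beat powers of degree d. *)

Section Modulus.
Variable R : realType.
Implicit Types (x y z w : R[i]) (r : R).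

Lemma nm_ge0 x : 0 <= nm x.
Proof. by case: x => a b; rewrite /= sqrtr_ge0. Qed.

Lemma nm_sqr x : nm x ^+ 2 = Re x ^+ 2 + Im x ^+ 2.
Proof. by case: x => a b /=; rewrite sqr_sqrtr // addr_ge0 ?sqr_ge0. Qed.

Lemma nm0 : nm (0 : R[i]) = 0.
Proof. exact: Normc.normc0. Qed.

Lemma nm1 : nm (1 : R[i]) = 1.
Proof. exact: Normc.normc1. Qed.

Lemma nm_eq0 x : (nm x == 0) = (x == 0).
Proof.
by apply/eqP/eqP => [|->]; [exact: Normc.eq0_normc|exact: nm0].
Qed.

Lemma nm_gt0 x : (0 < nm x) = (x != 0).
Proof. by rewrite lt0r nm_ge0 andbT nm_eq0. Qed.

Lemma nmM x y : nm (x * y) = nm x * nm y.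
Proof. exact: Normc.normcM. Qed.

Lemma nmX x k : nm (x ^+ k) = nm x ^+ k.
Proof. by elim: k => [|k IH]; rewrite ?expr0 ?nm1// !exprS nmM IH. Qed.

Lemma nmV x : nm x^-1 = (nm x)^-1.
Proof. exact: Normc.normcV. Qed.

Lemma nmN x : nm (- x) = nm x.
Proof. exact: normcN. Qed.

Lemma nm_distC x y : nm (x - y) = nm (y - x).
Proof. by rewrite -nmN opprB. Qed.

Lemma nmD x y : nm (x + y) <= nm x + nm y.
Proof. exact: le_normcD. Qed.

Lemma nmB x y : nm (x - y) <= nm x + nm y.
Proof. by rewrite -(nmN y) nmD. Qed.

Lemma nm_triangle z x y : nm (x - y) <= nm (x - z) + nm (z - y).
Proof.
have -> : x - y = (x - z) + (z - y) by ring.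
exact: nmD.
Qed.

Lemma nmB_ge x y : nm x - nm y <= nm (x - y).
Proof. by rewrite lerBlDr -{1}(subrK y x) nmD. Qed.

Lemma nm_real r : nm r%:C = `|r|.
Proof. by rewrite /= expr0n/= addr0 sqrtr_sqr. Qed.

Lemma nm_sum (I : Type) (s : seq I) (P : pred I) (F : I -> R[i]) :
  nm (\sum_(i <- s | P i) F i) <= \sum_(i <- s | P i) nm (F i).
Proof.
elim: s => [|i s IH]; first by rewrite !big_nil nm0.
rewrite !big_cons; case: ifP => // _.
by rewrite (le_trans (nmD _ _))// lerD2l.
Qed.

Lemma nm_prod (I : Type) (s : seq I) (P : pred I) (F : I -> R[i]) :
  nm (\prod_(i <- s | P i) F i) = \prod_(i <- s | P i) nm (F i).
Proof.
elim: s => [|i s IH]; first by rewrite !big_nil nm1.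
by rewrite !big_cons; case: ifP => // _; rewrite nmM IH.
Qed.

Lemma Re_le_nm x : `|Re x| <= nm x.
Proof. by rewrite -ler_sqr ?nnegrE ?nm_ge0// nm_sqr real_normK ?num_real// lerDl sqr_ge0. Qed.

Lemma Im_le_nm x : `|Im x| <= nm x.
Proof. by rewrite -ler_sqr ?nnegrE ?nm_ge0// nm_sqr real_normK ?num_real// lerDr sqr_ge0. Qed.

Lemma nm_le_ReIm x : nm x <= `|Re x| + `|Im x|.
Proof.
rewrite -ler_sqr ?nnegrE ?nm_ge0 ?addr_ge0// nm_sqr.
rewrite -(real_normK (num_real (Re x))) -(real_normK (num_real (Im x))).
by have := mulr_ge0 (normr_ge0 (Re x)) (normr_ge0 (Im x)); lra.
Qed.

End Modulus.

(** * A rational substitute for the spherical distance *)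

Section SphericalGap.
Variable R : realType.
Implicit Types z w : rsphere R.

(** Half the squared chordal distance, that is one minus the cosine of the spherical distance. It is
    a rational function of the coordinates, so estimates are made on it and [acos] enters only when
    passing from one to the other. *)
Definition gap z w : R := 1 - dot3 (stereo z) (stereo w).

Lemma gap_fin (z w : R[i]) :
  gap (Some z) (Some w) = 2 * nm (z - w) ^+ 2 / ((1 + nm z ^+ 2) * (1 + nm w ^+ 2)).
Proof.
rewrite !nm_sqr /gap /dot3; case: z w => [x y] [x' y'] /=.
have h (a b : R) : 1 + (a ^+ 2 + b ^+ 2) != 0.
  by rewrite lt0r_neq0// ltr_pwDl// addr_ge0// sqr_ge0.
have h' (a b : R) : a ^+ 2 + b ^+ 2 + 1 != 0 by rewrite addrC h.
by field; rewrite !h.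
Qed.

Lemma gap_infty (z : R[i]) : gap (Some z) None = 2 / (1 + nm z ^+ 2).
Proof.
rewrite !nm_sqr /gap /dot3; case: z => [x y] /=.
have h : 1 + (x ^+ 2 + y ^+ 2) != 0.
  by rewrite lt0r_neq0// ltr_pwDl// addr_ge0// sqr_ge0.
have h' : x ^+ 2 + y ^+ 2 + 1 != 0 by rewrite addrC h.
by field; rewrite ?h.
Qed.

Lemma gapC z w : gap z w = gap w z.
Proof. by rewrite /gap dot3C. Qed.

Lemma spherical_dist_lt (e : R) z w : 0 < e <= pi ->
  (spherical_dist z w < e) = (gap z w < 1 - cos e).
Proof.
move=> /andP[e0 epi]; have d := stereo_dot_itv z w.
rewrite /spherical_dist /gap ltrD2l ltrN2.
rewrite -ltr_cos ?in_itv/= ?acos_ge0 ?acos_lepi ?(ltW e0)//.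
by rewrite acosK// in_itv.
Qed.

Lemma cos_gap_gt0 (e : R) : 0 < e <= pi -> 0 < 1 - cos e.
Proof.
move=> /andP[e0 epi]; rewrite subr_gt0 -cos0 ltr_cos// in_itv/= ?lexx ?pi_ge0//.
by rewrite (ltW e0).
Qed.

Lemma gap_small (e : R) : 0 < e ->
  exists2 d : R, 0 < d & forall z w, gap z w < d -> spherical_dist z w < e.
Proof.
(* [cos] decreases only on [0, pi], hence the truncation. *)
move=> e0; pose e' := Num.min e pi.
have e'i : 0 < e' <= pi by rewrite lt_min e0 pi_gt0/= ge_min lexx orbT.
exists (1 - cos e'); first exact: cos_gap_gt0.
by move=> z w; rewrite -spherical_dist_lt// lt_min => /andP[].
Qed.

Lemma dist_small_gap (d : R) : 0 < d ->
  exists2 e : R, 0 < e & forall z w, spherical_dist z w < e -> gap z w < d.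
Proof.
move=> d0; pose d' := Num.min d 1.
have /andP[d'0 d'1] : 0 < d' <= 1 by rewrite lt_min d0 ltr01 ge_min lexx orbT.
have ai : -1 <= 1 - d' < 1 by lra.
have ai' : -1 <= 1 - d' <= 1 by lra.
exists (acos (1 - d')); first exact: acos_gt0.
move=> z w; rewrite spherical_dist_lt ?acos_gt0 ?acos_lepi//.
by rewrite acosK ?in_itv// opprB addrC subrK lt_min => /andP[].
Qed.

Lemma ball_sphereE z (e : R) w : ball z e w = (spherical_dist z w < e) :> Prop.
Proof. by rewrite ballEmdist. Qed.

Lemma nbhs_gap z (A : set (rsphere R)) :
  nbhs z A <-> exists2 d : R, 0 < d & forall w, gap z w < d -> A w.
Proof.
rewrite -nbhs_ballE; split=> [[e e0 eA]|[d d0 dA]].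
  by have [d d0 h] := gap_small e0; exists d => // w /h zw; apply: eA; rewrite ball_sphereE.
have [e e0 h] := dist_small_gap d0.
by exists e => // w; rewrite ball_sphereE => /h /dA.
Qed.

End SphericalGap.

(** * Neighborhoods in planar terms, and polynomial maps on the sphere *)

Section SphereTopology.
Variable R : realType.
Implicit Types z w : R[i].

Lemma gap_fin_le z w : gap (Some z) (Some w) <= 2 * nm (z - w) ^+ 2.
Proof.
have h (u : R[i]) : 1 <= 1 + nm u ^+ 2 by rewrite lerDl sqr_ge0.
rewrite gap_fin ler_pdivrMr ?mulr_gt0 ?(lt_le_trans ltr01 (h _))//.
by apply: ler_peMr; [rewrite mulr_ge0 ?sqr_ge0|exact: mulr_ege1].
Qed.

(** The gap from [z] to infinity is at least 2 / C with C = 1 + M^2, so a small gap forces [p] to be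
    finite. Then t = nm (z - w) satisfies 2 t^2 < e C (2 C + 2 t^2): the first entry of the minimum
    absorbs the t^2 on the right, and the second leaves d^2. *)
Lemma gap_small_fin (M d : R) : 0 < d ->
  exists2 e : R, 0 < e & forall z (p : rsphere R), nm z <= M ->
    gap (Some z) p < e -> exists2 w, p = Some w & nm (z - w) < d.
Proof.
move=> d0; pose C := 1 + M ^+ 2.
have C1 : 1 <= C by rewrite lerDl sqr_ge0.
have C0 : 0 < C by lra.
have e0 : 0 < Num.min (2 * C)^-1 (d ^+ 2 / (2 * C ^+ 2)).
  by rewrite lt_min invr_gt0 mulr_gt0//= divr_gt0 ?mulr_gt0 ?exprn_gt0.
exists (Num.min (2 * C)^-1 (d ^+ 2 / (2 * C ^+ 2))) => // z p zM.
move: e0; set e := Num.min _ _ => e0.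
have eC : e * C <= 1 / 2.
  rewrite -ler_pdivlMr// mul1r -invfM; first by rewrite /e ge_min lexx.
have eC2 : 2 * e * C ^+ 2 <= d ^+ 2.
  rewrite mulrAC -ler_pdivlMl ?mulr_gt0 ?exprn_gt0//.
  by rewrite mulrC /e ge_min lexx orbT.
have zC : 1 + nm z ^+ 2 <= C.
  by rewrite lerD2l ler_sqr ?nnegrE ?nm_ge0// (le_trans _ zM) ?nm_ge0.
have z0 : 0 < 1 + nm z ^+ 2 by rewrite ltr_pwDl ?sqr_ge0.
case: p => [w|]; last first.
  rewrite gap_infty ltr_pdivrMr// => h; exfalso.
  have : e * (1 + nm z ^+ 2) <= e * C by rewrite ler_pM2l.
  lra.
have w0 : 0 < 1 + nm w ^+ 2 by rewrite ltr_pwDl ?sqr_ge0.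
rewrite gap_fin ltr_pdivrMr ?mulr_gt0// => h; exists w => //.
rewrite -ltr_sqr ?nnegrE ?nm_ge0 ?(ltW d0)//.
set t := nm (z - w) in h *.
have wle : 1 + nm w ^+ 2 <= 2 * C + 2 * t ^+ 2.
  have : nm w <= nm z + t.
    by rewrite /t nm_distC addrC -lerBlDr nmB_ge.
  have := nm_ge0 w; have := nm_ge0 z; have : 0 <= t by exact: nm_ge0.
  have := sqr_ge0 (nm z - t).
  rewrite /C; move: zC; rewrite /C; nra.
have h2 : e * ((1 + nm z ^+ 2) * (1 + nm w ^+ 2)) <= e * (C * (2 * C + 2 * t ^+ 2)).
  by rewrite ler_pM2l//; apply: ler_pM => //; exact: ltW.
have t2 := sqr_ge0 t.
have h3 : e * C * t ^+ 2 <= 1 / 2 * t ^+ 2 by rewrite ler_wpM2r.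
nra.
Qed.

Lemma nbhs_fin z (A : set (rsphere R)) :
  nbhs (Some z : rsphere R) A <->
  exists2 d : R, 0 < d & forall w, nm (z - w) < d -> A (Some w).
Proof.
split=> [/nbhs_gap[d d0 dA]|[d d0 dA]].
  exists (Num.sqrt (d / 2)); first by rewrite sqrtr_gt0 divr_gt0.
  move=> w zw; apply: dA; rewrite (le_lt_trans (gap_fin_le _ _))//.
  rewrite -ltr_pdivlMl// mulrC -(@sqr_sqrtr _ (d / 2)) ?divr_ge0 ?ltW//.
  by rewrite ltr_sqr ?nnegrE ?nm_ge0 ?sqrtr_ge0.
have [e e0 he] := gap_small_fin (nm z) d0.
by apply/nbhs_gap; exists e => // p /(he _ _ (lexx _))[w -> /dA].
Qed.

Lemma nbhs_infty (A : set (rsphere R)) :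
  nbhs (None : rsphere R) A <->
  A None /\ exists M : R, forall w, M < nm w -> A (Some w).
Proof.
split=> [/nbhs_gap[d d0 dA]|[A0 [M MA]]].
  split; first by apply: dA; rewrite /gap /dot3 /=; lra.
  exists (Num.sqrt (2 / d)) => w Mw; apply: dA.
  rewrite gapC gap_infty ltr_pdivrMr ?ltr_pwDl ?sqr_ge0//.
  have h : 2 / d <= nm w ^+ 2.
    by rewrite -[leLHS]sqr_sqrtr ?divr_ge0 ?(ltW d0)// ler_sqr ?nnegrE ?nm_ge0 ?sqrtr_ge0 ?(ltW Mw).
  by rewrite mulrDr mulr1 ltr_pwDl// -ler_pdivrMl// mulrC.
apply/nbhs_gap; exists (2 / (1 + M ^+ 2)); first by rewrite divr_gt0// ltr_pwDl ?sqr_ge0.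
case=> // w; rewrite gapC gap_infty.
have pos (t : R) : 1 + t ^+ 2 \is Num.pos by rewrite posrE ltr_pwDl ?sqr_ge0.
rewrite ltr_pM2l// ltf_pV2// ltrD2l => h; apply: MA.
have [M0|M0] := leP 0 M; first by rewrite -ltr_sqr ?nnegrE ?nm_ge0.
by rewrite (lt_le_trans M0)// nm_ge0.
Qed.

Lemma sphere_emb_continuous :
  continuous (fun p : R * R => Some (p.1 +i* p.2) : rsphere R).
Proof.
move=> [x y] A /nbhs_fin[d d0 dA].
have h : \forall p \near (x, y), `|x - p.1| < d / 2 /\ `|y - p.2| < d / 2.
  have d2 : 0 < d / 2 by rewrite divr_gt0.
  exists (ball x (d / 2), ball y (d / 2)); first by split; apply: nbhsx_ballx.
  by case=> u v [/= hu hv].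
apply: filterS h => -[u v] /= [hu hv]; apply: dA.
by rewrite (le_lt_trans (nm_le_ReIm _))//= (splitr d) ltrD.
Qed.

Lemma closed_disk (c : R[i]) (M : R) :
  closed [set p : rsphere R | exists2 z, p = Some z & nm (z - c) <= M].
Proof.
rewrite -[X in closed X]setCK; apply: open_closedC.
rewrite openE => -[z|] h; last first.
  apply/nbhs_infty; split => //; exists (M + nm c) => w Mw [_ [<-]].
  by have := nmB_ge w c; lra.
have Mz : M < nm (z - c) by rewrite ltNge; apply/negP => zM; apply: h; exists z.
apply/nbhs_fin; exists (nm (z - c) - M); first by rewrite subr_gt0.
move=> w hw [_ [<-] wM]; have := nm_triangle w z c; lra.
Qed.

Lemma compact_disk (c : R[i]) (M : R) :
  compact [set p : rsphere R | exists2 z, p = Some z & nm (z - c) <= M].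
Proof.
pose M' := nm c + M.
have cK : compact (`[- M', M']%classic `*` `[- M', M']%classic : set (R * R)).
  by apply: compact_setX; exact: segment_compact.
have /(continuous_compact _) := cK.
move=> /(_ _ (fun p : R * R => Some (p.1 +i* p.2) : rsphere R)) H.
have cI := H (continuous_subspaceT sphere_emb_continuous).
apply: (subclosed_compact (@closed_disk c M) cI).
move=> _ [[x y] -> h0]; exists (x, y) => //=.
have h : nm (x +i* y) <= M'.
  by rewrite /M'; have := nmD (x +i* y - c) c; rewrite subrK; lra.
have := le_trans (Re_le_nm _) h; have := le_trans (Im_le_nm _) h.
by rewrite /= !in_itv/= !ler_norml => -> ->.
Qed.

Lemma poly_lipschitz (p : {poly R[i]}) (M : R) : exists2 L : R, 0 < L &
  forall z w, nm z <= M -> nm w <= M -> nm (p.[z] - p.[w]) <= L * nm (z - w).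
Proof.
have [M0|M0] := ltP M 0.
  by exists 1 => // z w zM; have := nm_ge0 z; lra.
elim/poly_ind: p => [|p c [L L0 IH]].
  by exists 1 => // z w _ _; rewrite !horner0 subrr nm0 mul1r nm_ge0.
exists (M * L + nm p.[0] + L * M + 1).
  by rewrite ltr_wpDl// addr_ge0 ?addr_ge0 ?mulr_ge0 ?nm_ge0// ltW.
move=> z w zM wM; rewrite !hornerMXaddC.
have -> : p.[z] * z + c - (p.[w] * w + c) =
  z * (p.[z] - p.[w]) + p.[w] * (z - w) by ring.
apply: (le_trans (nmD _ _)); rewrite !nmM.
have h1 : nm z * nm (p.[z] - p.[w]) <= M * (L * nm (z - w)).
  by rewrite ler_pM ?nm_ge0// IH.
have h2 : nm p.[w] <= nm p.[0] + L * M.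
  have := IH w 0 wM; rewrite nm0 subr0 => /(_ M0) h.
  rewrite addrC -lerBlDr (le_trans (nmB_ge _ _))// (le_trans h)//.
  by rewrite ler_wpM2l// ltW.
have h3 : nm p.[w] * nm (z - w) <= (nm p.[0] + L * M) * nm (z - w).
  by rewrite ler_wpM2r ?nm_ge0.
have := nm_ge0 (z - w); nra.
Qed.

Lemma poly_to_infty (p : {poly R[i]}) (B : R) : (1 < size p)%N ->
  exists M : R, forall w, M < nm w -> B < nm p.[w].
Proof.
elim/poly_ind: p B => [|p c IH] B; first by rewrite size_poly0.
rewrite size_MXaddC; case: ifP => // /negbT; rewrite negb_and => pc ps.
have [p1|p1] := leqP (size p) 1.
  move: pc ps; rewrite (size1_polyC p1); set a := p`_0 => _.
  rewrite size_polyC; case: eqVneq => //= a0 _.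
  exists ((B + nm c) / nm a) => w; rewrite ltr_pdivrMr ?nm_gt0// => h.
  rewrite hornerMXaddC hornerC.
  have := nmB_ge (a * w) (- c); rewrite opprK nmN nmM; lra.
have [M hM] := IH (B + nm c) p1.
exists (Num.max M 1) => w; rewrite gt_max => /andP[/hM h w1].
rewrite hornerMXaddC.
have := nmB_ge (p.[w] * w) (- c); rewrite opprK nmN nmM.
have := nm_ge0 p.[w]; nra.
Qed.

Lemma cpoly_map_continuous (g : cpoly R) : continuous (cpoly_map g).
Proof.
case=> [z|] A.
  move=> /nbhs_fin[d d0 dA]; apply/nbhs_fin.
  have [L L0 hL] := poly_lipschitz (val g) (nm z + 1).
  exists (Num.min 1 (d / L)); first by rewrite lt_min ltr01 divr_gt0.
  move=> w; rewrite lt_min => /andP[h1 h2]; apply: dA.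
  rewrite (le_lt_trans (hL _ _ _ _))//; first by rewrite lerDl.
    by have := nmB_ge w z; rewrite nm_distC; lra.
  by rewrite -ltr_pdivlMl// mulrC.
move=> /nbhs_infty[A0 [M MA]]; apply/nbhs_infty; split => //.
have [M' hM] := poly_to_infty M (valP g).
by exists M' => w /hM /MA.
Qed.

Lemma closed_poly_split (p : {poly R[i]}) (w : R[i]) : (1 < size p)%N ->
  exists2 s : seq R[i], size s = (size p).-1 &
    p - w%:P = lead_coef p *: \prod_(z <- s) ('X - z%:P).
Proof.
move=> p1; have ltc : (size (- w%:P : {poly R[i]}) < size p)%N.
  by rewrite size_polyN (leq_ltn_trans (size_polyC_leq1 _)).
have [s hs] := closed_field_poly_normal (p - w%:P).
move: hs; rewrite lead_coefDl// => hs; exists s => //.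
have := congr1 (fun q : {poly R[i]} => size q) hs.
rewrite size_polyDl// size_scale ?lead_coef_eq0 ?size_prod_XsubC.
  by move=> ->.
by rewrite -size_poly_gt0 (ltn_trans _ p1).
Qed.

(** Openness by factoring p - w: if no root lies within d of z, every linear factor has modulus at
    least d at z, so |p(z) - w| is at least |lead_coef p| d^deg. *)
Lemma poly_open (p : {poly R[i]}) z (d : R) : (1 < size p)%N -> 0 < d ->
  exists2 e : R, 0 < e &
    forall w, nm (p.[z] - w) < e -> exists2 z', nm (z - z') < d & p.[z'] = w.
Proof.
move=> p1 d0.
have lc0 : 0 < nm (lead_coef p).
  by rewrite nm_gt0 lead_coef_eq0 -size_poly_gt0 (ltn_trans _ p1).
exists (nm (lead_coef p) * d ^+ (size p).-1); first by rewrite mulr_gt0 ?exprn_gt0.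
move=> w hw; have [s ss hs] := closed_poly_split w p1.
have ev z' : p.[z'] - w = lead_coef p * \prod_(r <- s) (z' - r).
  have := congr1 (horner^~ z') hs; rewrite hornerD hornerN hornerC hornerZ => ->.
  by rewrite horner_prod; congr (_ * _); apply: eq_bigr => r _; rewrite !hornerE.
have [/hasP[r rs zr]|/hasPn H] := boolP (has (fun r => nm (z - r) < d) s).
  exists r => //; apply/eqP; rewrite -subr_eq0 ev (big_rem r)//= subrr mul0r mulr0.
  by [].
exfalso; move: hw; rewrite ev nmM ltr_pM2l// nm_prod ltNge => /negP; apply.
rewrite -ss; move: H; elim: s {ss hs ev} => [|a s IH] H; first by rewrite big_nil.
rewrite big_cons exprS ler_pM ?(ltW d0) ?exprn_ge0//.
- by rewrite ltW.
- by rewrite leNgt H ?mem_head.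
- by apply: IH => x xs; rewrite H// inE xs orbT.
Qed.

End SphereTopology.

(** * Connectedness by chains *)

Section Chains.

Inductive chain (T : Type) (P : set T) (r : T -> T -> Prop) : T -> T -> Prop :=
| chain_refl x : P x -> chain P r x x
| chain_step x y z : P x -> r x y -> chain P r y z -> chain P r x z.

Lemma chain_trans (T : Type) (P : set T) r (x y z : T) :
  chain P r x y -> chain P r y z -> chain P r x z.
Proof.
elim=> [//|a b c Pa rab _ IH h]; exact: chain_step Pa rab (IH h).
Qed.

Lemma chain_l (T : Type) (P : set T) r (x y : T) : chain P r x y -> P x.
Proof. by case. Qed.

Lemma chain1 (T : Type) (P : set T) (r : T -> T -> Prop) (x y : T) :
  P x -> P y -> r x y -> chain P r x y.
Proof. by move=> Px Py xy; apply: chain_step xy _ => //; exact: chain_refl. Qed.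

Lemma chain_image (T U : Type) (f : T -> U) (P : set T) (Q : set U)
    (r : T -> T -> Prop) (r' : U -> U -> Prop) (x y : T) :
  (forall x, P x -> Q (f x)) ->
  (forall x y, P x -> P y -> r x y -> r' (f x) (f y)) ->
  chain P r x y -> chain Q r' (f x) (f y).
Proof.
move=> PQ rr; elim=> [a Pa|a b c Pa rab ch IH]; first by apply: chain_refl; exact: PQ.
by apply: chain_step IH; [exact: PQ|apply: rr => //; exact: chain_l ch].
Qed.

Lemma chain_mono (T : Type) (A B : set T) (r r' : T -> T -> Prop) x y :
  A `<=` B -> (forall a b, r a b -> r' a b) -> chain A r x y -> chain B r' x y.
Proof.
move=> AB rr; elim=> [a Aa|a b c Aa rab _ IH]; first by apply: chain_refl; exact: AB.
by apply: chain_step IH; [exact: AB|exact: rr].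
Qed.

Lemma chain_sym (T : Type) (P : set T) (r : T -> T -> Prop) (x y : T) :
  (forall x y, r x y -> r y x) -> chain P r x y -> chain P r y x.
Proof.
move=> rs; elim=> [a Pa|a b c Pa rab ch IH]; first exact: chain_refl.
by apply: chain_trans IH _; apply: chain1 => //; [exact: chain_l ch|exact: rs].
Qed.

(** [X] and [Y] may overlap: the alternative [a = b] covers a chain that ends in both. *)
Lemma chain_crosses (T : Type) (P X Y : set T) r (x y : T) :
  P = X `|` Y -> chain P r x y -> X x -> Y y ->
  exists a b, [/\ X a, Y b & r a b \/ a = b].
Proof.
move=> PE; elim=> [a _ Xa Ya|a b c Pa rab ch IH Xa Yc].
  by exists a, a; split => //; right.
have : P b by exact: chain_l ch.
rewrite PE => -[Xb|Yb]; first exact: IH.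
by exists a, b; split => //; left.
Qed.

(** A separation of K would be crossed by chains of every step, giving pairs at distance below 1 /
    (k + 1) on opposite sides. By compactness the first members cluster at some p in K, and p then
    lies in the closures of both sides. *)
Lemma connected_of_chains (R : realType) (K : set (rsphere R)) : compact K ->
  (forall e : R, 0 < e -> forall x y, K x -> K y ->
     chain K (fun a b => spherical_dist a b < e) x y) ->
  connected K.
Proof.
move=> cK ch; apply: contrapT => nK; have := (connectedPn K).1 nK; case=> E [E0 KE [s1 s2]].
have [x Ex] := E0 false; have [y Ey] := E0 true.
have near_pair (e : R) : 0 < e ->
    exists ab, [/\ E false ab.1, E true ab.2 & spherical_dist ab.1 ab.2 < e].
  move=> e0.
  have Kx : K x by rewrite KE; left.
  have Ky : K y by rewrite KE; right.
  have [a [b [Ea Eb]]] := chain_crosses KE (ch e e0 x y Kx Ky) Ex Ey.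
  move=> h; exists (a, b); split => //=; case: h => [//|->].
  by rewrite spherical_distxx.
have [u hu] := choice (fun k : nat => near_pair k.+1%:R^-1 (ltac:(by rewrite invr_gt0 ltr0n))).
have [p [Kp clp]] : K `&` cluster ((fun k => (u k).1) @ \oo) !=set0.
  apply: cK; exists 0%N => // k _; rewrite /= KE; left; by have [] := hu k.
have clf : closure (E false) p.
  move=> A nA; have [//|q [Eq Aq]] := clp (E false) A _ nA.
    by exists 0%N => // k _; have [] := hu k.
  by exists q.
have clt : closure (E true) p.
  move=> A; rewrite -nbhs_ballE => -[e e0 eA].
  pose N := Num.truncn (2 / e).
  have : nbhs p (ball p (e / 2)) by apply: nbhsx_ballx; rewrite divr_gt0.
  move=> /(clp [set (u k).1 | k in [set k | (N < k)%N]]) [].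
    by exists N.+1 => // k Nk; exists k.
  move=> _ [[k Nk <-]]; rewrite ball_sphereE => h.
  exists (u k).2; split; first by have [] := hu k.
  apply: eA; rewrite ball_sphereE (le_lt_trans (spherical_dist_triangle (u k).1 _ _))//.
  rewrite [ltRHS]splitr ltrD//; have [_ _ /lt_le_trans->//] := hu k.
  rewrite -[leRHS]invrK lef_pV2 ?posrE ?invr_gt0 ?divr_gt0// invf_div.
  rewrite (le_trans (ltW (truncnS_gt _)))// ler_nat.
  exact: (leq_trans Nk).
have [Ef|Et] : E false p \/ E true p by move: Kp; rewrite KE.
- have : (E false `&` closure (E true)) p by [].
  by rewrite s2.
- have : (closure (E false) `&` E true) p by [].
  by rewrite s1.
Qed.

End Chains.

(** * Normal families and Julia sets *)

Section Subsequences.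

Definition frequently (P : nat -> Prop) := forall N, exists2 m, (N <= m)%N & P m.

Lemma frequently_color (T : finType) (c : nat -> T) (P : nat -> Prop) :
  frequently P -> exists t, frequently (fun m => P m /\ c m = t).
Proof.
move=> fP; apply: contrapT => /forallNP nf.
have /choice[N hN] t : exists N, forall m, (N <= m)%N -> P m -> c m <> t.
  have /existsNP[N /forall2NP hN] := nf t; exists N => m Nm Pm cm.
  by have [//|[]] := hN m.
have [m Nm Pm] := fP (\max_t N t).
by apply: (hN (c m) m) => //; rewrite (leq_trans _ Nm)// leq_bigmax.
Qed.

Lemma extract_subsequence (P : nat -> nat -> Prop) :
  (forall k, frequently (P k)) ->
  exists2 phi : nat -> nat, {homo phi : i j / (i < j)%N} & forall k, P k (phi k).
Proof.
move=> fP; have /choice[F hF] (kN : nat * nat) : exists m, (kN.2 <= m)%N /\ P kN.1 m.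
  by have [m] := fP kN.1 kN.2; exists m.
pose phi := fix phi k := if k is k'.+1 then F (k, (phi k').+1) else F (0%N, 0%N).
exists phi; last by case=> [|k]; [have [] := hF (0, 0)%N|have [] := hF (k.+1, (phi k).+1)].
apply: homo_ltn => [|k]; first exact: ltn_trans.
by have [] := hF (k.+1, (phi k).+1).
Qed.

Lemma homo_leq_id (phi : nat -> nat) k :
  {homo phi : i j / (i < j)%N} -> (k <= phi k)%N.
Proof.
by move=> hphi; elim: k => // k IH; rewrite (leq_ltn_trans IH)// hphi.
Qed.

End Subsequences.

Section Normality.
Variable R : realType.
Implicit Types (G : set (cpoly R)) (U K : set (rsphere R)).

Lemma uniform_cvgP K (u : nat -> rsphere R -> rsphere R) (f : rsphere R -> rsphere R) :
  {uniform K, u @ \oo --> f} <->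
  forall e : R, 0 < e -> exists N, forall k, (N <= k)%N ->
    forall x, K x -> spherical_dist (f x) (u k x) < e.
Proof.
split=> [H e e0|H A].
  have /H[N _ hN] : nbhs (f : {uniform` K -> rsphere R})
      [set g | forall x, K x -> spherical_dist (f x) (g x) < e].
    apply/uniform_nbhs; exists [set xy | ball xy.1 e xy.2].
    split; first by rewrite -entourage_ballE; exists e.
    by move=> g hg x /hg /=; rewrite ball_sphereE.
  by exists N => k Nk x Kx; exact: (hN k Nk).
move=> /uniform_nbhs[E [entE EA]].
move: entE; rewrite -entourage_ballE => -[e /= e0 he].
have [N hN] := H e e0; exists N => // k Nk; apply: EA => x Kx.
by apply: he => /=; rewrite ball_sphereE; exact: hN.
Qed.

Lemma normal_onP G U : normal_on G U <->
  forall g_ : nat -> cpoly R, (forall k, G (g_ k)) ->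
  exists phi : nat -> nat, {homo phi : i j / (i < j)%N} /\
  exists f : rsphere R -> rsphere R,
  forall K, compact K -> K `<=` U -> forall e : R, 0 < e ->
    exists N, forall k, (N <= k)%N -> forall x, K x ->
      spherical_dist (f x) (cpoly_map (g_ (phi k)) x) < e.
Proof.
split=> H g_ Gg; have [phi [hphi [f hf]]] := H g_ Gg; exists phi; split => //;
  by exists f => K cK KU; apply/uniform_cvgP; exact: hf.
Qed.

Lemma fatou_set_open G : open (fatou_set G).
Proof.
rewrite openE => z [U [oU Uz] nU].
by apply: filterS (open_nbhs_nbhs (conj oU Uz)) => y Uy; exists U.
Qed.

Lemma julia_set_closed G : closed (julia_set G).
Proof. exact/open_closedC/fatou_set_open. Qed.

Lemma cpoly_compA (f g h : cpoly R) :
  cpoly_comp f (cpoly_comp g h) = cpoly_comp (cpoly_comp f g) h.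
Proof. by apply: val_inj => /=; rewrite comp_polyA. Qed.

End Normality.

(** * Semigroups with finitely many generators *)

Section FiniteType.
Variables (R : realType) (I : finType) (h : I -> cpoly R).

Local Notation G := (semigroup_gen (range h)).

Lemma gen_mem i : G (h i).
Proof. by move=> A [_]; apply; exists i. Qed.

Lemma gen_comp f g : G f -> G g -> G (cpoly_comp f g).
Proof.
move=> Gf Gg A AG; have [cA _] := AG.
by apply: cA; [exact: (Gf A AG)|exact: (Gg A AG)].
Qed.

Lemma gen_ind (P : cpoly R -> Prop) : (forall i, P (h i)) ->
  (forall f g, P f -> P g -> P (cpoly_comp f g)) -> forall g, G g -> P g.
Proof.
move=> Ph Pc g; apply; split; first by move=> f k; exact: Pc.
by move=> _ [i _ <-].
Qed.

Lemma gen_right g : G g ->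
  exists i, g = h i \/ exists2 g', G g' & g = cpoly_comp g' (h i).
Proof.
move=> Gg; suff [] : G g /\ (exists i, g = h i \/
    exists2 g', G g' & g = cpoly_comp g' (h i)) by [].
move: g Gg; apply: gen_ind => [i|f g [Gf _] [Gg [i hi]]].
  by split; [exact: gen_mem|exists i; left].
split; first exact: gen_comp.
exists i; right; case: hi => [->|[g' Gg' ->]]; first by exists f.
by exists (cpoly_comp f g'); [exact: gen_comp|rewrite cpoly_compA].
Qed.

Fixpoint word_map (w : seq I) : rsphere R -> rsphere R :=
  if w is i :: w' then cpoly_map (h i) \o word_map w' else id.

Lemma word_map_cat w1 w2 : word_map (w1 ++ w2) = word_map w1 \o word_map w2.
Proof. by elim: w1 => //= i w ->. Qed.

Lemma gen_word g : G g -> exists2 w, w != [::] & cpoly_map g = word_map w.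
Proof.
move: g; apply: gen_ind => [i|f g [w1 w10 e1] [w2 w20 e2]]; first by exists [:: i].
exists (w1 ++ w2); last by rewrite word_map_cat -e1 -e2 cpoly_mapE.
by rewrite -size_eq0 size_cat addn_eq0 negb_and size_eq0 w10.
Qed.

Lemma word_map_infty w : word_map w None = None.
Proof. by elim: w => //= i w ->. Qed.

(** Along a sequence of words, either bounded lengths recur, and then one word occurs infinitely
    often and gives a constant subsequence; or the lengths tend to infinity, the maps become nearly
    constant on X, and a cluster point in C of the images of x0 is the limit. *)
Lemma normal_contracting (X C : set (rsphere R)) x0 : X x0 ->
  (forall e : R, 0 < e -> exists p, forall w, (p <= size w)%N ->
     forall x y, X x -> X y -> spherical_dist (word_map w x) (word_map w y) < e) ->
  compact C -> (forall w, C (word_map w x0)) ->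
  normal_on G X.
Proof.
move=> Xx0 contr cC Cx0; apply/normal_onP => g_ Gg.
have /choice[w_ hw] k : exists w, cpoly_map (g_ k) = word_map w.
  by have [w _ ->] := gen_word (Gg k); exists w.
have [[p fp]|np] := pselect (exists p, frequently (fun m => (size (w_ m) <= p)%N)).
  have [w fw] := frequently_color (fun m => insub_bseq p (w_ m)) fp.
  have [phi hphi hw'] := extract_subsequence (fun=> fw).
  exists phi; split => //; exists (word_map w) => K _ _ e e0.
  exists 0%N => k _ x _; have [sw eqw] := hw' k; rewrite hw -eqw.
  by rewrite /insub_bseq insubdK// spherical_distxx.
have evl p : exists N, forall m, (N <= m)%N -> (p <= size (w_ m))%N.
  apply: contrapT => /forallNP H; apply: np; exists p => N.
  have /existsNP[m /not_implyP[Nm /negP]] := H N.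
  by rewrite -ltnNge => /ltnW; exists m.
have [q [Cq clq]] : C `&` cluster ((fun k => word_map (w_ k) x0) @ \oo) !=set0.
  by apply: cC; exists 0%N => // k _; exact: Cx0.
have fq k : frequently (fun m => spherical_dist q (word_map (w_ m) x0) < k.+1%:R^-1).
  move=> N; have [||_ [[m Nm <-]]] := clq [set word_map (w_ m) x0 | m in [set m | (N <= m)%N]]
      (ball q k.+1%:R^-1).
  - by exists N => // m Nm; exists m.
  - by apply: nbhsx_ballx; rewrite invr_gt0.
  - by rewrite ball_sphereE => hm; exists m.
have [phi hphi hq] := extract_subsequence fq.
exists phi; split => //; exists (fun=> q) => K _ KX e e0.
have e20 : 0 < e / 2 by rewrite divr_gt0.
have [p hp] := contr _ e20.
have [N1 hN1] := evl p.
pose N2 := Num.truncn (e / 2)^-1.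
exists (maxn N1 N2) => k; rewrite geq_max => /andP[k1 k2] x Kx.
rewrite (le_lt_trans (spherical_dist_triangle (word_map (w_ (phi k)) x0) _ _))//.
rewrite [ltRHS]splitr hw ltrD//.
  rewrite (lt_le_trans (hq k))// -[leRHS]invrK lef_pV2 ?posrE ?invr_gt0//.
  by rewrite (le_trans (ltW (truncnS_gt _)))// ler_nat ltnS.
apply: hp => //; last exact: KX.
by apply: hN1; rewrite (leq_trans k1)// homo_leq_id.
Qed.

(** Every element factors through a generator applied first. Infinitely many terms of a sequence
    share that generator [h i], and a convergent subsequence of the remaining factors near the image
    of z is pulled back by the continuous map [h i]. *)
Lemma fatou_of_images z : (forall i, fatou_set G (cpoly_map (h i) z)) ->
  fatou_set G z.
Proof.
move=> hz; have /choice[U hU] i : exists U, open_nbhs (cpoly_map (h i) z) U /\ normal_on G U.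
  by have [U] := hz i; exists U.
pose V := [set x | forall i, U i (cpoly_map (h i) x)].
have oV : open V.
  rewrite openE => x Vx; rewrite /interior.
  have : \forall y \near x, forall i, U i (cpoly_map (h i) y).
    apply: (@filter_forall _ I (fun i y => U i (cpoly_map (h i) y)) (nbhs x)) => i.
    apply: (@cpoly_map_continuous _ (h i) x (U i)).
    by apply: open_nbhs_nbhs; split; [have [[]] := hU i|exact: Vx].
  by [].
exists V; first by split => // i; have [[]] := hU i.
apply/normal_onP => g_ Gg.
(* [None] marks a term that is itself a generator, with no remaining factor; infinitely many of
   these again give a constant subsequence. *)
have /choice[dec hdec] k : exists io : I * option (cpoly R),
    if io.2 is Some g' then G g' /\ g_ k = cpoly_comp g' (h io.1)
    else g_ k = h io.1.
  have [i [->|[g' Gg' ->]]] := gen_right (Gg k); first by exists (i, None).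
  by exists (i, Some g').
have fT : frequently (fun=> True) by move=> N; exists N.
have [[i b] fib] := frequently_color (fun m => ((dec m).1, isSome (dec m).2)) fT.
have [phi hphi hp] := extract_subsequence (fun=> fib).
case: b fib hp => _ hp.
- have /choice[g' hg'] k : exists g', G g' /\ g_ (phi k) = cpoly_comp g' (h i).
    have := hdec (phi k); have [_] := hp k.
    case: (dec (phi k)) => j [g'|] /=; last by case.
    by case=> -> [? ?]; exists g'.
  have [_ /normal_onP/(_ g')] := hU i.
  case=> [k|psi [hpsi [f hf]]]; first by have [] := hg' k.
  exists (phi \o psi); split; first by move=> a b /hpsi /hphi.
  exists (f \o cpoly_map (h i)) => K cK KV e e0.
  have [||N hN] := hf (cpoly_map (h i) @` K) _ _ e e0.
  - apply: continuous_compact => //; apply: continuous_subspaceT.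
    exact: cpoly_map_continuous.
  - by move=> _ [x Kx <-]; exact: KV.
  exists N => k Nk x Kx /=; have [_ ->] := hg' (psi k).
  by rewrite cpoly_mapE; apply: hN => //; exists x.
- exists phi; split => //; exists (cpoly_map (h i)) => K _ _ e e0.
  exists 0%N => k _ x _; have := hdec (phi k); have [_] := hp k.
  case: (dec (phi k)) => j [g'|] /=; first by case.
  by case=> -> ->; rewrite spherical_distxx.
Qed.

(** Sequences are composed with [h i] on the right and normality at z is used. By openness of [h i],
    a neighborhood of the image is covered by a small disk around z, and the limit is carried over
    along a section [s]; uniform convergence does not ask [s] to be continuous. *)
Lemma fatou_image z i : fatou_set G z -> fatou_set G (cpoly_map (h i) z).
Proof.
case: z => [c|//] [U [oU Uc] /normal_onP nU].
have /nbhs_fin[d d0 dU] : nbhs (Some c : rsphere R) U by apply: open_nbhs_nbhs.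
have d20 : 0 < d / 2 by rewrite divr_gt0.
have [e e0 he] := poly_open c (valP (h i)) d20.
pose V := [set p : rsphere R | exists2 w, p = Some w & nm ((val (h i)).[c] - w) < e].
exists V.
  split; last by exists (val (h i)).[c] => //; rewrite subrr nm0.
  rewrite openE => _ [w -> hw]; apply/nbhs_fin.
  exists (e - nm ((val (h i)).[c] - w)); first by rewrite subr_gt0.
  move=> w' hw'; exists w' => //.
  by have := nm_triangle w (val (h i)).[c] w'; lra.
have /choice[s hs] (p : rsphere R) : exists z', V p ->
    exists2 y, z' = Some y & nm (c - y) < d / 2 /\ cpoly_map (h i) z' = p.
  have [[w -> /he[z' h1 h2]]|nV] := pselect (V p); last by exists None.
  by exists (Some z') => _; exists z' => //; split => //=; rewrite h2.
apply/normal_onP => g_ Gg.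
have [k|phi [hphi [f hf]]] := nU (fun k => cpoly_comp (g_ k) (h i)).
  exact: gen_comp (Gg k) (gen_mem i).
exists phi; split => //; exists (f \o s) => K cK KV e1 e10.
have [|N hN] := hf _ (@compact_disk _ c (d / 2)) _ e1 e10.
  by move=> _ [y -> hy]; apply: dU; rewrite nm_distC; lra.
exists N => k Nk p Kp.
have [y sy [hy hsp]] := hs p (KV p Kp).
have := hN k Nk (s p); rewrite cpoly_mapE /= hsp; apply.
by exists y => //; rewrite nm_distC ltW.
Qed.

(** Backward self-similarity: J is the union of its preimages under the generators. One inclusion
    rests on the finiteness of the family, the other on openness. *)
Lemma julia_invariant z :
  julia_set G z <-> exists i, julia_set G (cpoly_map (h i) z).
Proof.
split=> [Jz|[i Jz] Fz]; last exact/Jz/fatou_image.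
by apply: contrapT => /forallNP H; apply: Jz; apply: fatou_of_images => i; exact: contrapT (H i).
Qed.

End FiniteType.

(** * Semigroups contracting an inner disk and expanding near infinity *)

Section HyperbolicDynamics.
Variables (R : realType) (I : finType) (h : I -> cpoly R) (rho Rb : R).
Hypothesis rho_lt : rho < 1 / 2.
Hypothesis Rb_gt : 1 / 2 < Rb.
Hypothesis h_inner : forall i z, nm z <= 1 / 2 -> nm (val (h i)).[z] <= rho.
Hypothesis h_contract : forall i z z', nm z <= 1 / 2 -> nm z' <= 1 / 2 ->
  nm ((val (h i)).[z] - (val (h i)).[z']) <= 1 / 2 * nm (z - z').
Hypothesis h_outer : forall i z, Rb <= nm z -> 2 * nm z <= nm (val (h i)).[z].
Hypothesis h_crit : forall i z, root (val (h i))^`() z -> nm z <= 1 / 2.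
Hypothesis h_deg : forall i, (2 <= cpoly_deg (h i))%N.

Local Notation G := (semigroup_gen (range h)).

Fixpoint word_val (w : seq I) (z : R[i]) : R[i] :=
  if w is i :: w' then (val (h i)).[word_val w' z] else z.

Lemma word_map_fin w z : word_map h w (Some z) = Some (word_val w z).
Proof. by elim: w => //= i w ->. Qed.

Lemma word_val_inner w z : nm z <= 1 / 2 -> nm (word_val w z) <= 1 / 2.
Proof.
move=> z1; elim: w => //= i w /(h_inner i) IH.
exact: le_trans IH (ltW rho_lt).
Qed.

Lemma word_val_contract w z z' : nm z <= 1 / 2 -> nm z' <= 1 / 2 ->
  nm (word_val w z - word_val w z') <= (1 / 2) ^+ size w * nm (z - z').
Proof.
move=> z1 z'1; elim: w => [|i w IH] /=; first by rewrite expr0 mul1r.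
rewrite (le_trans (h_contract _ (word_val_inner w z1) (word_val_inner w z'1)))//.
by rewrite exprS -[leRHS]mulrA ler_wpM2l// divr_ge0.
Qed.

Lemma word_val_outer w z : Rb <= nm z -> Rb * 2 ^+ size w <= nm (word_val w z).
Proof.
move=> zR; elim: w => [|i w IH] /=; first by rewrite mulr1.
have Rb0 : 0 < Rb by rewrite (lt_trans _ Rb_gt)// divr_gt0.
have e1 : (1 : R) <= 2 ^+ size w by rewrite exprn_ege1// ler1n.
have h1 : Rb <= nm (word_val w z) by rewrite (le_trans _ IH)// ler_peMr// ltW.
rewrite (le_trans _ (h_outer _ h1))// exprS mulrCA ler_pM2l//.
Qed.

Lemma normal_onS (U V : set (rsphere R)) : U `<=` V -> normal_on G V -> normal_on G U.
Proof.
move=> UV nV g_ Gg; have [phi [hphi [f hf]]] := nV g_ Gg.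
exists phi; split => //; exists f => K cK KU; apply: hf => //.
exact: subset_trans KU UV.
Qed.

Lemma fatou_inner z : nm z < 1 / 2 -> fatou_set G (Some z).
Proof.
move=> z1; pose U := [set p : rsphere R | exists2 z, p = Some z & nm z < 1 / 2].
exists U.
  split; last by exists z.
  rewrite openE => _ [y -> y1]; apply/nbhs_fin; exists (1 / 2 - nm y).
    by rewrite subr_gt0.
  by move=> w hw; exists w => //; have := nmB_ge w y; rewrite nm_distC; lra.
pose X := [set p : rsphere R | exists2 z, p = Some z & nm (z - 0) <= 1 / 2].
have UX : U `<=` X by move=> _ [y -> y1]; exists y => //; rewrite subr0 ltW.
apply: normal_onS UX _.
apply: (@normal_contracting _ _ _ X X (Some 0)).
- by exists 0 => //; rewrite subr0 nm0 divr_ge0.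
- move=> e e0; have [d d0 hd] := gap_small e0.
  have [p hp] : exists p, (1 / 2) ^+ p < d / 2 :> R.
    have d20 : 0 < d / 2 by rewrite divr_gt0.
    have /cvgrPdist_lt/(_ _ d20)[p _ hp] : (1 / 2 : R) ^+ n @[n --> \oo] --> (0 : R).
      by apply: cvg_expr; rewrite ger0_norm ?divr_ge0// ltr_pdivrMr// mul1r ltr1n.
    exists p; have := hp p (leqnn p).
    by rewrite /= sub0r normrN ger0_norm// exprn_ge0// divr_ge0.
  exists p => w pw _ _ [x -> hx] [y -> hy]; rewrite subr0 in hx; rewrite subr0 in hy.
  (* The disk has diameter 1, so the distance q of the two images is at most a = (1/2)^(size w) <=
     1, and the gap is at most 2 q^2 <= 2 a < d. *)
  rewrite !word_map_fin; apply: hd; rewrite (le_lt_trans (gap_fin_le _ _))//.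
  have := word_val_contract w hx hy.
  set q := nm (word_val _ _ - _); set a := (1 / 2) ^+ size w.
  have ap : a <= (1 / 2) ^+ p by rewrite ler_wiXn2l// ?divr_ge0// ler_pdivrMr// mul1r ler1n.
  have a1 : a <= 1 by rewrite exprn_ile1 ?divr_ge0// ler_pdivrMr// mul1r ler1n.
  have a0 : 0 <= a by rewrite exprn_ge0// divr_ge0.
  have := nm_ge0 (word_val w x - word_val w y); rewrite -/q.
  have := nmB x y; have := nm_ge0 (x - y).
  move=> h1 h2 q0 qa; have {}qa : q <= a by nra.
  have : q ^+ 2 <= a by nra.
  lra.
- exact: compact_disk.
- move=> w; rewrite word_map_fin; exists (word_val w 0) => //.
  by rewrite subr0 word_val_inner// nm0 divr_ge0.
Qed.

Lemma fatou_outer (p : rsphere R) : (forall z, p = Some z -> Rb < nm z) ->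
  fatou_set G p.
Proof.
move=> hp; pose U := [set p : rsphere R | forall z, p = Some z -> Rb < nm z].
exists U.
  split => //.
  rewrite openE => -[y hy|_].
    have /= y1 := hy y erefl.
    apply/nbhs_fin; exists (nm y - Rb); first by rewrite subr_gt0.
    by move=> w hw z [<-]; have := nmB_ge y w; lra.
  by apply/nbhs_infty; split => //; exists Rb => w hw z [<-].
have Rb0 : 0 < Rb by rewrite (lt_trans _ Rb_gt)// divr_gt0.
apply: (@normal_contracting _ _ _ U [set None] None) => //.
- move=> e e0; have e20 : 0 < e / 2 by rewrite divr_gt0.
  have [d d0 hd] := gap_small e20.
  pose p0 := Num.truncn (2 / (Rb ^+ 2 * d)).
  exists p0 => w pw.
  suff H x : U x -> spherical_dist (word_map h w x) None < e / 2.
    move=> x y /H hx /H; rewrite spherical_dist_sym => hy.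
    rewrite (le_lt_trans (spherical_dist_triangle None _ _))//.
    by rewrite [ltRHS]splitr ltrD.
  case: x => [x Ux|_]; last by rewrite word_map_infty spherical_distxx.
  rewrite word_map_fin; apply: hd; rewrite gap_infty.
  have := word_val_outer w (ltW (Ux x erefl)).
  set q := nm _ => hq.
  have q2 : (Rb * 2 ^+ size w) ^+ 2 <= q ^+ 2.
    by rewrite ler_sqr// nnegrE ?nm_ge0// mulr_ge0 ?exprn_ge0// ltW.
  rewrite ltr_pdivrMr ?ltr_pwDl ?sqr_ge0//.
  pose T : R := 2 ^+ size w.
  have hT : 2 / (Rb ^+ 2 * d) < T.
    rewrite (lt_le_trans (truncnS_gt _))// /T -natrX ler_nat -/p0.
    by rewrite (leq_ltn_trans pw)// ltn_expl.
  have T1 : 1 <= T by rewrite exprn_ege1// ler1n.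
  have Rd0 : 0 < Rb ^+ 2 * d by rewrite mulr_gt0 ?exprn_gt0.
  rewrite ltr_pdivrMr// in hT.
  have q2' : (Rb ^+ 2 * d) * T <= d * q ^+ 2.
    apply: (@le_trans _ _ (d * (Rb * T) ^+ 2)); last by rewrite ler_pM2l.
    by rewrite exprMn mulrCA mulrA ler_pM2l// expr2 ler_peMl// (le_trans ler01).
  by rewrite mulrDr mulr1; lra.
- exact: compact_set1.
- by move=> w; rewrite word_map_infty.
Qed.

Lemma julia_annulus p : julia_set G p ->
  exists2 z, p = Some z & 1 / 2 <= nm z <= Rb.
Proof.
case: p => [z|] Jz; last by exfalso; apply: Jz; exact: fatou_outer.
exists z => //; apply/andP; split; rewrite leNgt; apply/negP => hz; apply: Jz.
  exact: fatou_inner.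
by apply: fatou_outer => _ [<-].
Qed.

Lemma compact_julia : compact (julia_set G).
Proof.
apply: (subclosed_compact (@julia_set_closed _ _) (@compact_disk _ 0 Rb)).
by move=> p /julia_annulus[z -> /andP[_ hz]]; exists z => //; rewrite subr0.
Qed.

(** The two claims are proved together: by the chain rule a critical point of a composite is
    critical for the inner map or is sent by it to a critical point of the outer one, and in the
    first case the invariance of the disk is needed. *)
Lemma gen_postcritical g : G g ->
  (forall z, nm z <= 1 / 2 -> nm (val g).[z] <= 1 / 2) /\
  (forall z, root (val g)^`() z -> nm (val g).[z] <= 1 / 2).
Proof.
move: g; apply: gen_ind => [i|f g [f1 f2] [g1 g2]].
  have hi z : nm z <= 1 / 2 -> nm (val (h i)).[z] <= 1 / 2.
    by move=> /(h_inner i) hz; exact: le_trans hz (ltW rho_lt).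
  by split => // z /h_crit; exact: hi.
split=> z /=; first by move=> hz; rewrite horner_comp; apply: f1; exact: g1.
rewrite horner_comp deriv_comp rootM root_comp => /orP[|/g2]; first exact: f2.
exact: f1.
Qed.

Lemma gen_degree g : G g -> (2 <= cpoly_deg g)%N.
Proof.
move: g; apply: gen_ind => [//|f g f1 g1].
rewrite /cpoly_deg /= size_comp_poly.
by rewrite (leq_trans f1)// leq_pmulr// (ltn_trans _ g1).
Qed.

Lemma hyperbolic_postcritically_bounded (i0 : I) : postcritically_bounded G.
Proof.
split; [|exact: gen_degree|].
  by exists (range h) => //; exists (h i0); exists i0.
exists 1; split; first exact: real1.
move=> x x1 z /= Pz.
have z1 : nm z <= 1 / 2.
  rewrite leNgt; apply/negP => hz.
  have nz : nbhs (Some z : rsphere R) [set p | exists2 w, p = Some w & 1 / 2 < nm w].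
    apply/nbhs_fin; exists (nm z - 1 / 2); first by rewrite subr_gt0.
    by move=> w hw; exists w => //; have := nmB_ge z w; lra.
  have [p [[g Gg [[c|] /= hc <-]] [y]]] := Pz _ nz; last by [].
  by case=> <-; have [_ /(_ c hc)] := gen_postcritical Gg; lra.
apply: le_trans (ltW x1).
have -> : `|z| = (nm z)%:C by [].
by rewrite lecR; lra.
Qed.

(** The iterate of order k + 1: the semigroup does not contain the identity. *)
Fixpoint orbit_cpoly (i : I) (k : nat) : cpoly R :=
  if k is k'.+1 then cpoly_comp (h i) (orbit_cpoly i k') else h i.

Lemma orbit_cpoly_gen i k : G (orbit_cpoly i k).
Proof. by elim: k => [|k IH]; [exact: gen_mem|apply: gen_comp => //; exact: gen_mem]. Qed.

Lemma orbit_cpolyE i k z :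
  cpoly_map (orbit_cpoly i k) (Some z) = Some (word_val (nseq k.+1 i) z).
Proof.
elim: k => //= k IH; rewrite horner_comp; move: IH => /= [->].
by [].
Qed.

(** The point 0 lies in the inner disk and real points beyond [Rb] escape. Let t0 end the longest
    interval [0, t0) of points whose orbit under one generator enters the disk. The orbit of t0
    never enters it, while the orbits of points just below end up within radius [rho]. If t0 were a
    Fatou point, a subsequence of iterates would converge uniformly near t0 and keep these orbits
    close. *)
Lemma julia_nonempty (i0 : I) : julia_set G !=set0.
Proof.
pose orb k (t : R) := word_val (nseq k i0) t%:C.
pose B (t : R) := exists k, nm (orb k t) < 1 / 2.
have B0 : B 0 by exists 0%N; rewrite /orb nm_real normr0 divr_gt0.
have Rb0 : 0 < Rb by rewrite (lt_trans _ Rb_gt)// divr_gt0.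
have nB t : Rb <= t -> ~ B t.
  move=> tR [k]; have := @word_val_outer (nseq k i0) t%:C.
  rewrite nm_real ger0_norm; last by rewrite (le_trans (ltW Rb0)).
  move=> /(_ tR); rewrite -/(orb k t) size_nseq => h1 h2.
  have : Rb <= Rb * 2 ^+ k by rewrite ler_peMr ?exprn_ege1 ?ler1n// ltW.
  by move=> h3; have := le_lt_trans (le_trans h3 h1) h2; rewrite ltNge (ltW Rb_gt).
pose S := [set t : R | 0 <= t /\ forall s, 0 <= s <= t -> B s].
have S0 : S 0 by split => // s; rewrite -eq_le => /eqP <-.
have ubS : ubound S Rb.
  move=> t [t0 ht]; rewrite leNgt; apply/negP => tR.
  by apply: (nB t); [exact: ltW|apply: ht; rewrite t0 lexx].
have hsS : has_sup S by split; [exists 0|exists Rb].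
pose t0 := sup S.
have t0_ge0 : 0 <= t0 by apply: ub_le_sup => //; exists Rb.
have Blt s : 0 <= s -> s < t0 -> B s.
  move=> s0 st; have ts : 0 < t0 - s by rewrite subr_gt0.
  have [t [t1 ht]] := sup_adherent ts hsS.
  by rewrite -/t0 opprB addrC subrK => st'; apply: ht; rewrite s0 ltW.
have orb_cont k (t e : R) : 0 < e -> exists2 d : R, 0 < d &
    forall s, `|t - s| < d -> nm (orb k t - orb k s) < e.
  move=> e0; have orbE s : orb k s = (val (cpoly_iter k (h i0))).[s%:C].
    rewrite /orb; elim: k => [|k IH]; first by rewrite /= hornerX.
    by rewrite /= IH horner_comp.
  have [L L0 hL] := poly_lipschitz (val (cpoly_iter k (h i0))) (`|t| + 1).
  exists (Num.min 1 (e / L)); first by rewrite lt_min ltr01 divr_gt0.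
  move=> s; rewrite lt_min => /andP[s1 s2]; rewrite !orbE.
  rewrite (le_lt_trans (hL _ _ _ _))// ?nm_real; first by rewrite lerDl.
    by have := lerB_dist s t; rewrite distrC; lra.
  by rewrite -rmorphB nm_real -ltr_pdivlMl// mulrC.
have nBt0 : ~ B t0.
  move=> [k hk].
  have e0 : 0 < 1 / 2 - nm (orb k t0) by rewrite subr_gt0.
  have [d d0 hd] := orb_cont k t0 _ e0.
  have St : S (t0 + d / 2).
    split; first by rewrite addr_ge0// divr_ge0// ltW.
    move=> s /andP[s0 s1]; have [st|ts] := ltP s t0; first exact: Blt.
    exists k; have : `|t0 - s| < d by rewrite ler0_norm; lra.
    move=> /hd; rewrite nm_distC; have := nmB_ge (orb k s) (orb k t0); lra.
  have := ub_le_sup (ex_intro _ Rb ubS) St; rewrite -/t0; lra.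
have t0_gt0 : 0 < t0 by rewrite lt_neqAle t0_ge0 andbT; apply/eqP => t00; apply: nBt0; rewrite -t00.
apply: contrapT => /set0P/negP/negPn/eqP J0.
have [U [oU Ut] /normal_onP nU] : fatou_set G (Some t0%:C).
  by apply: contrapT => Jt; have : julia_set G (Some t0%:C) by []; rewrite J0.
have [phi [hphi [f hf]]] := nU _ (orbit_cpoly_gen i0).
have /nbhs_fin[d d0 dU] : nbhs (Some t0%:C : rsphere R) U by apply: open_nbhs_nbhs.
have [e0 e00 he0] := gap_small_fin rho (ltac:(by rewrite subr_gt0) : 0 < 1 / 2 - rho).
have [e1 e10 he1] := dist_small_gap e00.
(* Five distances are added: from time [phi K] to the limit and back to time [phi N] at t, across
   from t to t0 at time [phi N], and the same two steps at t0. *)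
have e5 : 0 < e1 / 5 by rewrite divr_gt0.
have [|N hN] := hf _ (@compact_disk _ t0%:C (d / 2)) _ _ e5.
  by move=> _ [y -> hy]; apply: dU; rewrite nm_distC; lra.
have : nbhs (cpoly_map (orbit_cpoly i0 (phi N)) (Some t0%:C))
    (ball (cpoly_map (orbit_cpoly i0 (phi N)) (Some t0%:C)) (e1 / 5)).
  exact: nbhsx_ballx.
move=> /cpoly_map_continuous/nbhs_fin[d1 d10 hd1].
pose m := Num.min t0 (Num.min d d1) / 2.
have [m0 mt md md1] : [/\ 0 < m, m < t0, m <= d / 2 & m < d1].
  have h0 : 0 < Num.min t0 (Num.min d d1) by rewrite !lt_min t0_gt0 d0.
  have h1 : Num.min t0 (Num.min d d1) <= t0 by rewrite ge_min lexx.
  have h2 : Num.min t0 (Num.min d d1) <= d by rewrite !ge_min lexx orbT.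
  have h3 : Num.min t0 (Num.min d d1) <= d1 by rewrite !ge_min lexx !orbT.
  by rewrite /m; split; lra.
pose t := t0 - m.
have tt : nm (t0%:C - t%:C) = m.
  rewrite -rmorphB nm_real /t opprB addrCA subrr addr0 gtr0_norm//.
have [k hk] : B t by apply: Blt; rewrite /t ?subr_ge0; lra.
have orb_in j : (k < j)%N -> nm (orb j t) <= rho.
  move=> kj; rewrite -(subnK kj) addnS /orb; elim: (j - k.+1)%N => [|a IH].
    by rewrite add0n; apply: h_inner; exact: ltW.
  by rewrite addSn; apply: h_inner; apply: le_trans IH (ltW rho_lt).
have orb_out j : 1 / 2 <= nm (orb j t0).
  by rewrite leNgt; apply/negP => hj; apply: nBt0; exists j.
pose K := maxn N k.
have D1 := hN N (leqnn N) (Some t0%:C); have D2 := hN N (leqnn N) (Some t%:C).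
have D3 := hN K (leq_maxl _ _) (Some t0%:C); have D4 := hN K (leq_maxl _ _) (Some t%:C).
have D5 : spherical_dist (cpoly_map (orbit_cpoly i0 (phi N)) (Some t0%:C))
   (cpoly_map (orbit_cpoly i0 (phi N)) (Some t%:C)) < e1 / 5.
  by apply: hd1; rewrite tt.
have P1 : exists2 z, Some t0%:C = Some z & nm (z - t0%:C) <= d / 2.
  by exists t0%:C => //; rewrite subrr nm0 divr_ge0// ltW.
have P2 : exists2 z, Some t%:C = Some z & nm (z - t0%:C) <= d / 2.
  by exists t%:C => //; rewrite nm_distC tt.
move/(_ P1): D1 => D1; move/(_ P2): D2 => D2; move/(_ P1): D3 => D3; move/(_ P2): D4 => D4.
rewrite !orbit_cpolyE in D1 D2 D3 D4 D5.
set u := f (Some t0%:C) in D1 D3; set v := f (Some t%:C) in D2 D4.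
have DD : spherical_dist (Some (word_val (nseq (phi K).+1 i0) t%:C))
   (Some (word_val (nseq (phi K).+1 i0) t0%:C)) < e1.
  have T1 := spherical_dist_triangle v (Some (word_val (nseq (phi K).+1 i0) t%:C))
   (Some (word_val (nseq (phi K).+1 i0) t0%:C)).
  have T2 := spherical_dist_triangle u v (Some (word_val (nseq (phi K).+1 i0) t0%:C)).
  have T3 := spherical_dist_triangle (Some (word_val (nseq (phi N).+1 i0) t%:C)) v u.
  have T4 := spherical_dist_triangle (Some (word_val (nseq (phi N).+1 i0) t0%:C))
    (Some (word_val (nseq (phi N).+1 i0) t%:C)) u.
  rewrite spherical_dist_sym in D4; rewrite spherical_dist_sym in D1.
  rewrite spherical_dist_sym in D5.
  lra.
have oi : nm (orb (phi K).+1 t) <= rho.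
  by apply: orb_in; rewrite ltnS (leq_trans (leq_maxr N k))// homo_leq_id.
have [w [<-]] := he0 _ _ oi (he1 _ _ DD).
have := orb_out (phi K).+1; have := nmB_ge (orb (phi K).+1 t0) (orb (phi K).+1 t).
rewrite nm_distC -/(orb (phi K).+1 t0) -/(orb (phi K).+1 t); lra.
Qed.

End HyperbolicDynamics.

(** * Complex exponential and logarithms *)

Section ComplexExponential.
Variable R : realType.
Implicit Types (u v z : R[i]) (x y : R).

Definition cexp u : R[i] := (expR (Re u) * cos (Im u)) +i* (expR (Re u) * sin (Im u)).

Definition tpi (m : int) : R[i] := 0 +i* (m%:~R * (pi *+ 2)).

Lemma cexpD u v : cexp (u + v) = cexp u * cexp v.
Proof.
case: u v => [a b] [c d]; rewrite /cexp /= expRD cosD sinD /=.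
by apply/eqP; rewrite eq_complex /=; apply/andP; split; apply/eqP; ring.
Qed.

Lemma nm_cexp u : nm (cexp u) = expR (Re u).
Proof.
apply/eqP; rewrite -(@eqrXn2 _ 2) ?nm_ge0 ?expR_ge0// nm_sqr /=.
by rewrite !exprMn -mulrDr cos2Dsin2 mulr1.
Qed.

Lemma cexp_neq0 u : cexp u != 0.
Proof. by rewrite -nm_gt0 nm_cexp expR_gt0. Qed.

Lemma cexp0 : cexp 0 = 1.
Proof. by rewrite /cexp /= expR0 cos0 sin0 mulr1 mulr0. Qed.

Lemma cexpN u : cexp (- u) = (cexp u)^-1.
Proof. by apply: (mulfI (cexp_neq0 u)); rewrite -cexpD subrr cexp0 divff ?cexp_neq0. Qed.

Lemma cexpMn u k : cexp (u *+ k) = cexp u ^+ k.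
Proof. by elim: k => [|k IH]; rewrite ?mulr0n ?cexp0// mulrS cexpD IH exprS. Qed.

Lemma tpiD a b : tpi (a + b) = tpi a + tpi b.
Proof. by apply/eqP; rewrite eq_complex /= addr0 eqxx/= intrD mulrDl. Qed.

Lemma tpi0 : tpi 0 = 0.
Proof. by rewrite /tpi mul0r. Qed.

Lemma tpiN a : tpi (- a) = - tpi a.
Proof. by apply/eqP; rewrite -addr_eq0 -tpiD addNr tpi0. Qed.

Lemma tpiMn a k : tpi (a *+ k) = tpi a *+ k.
Proof. by elim: k => [|k IH]; rewrite ?mulr0n ?tpi0// !mulrS tpiD IH. Qed.

Lemma nm_tpi1 : nm (tpi 1) = pi *+ 2.
Proof. by rewrite /= expr0n/= add0r sqrtr_sqr mul1r ger0_norm// mulrn_wge0// pi_ge0. Qed.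

Lemma cexp_tpi m : cexp (tpi m) = 1.
Proof.
have h1 : cexp (tpi 1) = 1.
  by rewrite /cexp /= mul1r expR0 cos2pi sin2pi mulr0 mulr1.
have hn (k : nat) : cexp (tpi k) = 1.
  by elim: k => [|k IH]; rewrite ?tpi0 ?cexp0// -addn1 PoszD tpiD cexpD IH h1 mulr1.
by case: m => k; rewrite ?NegzE ?tpiN ?cexpN hn ?invr1.
Qed.

Lemma floor_period (t : R) : exists m : int, 0 <= t - m%:~R * (pi *+ 2) < pi *+ 2.
Proof.
have p2 : 0 < pi *+ 2 :> R by rewrite mulrn_wgt0// pi_gt0.
have /andP[m1 m2] := floor_itv (t / (pi *+ 2)).
exists (Num.floor (t / (pi *+ 2))); rewrite subr_ge0 -ler_pdivlMr// m1/=.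
by move: m2; rewrite ltr_pdivrMr// intrD1 mulrDl mul1r ltrBlDr addrC.
Qed.

Lemma cexp_eq1 u : cexp u = 1 -> exists m, u = tpi m.
Proof.
move=> u1; have : nm (cexp u) = 1 by rewrite u1 nm1.
rewrite nm_cexp -expR0 => /expR_inj ru.
have [m /andP[m1 m2]] := floor_period (Im u); exists m.
have v1 : cexp (u - tpi m) = 1 by rewrite cexpD u1 cexpN cexp_tpi invr1 mulr1.
apply/eqP; rewrite -subr_eq0; apply/eqP.
move: v1; set v := u - tpi m.
have rv : Re v = 0 by rewrite /v; case: (u) ru => a b /= ->; rewrite subr0.
have iv : Im v = Im u - m%:~R * (pi *+ 2) by rewrite /v; case: (u).
have v0 : 0 <= Im v by rewrite iv.
have v2 : Im v < pi *+ 2 by rewrite iv.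
rewrite /cexp rv expR0 !mul1r => -[cv _].
suff iv0 : Im v = 0 by apply/eqP; rewrite eq_complex rv iv0 !eqxx.
(* [cos] is injective only on [0, pi]; beyond pi the angle is reflected to 2 pi - Im v. *)
have [vp|pv] := leP (Im v) pi.
  by apply: cos_inj; rewrite ?in_itv/= ?cos0// ?lexx ?pi_ge0// v0.
have e0 : pi *+ 2 - Im v = 0.
  apply: cos_inj; rewrite ?in_itv/= ?lexx ?pi_ge0//.
    by rewrite subr_ge0 ltW// mulr2n; lra.
  by rewrite cosB cos2pi sin2pi mul0r addr0 mul1r cos0.
by move: v2; rewrite -subr_gt0 e0 ltxx.
Qed.

Lemma cexp_inj u v : cexp u = cexp v -> exists m, u = v + tpi m.
Proof.
move=> uv; have [|m hm] := @cexp_eq1 (u - v).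
  by rewrite cexpD cexpN uv divff// cexp_neq0.
by exists m; rewrite -hm addrC subrK.
Qed.

Lemma cexp_surj z : z != 0 -> exists u, cexp u = z.
Proof.
move=> z0; have n0 : 0 < nm z by rewrite nm_gt0.
pose c := Re z / nm z; pose s := Im z / nm z.
have cs : c ^+ 2 + s ^+ 2 = 1.
  by rewrite /c /s !expr_div_n -mulrDl -nm_sqr divff// expf_neq0// gt_eqF.
have c1 : -1 <= c <= 1 by have := sqr_ge0 s; nra.
have zE : z = (nm z * c) +i* (nm z * s).
  rewrite /c /s !(mulrC (nm z)) !divfK ?gt_eqF//.
  by case: (z).
exists (ln (nm z) +i* (if 0 <= s then acos c else - acos c)).
rewrite /cexp /= lnK ?posrE// [RHS]zE.
have sa : sin (acos c) = `|s|.
  by rewrite sin_acos// -sqrtr_sqr; congr Num.sqrt; lra.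
have ca : cos (acos c) = c by rewrite acosK// in_itv.
case: ifP => s0; first by rewrite ca sa ger0_norm.
rewrite cosN sinN ca sa ltr0_norm ?opprK//.
by rewrite ltNge s0.
Qed.

Lemma lipschitz_of_derive (f df : R -> R) (C : R) :
  (forall x, is_derive x 1 f (df x)) -> (forall x, `|df x| <= C) ->
  forall x y, `|f x - f y| <= C * `|x - y|.
Proof.
move=> fd dC.
have key x y : x <= y -> `|f y - f x| <= C * `|y - x|.
  move=> xy; have [|c _ ->] := @MVT_segment R f df x y xy (fun t _ => fd t).
    apply: derivable_within_continuous => t _.
    exact: @ex_derive _ _ _ _ _ _ _ (fd t).
  by rewrite normrM ler_wpM2r.
move=> x y; have [xy|/ltW yx] := leP y x; first exact: key.
by rewrite distrC [`|x - y|]distrC; exact: key.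
Qed.

Lemma sin_lipschitz x y : `|sin x - sin y| <= `|x - y|.
Proof. by rewrite -[leRHS]mul1r; apply: lipschitz_of_derive (@cos_max R) _ _; exact: is_derive_sin. Qed.

Lemma cos_lipschitz x y : `|cos x - cos y| <= `|x - y|.
Proof.
rewrite -[leRHS]mul1r; apply: (@lipschitz_of_derive _ (fun x => - sin x)) => t.
by rewrite normrN sin_max.
Qed.

Lemma atan_lipschitz x y : `|atan x - atan y| <= `|x - y|.
Proof.
rewrite -[leRHS]mul1r.
apply: (@lipschitz_of_derive _ (fun x => (1 + x ^+ 2)^-1)) => t.
rewrite ger0_norm ?invr_ge0 ?addr_ge0 ?sqr_ge0// invf_le1; first by rewrite lerDl sqr_ge0.
by rewrite ltr_pwDl ?sqr_ge0.
Qed.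

Lemma expR_lipschitz M x y : x <= M -> y <= M ->
  `|expR x - expR y| <= expR M * `|x - y|.
Proof.
have key a b : a <= b -> b <= M -> expR b - expR a <= expR M * (b - a).
  move=> ab bM; have := expR_ge1Dx (a - b); rewrite expRD expRN.
  rewrite ler_pdivlMr ?expR_gt0// => h1.
  have h2 : expR b <= expR M by rewrite ler_expR.
  have := expR_gt0 b; nra.
move=> xM yM; have [xy|/ltW yx] := leP y x.
  by rewrite !ger0_norm ?subr_ge0 ?ler_expR//; exact: key.
by rewrite distrC [`|x - y|]distrC !ger0_norm ?subr_ge0 ?ler_expR//; exact: key.
Qed.

Lemma cexp_lipschitz M u v : Re u <= M -> Re v <= M ->
  nm (cexp u - cexp v) <= 4 * expR M * nm (u - v).
Proof.
case: u v => [a b] [c d] aM cM.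
have h1 : `|expR a - expR c| <= expR M * `|a - c| := expR_lipschitz aM cM.
have hr : `|a - c| <= nm ((a - c) +i* (b - d)) by exact: (Re_le_nm ((a - c) +i* (b - d))).
have hi : `|b - d| <= nm ((a - c) +i* (b - d)) by exact: (Im_le_nm ((a - c) +i* (b - d))).
rewrite -[(a +i* b) - (c +i* d)]/((a - c) +i* (b - d)).
move: hr hi; set N := nm (_ +i* _) => hr hi.
have eM0 := expR_gt0 M.
have key (f g : R) : `|f| <= 1 -> `|f - g| <= `|b - d| ->
   `|expR a * f - expR c * g| <= 2 * expR M * N.
  move=> f1 fg; have -> : expR a * f - expR c * g =
    (expR a - expR c) * f + expR c * (f - g) by ring.
  rewrite (le_trans (ler_normD _ _))// !normrM.
  have t1 : `|expR a - expR c| * `|f| <= expR M * N.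
    rewrite -[leRHS]mulr1 ler_pM// (le_trans h1)// ler_pM2l//.
  have t2 : `|expR c| * `|f - g| <= expR M * N.
    rewrite ler_pM// ?(le_trans fg)// ger0_norm ?expR_ge0// ler_expR//.
  lra.
apply: (le_trans (nm_le_ReIm _)) => /=.
have := key _ _ (cos_max b) (cos_lipschitz b d).
have := key _ _ (sin_max b) (sin_lipschitz b d).
lra.
Qed.

(** The principal logarithm on the right half-plane, the only place where it is used; there the
    argument is a plain [atan]. *)
Definition clog z : R[i] := ln (nm z) +i* atan (Im z / Re z).

Lemma clogK z : 0 < Re z -> cexp (clog z) = z.
Proof.
move=> z0; have z1 : 0 < nm z.
  by rewrite nm_gt0; apply: contraTneq z0 => ->; rewrite ltxx.
rewrite /cexp /= lnK ?posrE//.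
set t := Im z / Re z.
have st : sin (atan t) = t * cos (atan t).
  have c0 : cos (atan t) != 0.
    by rewrite gt_eqF// cos_gt0_pihalf// atan_gtNpi2 atan_ltpi2.
  by rewrite -{2}(atanK t) /tan divfK.
have zt : nm z = Re z * Num.sqrt (1 + t ^+ 2).
  apply/eqP; rewrite -(@eqrXn2 _ 2) ?nm_ge0 ?mulr_ge0 ?sqrtr_ge0 ?(ltW z0)//.
  rewrite exprMn sqr_sqrtr ?addr_ge0 ?sqr_ge0// nm_sqr mulrDr mulr1 -exprMn.
  by have -> : Re z * t = Im z by rewrite /t mulrC divfK ?gt_eqF.
have sq0 : Num.sqrt (1 + t ^+ 2) != 0 by rewrite gt_eqF// sqrtr_gt0 ltr_pwDl ?sqr_ge0.
rewrite st cos_atan zt mulrCA mulfK// divfK ?gt_eqF//.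
by case: (z).
Qed.

Lemma clogV z : 0 < Re z -> clog z^-1 = - clog z.
Proof.
move=> z0; have z1 : 0 < nm z.
  by rewrite nm_gt0; apply: contraTneq z0 => ->; rewrite ltxx.
apply/eqP; rewrite eq_complex; apply/andP; split.
  rewrite [Re (clog _)]/= nmV lnV ?posrE//.
rewrite [Im (clog z^-1)]/= -[Im (- clog z)]/(- atan (Im z / Re z)) -atanN; apply/eqP.
congr atan; case: (z) z0 z1 => a b /= a0 _.
have h0 : a ^+ 2 + b ^+ 2 != 0 by rewrite gt_eqF// ltr_pwDl ?exprn_gt0 ?sqr_ge0.
by field; rewrite h0 gt_eqF.
Qed.

Lemma ln_lipschitz k x y : 0 < k -> k <= x -> k <= y ->
  `|ln x - ln y| <= k^-1 * `|x - y|.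
Proof.
move=> k0; have key a b : k <= a -> a <= b -> ln b - ln a <= k^-1 * (b - a).
  move=> ka ab; have a0 : 0 < a by lra.
  have b0 : 0 < b by lra.
  rewrite -ln_div ?posrE//; have -> : b / a = 1 + (b - a) / a.
    by rewrite mulrBl divff ?gt_eqF// addrC subrK.
  rewrite (le_trans (le_ln1Dx _))//.
    by rewrite (@lt_le_trans _ _ 0) ?divr_ge0 ?subr_ge0// ltW.
  by rewrite mulrC ler_wpM2r ?subr_ge0// lef_pV2 ?posrE.
move=> kx ky; have [yx|/ltW xy] := leP y x.
  by rewrite !ger0_norm ?subr_ge0 ?ler_ln ?posrE ?(lt_le_trans k0)//; exact: key.
rewrite distrC [`|x - y|]distrC !ger0_norm ?subr_ge0 ?ler_ln ?posrE ?(lt_le_trans k0)//.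
exact: key.
Qed.

Lemma clog_lipschitz (k M : R) : 0 < k -> exists2 C : R, 0 < C &
  forall z w, k <= Re z -> nm z <= M -> k <= Re w -> nm w <= M ->
    nm (clog z - clog w) <= C * nm (z - w).
Proof.
move=> k0; have [M0|M0] := ltP M 0.
  by exists 1 => // z w _ zM; have := nm_ge0 z; lra.
(* The first summand serves the modulus, the other two the argument, through the quotient Im z / Re
   z. *)
have C0 : 0 < k^-1 + (k^-1 + M / k ^+ 2).
  rewrite ltr_pwDl ?invr_gt0// addr_ge0 ?invr_ge0 ?(ltW k0)//.
  by rewrite divr_ge0// sqr_ge0.
exists (k^-1 + (k^-1 + M / k ^+ 2)) => // z w zk zM wk wM.
have zn : k <= nm z by rewrite (le_trans zk)// (le_trans (ler_norm _) (Re_le_nm z)).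
have wn : k <= nm w by rewrite (le_trans wk)// (le_trans (ler_norm _) (Re_le_nm w)).
apply: (le_trans (nm_le_ReIm _)).
rewrite -[Re (clog z - clog w)]/(ln (nm z) - ln (nm w)).
rewrite -[Im (clog z - clog w)]/(atan (Im z / Re z) - atan (Im w / Re w)).
rewrite mulrDl lerD//.
  apply: (le_trans (ln_lipschitz k0 zn wn)).
  rewrite ler_pM2l ?invr_gt0// ler_norml; have := nmB_ge z w; have := nmB_ge w z.
  by rewrite nm_distC; lra.
apply: (le_trans (atan_lipschitz _ _)).
have hr : `|Re w - Re z| <= nm (z - w).
  by rewrite nm_distC; have := Re_le_nm (w - z); case: (z) => a b; case: (w).
have hi : `|Im z - Im w| <= nm (z - w).
  by have := Im_le_nm (z - w); case: (z) => a b; case: (w).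
have z0 : 0 < Re z by lra.
have w0 : 0 < Re w by lra.
have -> : Im z / Re z - Im w / Re w = (Im z - Im w) / Re z + Im w * (Re w - Re z) / (Re z * Re w).
  by field; rewrite !gt_eqF.
rewrite (le_trans (ler_normD _ _))// [leRHS]mulrDl lerD//.
  rewrite normrM mulrC ler_pM// ger0_norm ?invr_ge0 ?(ltW z0)// lef_pV2 ?posrE//.
rewrite !normrM mulrAC ler_pM ?mulr_ge0//.
rewrite ler_pM// ?(le_trans (Im_le_nm w))//.
rewrite ger0_norm ?invr_ge0 ?mulr_ge0 ?(ltW z0) ?(ltW w0)// lef_pV2 ?posrE ?exprn_gt0 ?mulr_gt0//.
by rewrite expr2 ler_pM// ltW.
Qed.

End ComplexExponential.

(** * Logarithms of a translate *)

Section Shift.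
Variable R : realType.
Implicit Types (b c u v s : R[i]) (x y : R).

(* A branch of log (1 - b / e^s), so that s + shift_log b s is a logarithm of
   e^s - b. *)
Definition shift_log b s : R[i] := clog (1 - b * cexp (- s)).

(** Since |e^(-s)| <= 2 on the half-plane considered, 1 - b e^(-s) stays within 2 sg < 1 of 1 as
    soon as sg < 1/2, hence in the right half-plane where [clog] is a logarithm. *)
Lemma shift_log_arg sg b s : 0 <= sg -> nm b <= sg -> ln (1 / 2) <= Re s ->
  nm (b * cexp (- s)) <= 2 * sg.
Proof.
move=> sg0 bs s0; rewrite nmM mulrC cexpN nmV nm_cexp.
rewrite ler_pM ?nm_ge0 ?invr_ge0 ?expR_ge0//.
rewrite -[leRHS]invrK lef_pV2 ?posrE ?expR_gt0 ?invr_gt0//.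
by rewrite -ler_ln ?posrE ?expR_gt0// ?invr_gt0// expRK -[2^-1]mul1r.
Qed.

Lemma Re_1B z (t : R) : nm z <= t -> 1 - t <= Re (1 - z).
Proof.
move=> zt; have -> : Re (1 - z) = 1 - Re z by case: z {zt}.
by have := le_trans (ler_norm _) (Re_le_nm z); lra.
Qed.

Lemma nm_1B z (t : R) : nm z <= t -> nm (1 - z) <= 1 + t.
Proof. by move=> zt; have := nmB 1 z; rewrite nm1; lra. Qed.

Lemma cexp_shift sg b s : 0 <= sg -> sg < 1 / 2 -> nm b <= sg -> ln (1 / 2) <= Re s ->
  cexp (s + shift_log b s) = cexp s - b.
Proof.
move=> sg0 sg1 bs s0; rewrite cexpD clogK.
  by rewrite mulrBr mulr1 mulrCA -cexpD subrr cexp0 mulr1.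
by have := Re_1B (shift_log_arg sg0 bs s0); lra.
Qed.

Lemma shift_log_tpi b s m : shift_log b (s + tpi R m) = shift_log b s.
Proof. by rewrite /shift_log opprD cexpD -tpiN cexp_tpi mulr1. Qed.

Lemma shift_log_lipschitz sg : 0 <= sg -> sg < 1 / 2 ->
  exists2 C : R, 0 < C & forall b b' s s', nm b <= sg -> nm b' <= sg ->
    ln (1 / 2) <= Re s -> ln (1 / 2) <= Re s' ->
    nm (shift_log b s - shift_log b' s') <= C * (nm (b - b') + nm (s - s')).
Proof.
move=> sg0 sg1; have k0 : 0 < 1 - 2 * sg by lra.
have [C C0 hC] := clog_lipschitz (1 + 2 * sg) k0.
pose E : R := expR (- ln (1 / 2)).
have E0 : 0 < E by exact: expR_gt0.
exists (C * (2 + sg * (4 * E))).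
  by rewrite mulr_gt0// ltr_pwDl ?mulr_ge0 ?(ltW E0).
move=> b b' s s' bs bs' ss ss'.
have h1 := shift_log_arg sg0 bs ss; have h2 := shift_log_arg sg0 bs' ss'.
apply: (le_trans (hC _ _ (Re_1B h1) (nm_1B h1) (Re_1B h2) (nm_1B h2))).
rewrite -mulrA ler_pM2l//.
have -> : 1 - b * cexp (- s) - (1 - b' * cexp (- s')) =
  - ((b - b') * cexp (- s)) - b' * (cexp (- s) - cexp (- s')) by ring.
apply: (le_trans (nmB _ _)); rewrite nmN !nmM.
have reN (w : R[i]) : Re (- w) = - Re w by case: w.
have t1 : nm (b - b') * nm (cexp (- s)) <= nm (b - b') * 2.
  rewrite ler_wpM2l ?nm_ge0//.
  have := @shift_log_arg 1 1 s ler01; rewrite [1 * cexp _]mul1r mulr1 nm1; apply=> //.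
have t2 : nm (cexp (- s) - cexp (- s')) <= 4 * E * nm (s - s').
  have := @cexp_lipschitz R (- ln (1 / 2)) (- s) (- s').
  rewrite !reN !lerN2 => /(_ ss ss').
  have -> : - s - - s' = - (s - s') by ring.
  by rewrite nmN.
have t3 : nm b' * nm (cexp (- s) - cexp (- s')) <= sg * (4 * E * nm (s - s')).
  by rewrite ler_pM ?nm_ge0.
have := nm_ge0 (s - s'); have := nm_ge0 (b - b'); have : 0 <= sg * (4 * E).
  by rewrite mulr_ge0// mulr_ge0// ltW.
move=> t4 t5 t6; rewrite mulrDl.
have : 0 <= sg * (4 * E) * nm (b - b') by rewrite mulr_ge0.
have : 0 <= 2 * nm (s - s') by rewrite mulr_ge0.
lra.
Qed.

(** With v = u + shift_log c u one has e^u = e^v + c, so 1 / (1 - c e^(-u)) = 1 + c e^(-v) and u is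
    v plus the logarithm of the latter: a Lipschitz function of v. *)
Lemma shift_expanding sg : 0 <= sg -> sg < 1 / 2 ->
  exists2 C : R, 0 < C & forall c u u', nm c <= sg ->
    ln (1 / 2) <= Re u -> ln (1 / 2) <= Re u' ->
    nm (u - u') <= C * nm (u + shift_log c u - (u' + shift_log c u')).
Proof.
move=> sg0 sg1; pose t := 2 * sg.
(* For |w| <= t the real part of 1 / (1 - w) is Re (1 - w) / |1 - w|^2, hence at least this
   constant. *)
have k0 : 0 < (1 - t) / (1 + t) ^+ 2.
  by rewrite divr_gt0 ?exprn_gt0// /t; lra.
have [C C0 hC] := clog_lipschitz (1 - t)^-1 k0.
(* Bounds |e^(-v)|, since |e^v| = |e^u - c| >= 1/2 - sg. *)
pose E : R := (1 / 2 - sg)^-1.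
have E0 : 0 < E by rewrite invr_gt0; lra.
exists (1 + C * (sg * (4 * E))).
  by rewrite ltr_pwDl// mulr_ge0 ?(ltW C0)// mulr_ge0// mulr_ge0// ltW.
move=> c u u' cs us us'.
set v := u + shift_log c u; set v' := u' + shift_log c u'.
have inv (w : R[i]) : nm w <= t ->
    (1 - t) / (1 + t) ^+ 2 <= Re (1 - w)^-1 /\ nm (1 - w)^-1 <= (1 - t)^-1.
  move=> wt; have h1 := Re_1B wt; have h2 := nm_1B wt.
  have t1 : 0 < 1 - t by rewrite /t; lra.
  have n1 : 1 - t <= nm (1 - w).
    by rewrite (le_trans h1)// (le_trans (ler_norm _))// Re_le_nm.
  split; last by rewrite nmV lef_pV2 ?posrE// (lt_le_trans t1).
  have -> : Re (1 - w)^-1 = Re (1 - w) / nm (1 - w) ^+ 2.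
    by rewrite nm_sqr; case: (1 - w).
  rewrite ler_pM ?invr_ge0 ?sqr_ge0 ?(ltW t1)// lef_pV2 ?posrE ?exprn_gt0//.
  - by rewrite ler_sqr ?nnegrE ?nm_ge0// /t; lra.
  - by rewrite /t; lra.
  - by rewrite (lt_le_trans t1).
have sl w : ln (1 / 2) <= Re w -> shift_log c w = - clog (1 - c * cexp (- w))^-1.
  move=> hw; rewrite clogV ?opprK//.
  by have := Re_1B (shift_log_arg sg0 cs hw); lra.
have ci w : ln (1 / 2) <= Re w ->
    (1 - c * cexp (- w))^-1 = 1 + c * cexp (- (w + shift_log c w)).
  move=> hw; rewrite (cexpN (w + _)) (cexp_shift sg0 sg1 cs hw) cexpN.
  have e0 := cexp_neq0 w.
  have e1 : cexp w - c != 0 by rewrite -(cexp_shift sg0 sg1 cs hw) cexp_neq0.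
  by field; rewrite e0 e1.
have [a1 a2] := inv _ (shift_log_arg sg0 cs us).
have [a1' a2'] := inv _ (shift_log_arg sg0 cs us').
have hd := hC _ _ a1 a2 a1' a2'.
have uv : u - u' = (v - v') + (clog (1 - c * cexp (- u))^-1 - clog (1 - c * cexp (- u'))^-1).
  by rewrite /v /v' !sl//; ring.
have reN (w : R[i]) : Re (- w) = - Re w by case: w.
have rv w : ln (1 / 2) <= Re w -> Re (- (w + shift_log c w)) <= ln E.
  move=> hw; rewrite reN -ler_expR lnK ?posrE// expRN -nm_cexp (cexp_shift sg0 sg1 cs hw).
  rewrite /E lef_pV2 ?posrE; last 2 first.
  - by rewrite -(cexp_shift sg0 sg1 cs hw) nm_gt0 cexp_neq0.
  - lra.
  have := nmB_ge (cexp w) c; rewrite nm_cexp.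
  have : 1 / 2 <= expR (Re w) by rewrite -ler_ln ?posrE ?expR_gt0// expRK.
  lra.
have he : nm (cexp (- v) - cexp (- v')) <= 4 * E * nm (v - v').
  have := cexp_lipschitz (rv _ us) (rv _ us'); rewrite lnK ?posrE// -/v -/v'.
  have -> : - v - - v' = - (v - v') by ring.
  by rewrite nmN.
rewrite uv (le_trans (nmD _ _))// mulrDl mul1r lerD2l (le_trans hd)// -mulrA ler_pM2l//.
rewrite !ci// -/v -/v'.
have -> : 1 + c * cexp (- v) - (1 + c * cexp (- v')) = c * (cexp (- v) - cexp (- v')) by ring.
by rewrite nmM -mulrA ler_pM ?nm_ge0.
Qed.

End Shift.

(** * A crossing lemma for discrete curves *)

Section Crossing.

Inductive color := cA | cB | cC.

Definition color_eqb (a b : color) : bool :=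
  match a, b with cA, cA | cB, cB | cC, cC => true | _, _ => false end.

Lemma color_eqbP : Equality.axiom color_eqb.
Proof. by case; case; constructor. Qed.

HB.instance Definition _ := hasDecEq.Build color color_eqbP.

(* Signed count of the passages from B to C: its sum along a closed path that
   misses one of the colors vanishes. *)
Definition turn (a b : color) : int :=
  match a, b with cB, cC => 1 | cC, cB => -1 | _, _ => 0 end.

Lemma turn_cell (a b c d : color) :
  ~~ [&& cA \in [:: a; b; c; d], cB \in [:: a; b; c; d] & cC \in [:: a; b; c; d]] ->
  turn a b + turn b d = turn a c + turn c d.
Proof. by case: a; case: b; case: c; case: d. Qed.

Variables (col : nat -> nat -> color) (p q : nat).
Let H i j := turn (col i j) (col i.+1 j).
Let V i j := turn (col i j) (col i j.+1).

(** A discrete Stokes formula: when the cell identities are added, the inner edges cancel. *)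
Lemma turn_grid :
  (forall i j, (i < p)%N -> (j < q)%N -> H i j + V i.+1 j = V i j + H i j.+1) ->
  \sum_(i < p) H i 0%N + \sum_(j < q) V p j = \sum_(j < q) V 0%N j + \sum_(i < p) H i q.
Proof.
move=> cell.
have strip i : (i < p)%N ->
    H i 0%N + \sum_(j < q) V i.+1 j = \sum_(j < q) V i j + H i q.
  move=> ip; have : forall j, (j < q)%N -> H i j + V i.+1 j = V i j + H i j.+1.
    by move=> j jq; exact: cell.
  elim: q => [|k IH] hk; first by rewrite !big_ord0 addr0 add0r.
  rewrite !big_ord_recr /= addrA IH; last by move=> j jk; apply: hk; exact: ltnW.
  by rewrite -addrA hk// !addrA.
have : forall i, (i < p)%N ->
    H i 0%N + \sum_(j < q) V i.+1 j = \sum_(j < q) V i j + H i q by exact: strip.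
elim: p => [|k IH] hk; first by rewrite !big_ord0 addr0 add0r.
rewrite !big_ord_recr /=.
by rewrite -addrA hk// addrA IH ?addrA// => i ik; apply: hk; exact: ltnW.
Qed.

End Crossing.

Section GridZero.
Variable R : realType.

Lemma cell_spread (f : bool -> bool -> R) (d : R) :
  `|f true false - f false false| <= d -> `|f true true - f false true| <= d ->
  `|f false true - f false false| <= d -> `|f true true - f true false| <= d ->
  forall b c b' c', f b c - f b' c' <= 2 * d.
Proof.
rewrite !ler_norml => /andP[? ?] /andP[? ?] /andP[? ?] /andP[? ?].
by do 4 case; lra.
Qed.

Variables (x y : nat -> nat -> R) (p q : nat) (d : R).
Hypothesis q0 : (0 < q)%N.
Hypothesis step1 : forall i j, (i < p)%N -> (j <= q)%N ->
  `|x i.+1 j - x i j| <= d /\ `|y i.+1 j - y i j| <= d.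
Hypothesis step2 : forall i j, (i <= p)%N -> (j < q)%N ->
  `|x i j.+1 - x i j| <= d /\ `|y i j.+1 - y i j| <= d.
Hypothesis x00 : x 0%N 0%N < 0.
Hypothesis xpq : 0 <= x p q.
Hypothesis xpq1 : 0 <= x p q.-1.
Hypothesis y0j : forall j, (j <= q)%N -> y 0%N j <= 0.
Hypothesis yiq : forall i, (i <= p)%N -> y i q <= 0.
Hypothesis yi0 : forall i, (0 < i <= p)%N -> 0 < y i 0%N.
Hypothesis ypj : forall j, (j < q)%N -> 0 < y p j.

(** Three sectors of the (x, y) plane that meet at the origin, so that a small cell showing all
    three colors has to be near it. *)
Let col i j := if x i j < 0 then cB else if y i j <= 0 then cC else cA.

(** Without such a point no cell shows all three colors, and by [turn_grid] the turns along the two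
    boundary paths from (0, 0) to (p, q) have equal sums. Through (p, 0) there is no passage between
    B and C, so the sum is 0; through (0, q) only B and C occur and the path leads from B to C, so
    the sum is 1. *)
Lemma grid_zero : exists i j, [/\ (i <= p)%N, (j <= q)%N,
  `|x i j| <= 2 * d & `|y i j| <= 2 * d].
Proof.
apply: contrapT => nex.
have near0 i j : (i <= p)%N -> (j <= q)%N ->
    `|x i j| <= 2 * d -> `|y i j| <= 2 * d -> False.
  by move=> ip jq hx hy; apply: nex; exists i, j.
pose cx i j (b c : bool) := x (i + b)%N (j + c)%N.
pose cy i j (b c : bool) := y (i + b)%N (j + c)%N.
have colB i j : col i j = cB -> x i j < 0.
  by rewrite /col; case: ltP => //; case: ifP.
have colC i j : col i j = cC -> 0 <= x i j /\ y i j <= 0.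
  by rewrite /col; case: ltP => // h1; case: ifP.
have colA i j : col i j = cA -> 0 < y i j.
  by rewrite /col; case: ltP => // h1; case: leP.
have cell i j : (i < p)%N -> (j < q)%N ->
    turn (col i j) (col i.+1 j) + turn (col i.+1 j) (col i.+1 j.+1) =
    turn (col i j) (col i j.+1) + turn (col i j.+1) (col i.+1 j.+1).
  move=> ip jq; apply: turn_cell; apply/negP => /and3P[].
  have [a1 a2] := step1 ip (ltnW jq); have [b1 b2] := step1 ip jq.
  have [c1 c2] := step2 (ltnW ip) jq; have [d1 d2] := step2 ip jq.
  have hx b c b' c' : cx i j b c - cx i j b' c' <= 2 * d.
    by apply: cell_spread; rewrite /cx ?addn1 ?addn0.
  have hy b c b' c' : cy i j b c - cy i j b' c' <= 2 * d.
    by apply: cell_spread; rewrite /cy ?addn1 ?addn0.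
  have corner e : e \in [:: col i j; col i.+1 j; col i j.+1; col i.+1 j.+1] ->
      exists b c : bool, col (i + b)%N (j + c)%N = e.
    rewrite !inE => /or4P[] /eqP ->.
    - by exists false, false; rewrite !addn0.
    - by exists true, false; rewrite addn1 addn0.
    - by exists false, true; rewrite addn1 addn0.
    - by exists true, true; rewrite !addn1.
  move=> /corner[bA [cA' hA]] /corner[bB [cB' hB]] /corner[bC [cC' hC]].
  apply: (@near0 (i + bC)%N (j + cC')%N).
  - by case: (bC); rewrite ?addn1 ?addn0// ltnW.
  - by case: (cC'); rewrite ?addn1 ?addn0// ltnW.
  - have := hx bC cC' bB cB'; rewrite /cx; have := colB _ _ hB; have [h1 _] := colC _ _ hC.
    by rewrite ger0_norm//; lra.
  - have := hy bA cA' bC cC'; rewrite /cy; have := colA _ _ hA; have [_ h1] := colC _ _ hC.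
    by rewrite ler0_norm//; lra.
have := @turn_grid col p q cell.
pose ind c := if c is cC then 1 else 0 : int.
have tel (f : nat -> color) k : (forall j, (j <= k)%N -> f j != cA) ->
    \sum_(j < k) turn (f j) (f j.+1) = ind (f k) - ind (f 0%N).
  elim: k => [|k IH] hk; first by rewrite big_ord0 subrr.
  rewrite big_ord_recr /= IH; last by move=> j jk; apply: hk; exact: leqW.
  have := hk k (leqnSn k); have := hk k.+1 (leqnn _).
  by case: (f k); case: (f k.+1); case: (f 0%N).
have colBC i j : y i j <= 0 -> col i j != cA.
  by rewrite /col => ->; case: ifP.
have colAB i j : 0 < y i j -> col i j != cC.
  by rewrite /col leNgt => ->; case: ifP.
rewrite (tel (col 0%N)); last by move=> j jq; apply: colBC; exact: y0j.
rewrite (tel (col^~ q)); last by move=> i ip; apply: colBC; exact: yiq.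
have c00 : col 0%N 0%N = cB by rewrite /col x00.
have cpq : col p q = cC by rewrite /col ltNge xpq /= yiq.
rewrite c00 cpq /=.
rewrite big1; last first.
  have yS k : (k < p)%N -> 0 < y k.+1 0%N by move=> kp; apply: yi0.
  move=> i _; have := colAB i.+1 0%N (yS _ (ltn_ord i)).
  have : col i 0%N != cC.
    case: (i : nat) (ltn_ord i) => [|k] kp; first by rewrite c00.
    by apply: colAB; apply: yi0; exact: ltnW.
  by case: (col i 0%N); case: (col i.+1 0%N).
rewrite big1; last first.
  move=> j _; have h1 := colAB p j (ypj (ltn_ord j)).
  have [jq|jq] := ltnP j.+1 q.
    have := colAB p j.+1 (ypj jq).
    by case: (col p j) h1; case: (col p j.+1).
  (* The last edge ends at the corner of color C; [xpq1] keeps its other end from having color B. *)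
  have jE : j = q.-1 :> nat.
    by apply/eqP; rewrite eqn_leq -ltnS prednK// ltn_ord -ltnS prednK.
  have : col p j != cB by rewrite /col jE ltNge xpq1; case: ifP.
  by case: (col p j) h1; case: (col p j.+1).
by rewrite /=; case: (col 0%N q).
Qed.

End GridZero.

(** * Crossing of two chains in a strip *)

Section ChainCrossing.
Variable R : realType.
Implicit Types (X Y : set R[i]) (d : R).

Definition dist_le d (u v : R[i]) : Prop := nm (u - v) <= d.

Definition chain_connected d X :=
  forall u v, X u -> X v -> chain X (dist_le d) u v.

Lemma chain_fun (T : Type) (P : set T) (r : T -> T -> Prop) a b : chain P r a b ->
  exists (N : nat) (f : nat -> T), [/\ f 0%N = a, f N = b,
    forall i, (i <= N)%N -> P (f i) & forall i, (i < N)%N -> r (f i) (f i.+1)].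
Proof.
elim=> [u Pu|u v w Pu ruv ch [N [f [f0 fN fP fr]]]].
  by exists 0%N, (fun=> u).
exists N.+1, (fun i => if i is k.+1 then f k else u); split => //.
- by case=> // k; exact: fP.
- by case=> [_|k kN]; [rewrite f0|exact: fr].
Qed.

(** Stop at the first index of height at least [T] and start at the last earlier index of height at
    most 0; in between the heights remain strictly inside the strip. *)
Lemma chain_window X d (T : R) u v : chain X (dist_le d) u v -> 0 < T ->
  Im u <= 0 -> T <= Im v ->
  exists (N : nat) (f : nat -> R[i]), [/\ (0 < N)%N, Im (f 0%N) <= 0, T <= Im (f N),
    forall i, (0 < i < N)%N -> 0 < Im (f i) < T &
    (forall i, (i <= N)%N -> X (f i)) /\
    (forall i, (i < N)%N -> nm (f i - f i.+1) <= d)].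
Proof.
move=> ch T0 u0 vT; have [N [f [f0 fN fX fr]]] := chain_fun ch.
have exT : exists i, T <= Im (f i) by exists N; rewrite fN.
have [i1 hi1 mini1] := ex_minnP exT.
have i1N : (i1 <= N)%N by apply: mini1; rewrite fN.
pose Q i := (i < i1)%N && (Im (f i) <= 0).
have i10 : (0 < i1)%N.
  by rewrite lt0n; apply: contraTneq hi1 => ->; rewrite f0 -ltNge (le_lt_trans u0).
have exQ : exists i, Q i by exists 0%N; rewrite /Q i10 f0.
have ubQ i : Q i -> (i <= i1)%N by move=> /andP[/ltnW].
have [i0 /andP[i01 hi0] maxi0] := ex_maxnP exQ ubQ.
exists (i1 - i0)%N, (fun k => f (i0 + k)%N); split.
- by rewrite subn_gt0.
- by rewrite addn0.
- by rewrite subnKC// ltnW.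
- move=> k /andP[k0 k1]; have kl : (i0 + k < i1)%N by lia.
  apply/andP; split; rewrite ltNge; apply/negP => hk.
    by have := maxi0 (i0 + k)%N; rewrite /Q kl hk => /(_ isT); lia.
  by have := mini1 _ hk; lia.
- by split=> k hk; [apply: fX|rewrite addnS; apply: fr]; lia.
Qed.

(** Truncation puts the two ends of a window exactly at heights 0 and pi, which yields the boundary
    signs of [y] that [grid_zero] asks for. *)
Definition clamp (t : R) : R := Num.max 0 (Num.min t pi).

Lemma clamp_lipschitz s t : `|clamp s - clamp t| <= `|s - t|.
Proof.
have P0 := @pi_gt0 R.
have c3 r : [\/ r <= 0 /\ clamp r = 0, 0 <= r <= pi /\ clamp r = r | pi <= r /\ clamp r = pi].
  rewrite /clamp; have [r0|r0] := leP r 0.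
    by constructor 1; split => //; rewrite min_l ?max_l//; lra.
  have [rp|rp] := leP r pi; last by constructor 3; rewrite max_r// ltW.
  by constructor 2; rewrite ?(ltW r0); split => //; rewrite max_r// ltW.
have h1 := ler_norm (s - t); have h2 := ler_norm (t - s); rewrite distrC in h2.
rewrite ler_norml.
by case: (c3 s) => -[hs ->]; case: (c3 t) => -[ht ->]; lra.
Qed.

(* The left/right order of the two sets is exchanged between heights 0 and pi,
   which forces a crossing. *)
Lemma chains_cross X Y d : d <= 1 / 2 ->
  chain_connected d X -> chain_connected d Y ->
  (exists2 u, X u & Im u <= 0) -> (exists2 u, X u & pi <= Im u) ->
  (exists2 u, Y u & Im u <= 0) -> (exists2 u, Y u & pi <= Im u) ->
  (forall u v, X u -> Y v -> `|Im u| <= 1 -> `|Im v| <= 1 -> Re u < Re v) ->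
  (forall u v, X u -> Y v -> `|Im u - pi| <= 1 -> `|Im v - pi| <= 1 -> Re v < Re u) ->
  exists u v, [/\ X u, Y v & nm (u - v) <= 6 * d].
Proof.
move=> d1 cX cY [u0 Xu0 hu0] [u1 Xu1 hu1] [v0 Yv0 hv0] [v1 Yv1 hv1] sep0 sep1.
have P0 := @pi_gt0 R; have P2 := @pi_ge2 R.
have [p [a [p0 a0 ap aM [aX aS]]]] := chain_window (cX _ _ Xu0 Xu1) P0 hu0 hu1.
have [q [b [q0 b0 bq bM [bY bS]]]] := chain_window (cY _ _ Yv0 Yv1) P0 hv0 hv1.
have stepI (f : nat -> R[i]) N i : (forall i, (i < N)%N -> nm (f i - f i.+1) <= d) ->
    (i < N)%N -> `|Re (f i.+1) - Re (f i)| <= d /\ `|Im (f i.+1) - Im (f i)| <= d.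
  move=> fS iN; have := fS i iN; have := Re_le_nm (f i - f i.+1).
  have := Im_le_nm (f i - f i.+1); rewrite nm_distC.
  case: (f i) => r s; case: (f i.+1) => r' s' /=.
  rewrite [`|s - s'|]distrC [`|r - r'|]distrC => h1 h2 h3.
  by split; apply: le_trans h3.
(* Only the ends of a window can lie outside [0, pi], and by at most one step, because their
   neighbors are on the other side of the level. *)
have over (f : nat -> R[i]) N i : (0 < N)%N -> Im (f 0%N) <= 0 -> pi <= Im (f N) ->
    (forall i, (0 < i < N)%N -> 0 < Im (f i) < pi) ->
    (forall i, (i < N)%N -> nm (f i - f i.+1) <= d) -> (i <= N)%N ->
    `|clamp (Im (f i)) - Im (f i)| <= d.
  move=> N0 f0 fN fM fS iN.
  have [|i0] := posnP i.
    move=> ->; have [_ h1] := stepI f N 0%N fS N0.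
    have {}h1 := le_trans (ler_norm _) h1.
    have f1 : 0 <= Im (f 1%N).
      have [N1|N1] := ltnP 1%N N; first by have /andP[/ltW] := fM 1%N N1.
      have NE : N = 1%N by apply/eqP; rewrite eqn_leq N1 N0.
      by apply: le_trans (ltW P0) _; rewrite -NE.
    rewrite /clamp min_l; last by lra.
    by rewrite max_l// sub0r normrN ler0_norm//; lra.
  move: iN; rewrite leq_eqVlt => /orP[/eqP ->|iN]; last first.
    have /andP[h1 h2] : 0 < Im (f i) < pi by apply: fM; rewrite i0 iN.
    rewrite /clamp min_l ?(ltW h2)// max_r ?(ltW h1)// subrr normr0.
    by rewrite (le_trans _ (fS _ N0))// nm_ge0.
  have N1 : (N.-1 < N)%N by rewrite prednK.
  have [_] := stepI f N N.-1 fS N1; rewrite prednK// => h1.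
  have {}h1 := le_trans (ler_norm _) h1.
  have f1 : Im (f N.-1) <= pi.
    have [N2|N2] := posnP N.-1; first by rewrite N2; lra.
    by have /andP[_ /ltW] : 0 < Im (f N.-1) < pi by apply: fM; rewrite N2.
  by rewrite /clamp min_r// max_r ?(ltW P0)// ler0_norm ?subr_le0//; lra.
have overA i : (i <= p)%N -> `|clamp (Im (a i)) - Im (a i)| <= d by exact: over.
have overB j : (j <= q)%N -> `|clamp (Im (b j)) - Im (b j)| <= d by exact: over.
have cl0 t : t <= 0 -> clamp t = 0.
  by move=> t0; rewrite /clamp min_l ?max_l//; lra.
have cl1 t : pi <= t -> clamp t = pi.
  by move=> t0; rewrite /clamp min_r ?max_r//; lra.
have clpos t : 0 < t -> 0 < clamp t.
  by move=> t0; rewrite /clamp lt_max lt_min t0 P0 orbT.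
have cllt t : t < pi -> clamp t < pi.
  by move=> tp; rewrite /clamp gt_max gt_min P0 tp.
have cl01 t : 0 <= clamp t <= pi.
  by rewrite /clamp le_max ge_max ge_min lexx (ltW P0) lexx orbT.
(* Grid point (i, j) compares the i-th point of one chain with the j-th point of the other; a common
   near-zero of [x] and [y] is a near-meeting of the chains. *)
pose x i j := Re (a i) - Re (b j); pose y i j := clamp (Im (a i)) - clamp (Im (b j)).
have sx1 i j : (i < p)%N -> (j <= q)%N ->
    `|x i.+1 j - x i j| <= d /\ `|y i.+1 j - y i j| <= d.
  move=> ip _; have [h1 h2] := stepI a p i aS ip.
  have -> : x i.+1 j - x i j = Re (a i.+1) - Re (a i) by rewrite /x; ring.
  have -> : y i.+1 j - y i j = clamp (Im (a i.+1)) - clamp (Im (a i)) by rewrite /y; ring.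
  by split => //; apply: le_trans h2; exact: clamp_lipschitz.
have sx2 i j : (i <= p)%N -> (j < q)%N ->
    `|x i j.+1 - x i j| <= d /\ `|y i j.+1 - y i j| <= d.
  move=> _ jq; have [h1 h2] := stepI b q j bS jq.
  have -> : x i j.+1 - x i j = - (Re (b j.+1) - Re (b j)) by rewrite /x; ring.
  have -> : y i j.+1 - y i j = - (clamp (Im (b j.+1)) - clamp (Im (b j))) by rewrite /y; ring.
  by rewrite !normrN; split => //; apply: le_trans h2; exact: clamp_lipschitz.
have a00 : `|Im (a 0%N)| <= 1.
  have := overA 0%N isT; rewrite cl0// sub0r normrN; lra.
have b00 : `|Im (b 0%N)| <= 1.
  have := overB 0%N isT; rewrite cl0// sub0r normrN; lra.
have app : `|Im (a p) - pi| <= 1.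
  have := overA p (leqnn p); rewrite cl1// distrC; lra.
have bqq : `|Im (b q) - pi| <= 1.
  have := overB q (leqnn q); rewrite cl1// distrC; lra.
have bq1 : `|Im (b q.-1) - pi| <= 1.
  have qq : (q.-1 < q)%N by rewrite prednK.
  have [_] := stepI b q q.-1 bS qq; rewrite prednK// => h1.
  have {}h1 := le_trans (ler_norm _) h1.
  have h2 : Im (b q.-1) <= pi.
    have [N2|N2] := posnP q.-1; first by rewrite N2; lra.
    by have /andP[_ /ltW] : 0 < Im (b q.-1) < pi by apply: bM; rewrite N2.
  by rewrite ler_norml; apply/andP; split; lra.
have x00 : x 0%N 0%N < 0 by rewrite /x subr_lt0; apply: sep0 => //; [exact: aX|exact: bY].
have xpq : 0 <= x p q by rewrite /x subr_ge0 ltW//; apply: sep1 => //; [exact: aX|exact: bY].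
have xpq1 : 0 <= x p q.-1.
  by rewrite /x subr_ge0 ltW//; apply: sep1 => //; [exact: aX|apply: bY; exact: leq_pred].
have y0j j : (j <= q)%N -> y 0%N j <= 0.
  by move=> _; rewrite /y (cl0 _ a0) sub0r oppr_le0; have /andP[] := cl01 (Im (b j)).
have yiq i : (i <= p)%N -> y i q <= 0.
  by move=> _; rewrite /y (cl1 _ bq) subr_le0; have /andP[] := cl01 (Im (a i)).
have yi0 i : (0 < i <= p)%N -> 0 < y i 0%N.
  move=> /andP[i0]; rewrite /y (cl0 _ b0) subr0 leq_eqVlt => /orP[/eqP ->|ip].
    by rewrite cl1.
  by apply: clpos; have /andP[] : 0 < Im (a i) < pi by apply: aM; rewrite i0.
have ypj j : (j < q)%N -> 0 < y p j.
  move=> jq; rewrite /y (cl1 _ ap) subr_gt0; have [->|j0] := posnP j.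
    by rewrite cl0.
  by apply: cllt; have /andP[] : 0 < Im (b j) < pi by apply: bM; rewrite j0.
have [i [j [ip jq hx hy]]] := grid_zero q0 sx1 sx2 x00 xpq xpq1 y0j yiq yi0 ypj.
exists (a i), (b j); split; [exact: aX|exact: bY|].
(* 2 d for [x], 2 d for [y] and d for each of the two truncations make 6 d. *)
apply: (le_trans (nm_le_ReIm _)).
have -> : Re (a i - b j) = x i j by rewrite /x; case: (a i); case: (b j).
have -> : Im (a i - b j) = y i j - (clamp (Im (a i)) - Im (a i)) + (clamp (Im (b j)) - Im (b j)).
  by rewrite /y; case: (a i) => r s; case: (b j) => r' s' /=; ring.
have := overA i ip; have := overB j jq.
have t1 := ler_normD (y i j - (clamp (Im (a i)) - Im (a i))) (clamp (Im (b j)) - Im (b j)).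
have t2 := ler_normB (y i j) (clamp (Im (a i)) - Im (a i)).
lra.
Qed.

End ChainCrossing.

(** * Inverse branches in the logarithmic coordinate *)

Section SimpleRoots.
Variable F : fieldType.

Lemma uniq_simple_roots (s : seq F) :
  (forall z, z \in s -> ~~ root (\prod_(x <- s) ('X - x%:P))^`() z) -> uniq s.
Proof.
elim: s => //= x s IH hs.
set Q := \prod_(y <- s) ('X - y%:P).
have dQ z : ((\prod_(y <- x :: s) ('X - y%:P))^`()).[z] = Q.[z] + (z - x) * Q^`().[z].
  by rewrite big_cons derivM derivXsubC mul1r !hornerE.
have rQ z : (z \in s) = (Q.[z] == 0) by rewrite -[RHS]/(root Q z) root_prod_XsubC.
apply/andP; split.
  apply/negP => xs; have := hs x (mem_head _ _).
  by rewrite /root dQ subrr mul0r addr0 -rQ xs.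
apply: IH => z zs; have := hs z (mem_behead (s := x :: s) zs).
rewrite /root dQ; move: (zs); rewrite rQ => /eqP ->; rewrite add0r.
by apply: contra => /eqP ->; rewrite mulr0.
Qed.

End SimpleRoots.

(** * Inverse branches of one generator *)

Section Lift.
Variables (R : realType) (sg Rb tau C1 C2 : R).
Hypothesis sg0 : 0 <= sg.
Hypothesis sg1 : sg < 1 / 2.
Hypothesis Rb1 : 1 / 2 < Rb.
Hypothesis C10 : 0 < C1.
Hypothesis C20 : 0 < C2.
Hypothesis shiftC1 : forall b b' s s' : R[i], nm b <= sg -> nm b' <= sg ->
  ln (1 / 2) <= Re s -> ln (1 / 2) <= Re s' ->
  nm (shift_log b s - shift_log b' s') <= C1 * (nm (b - b') + nm (s - s')).
Hypothesis shiftC2 : forall c u u' : R[i], nm c <= sg ->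
  ln (1 / 2) <= Re u -> ln (1 / 2) <= Re u' ->
  nm (u - u') <= C2 * nm (u + shift_log c u - (u' + shift_log c u')).

Definition annulus (z : R[i]) : Prop := 1 / 2 <= nm z <= Rb.

Lemma annulus_Re (u : R[i]) : annulus (cexp u) -> ln (1 / 2) <= Re u <= ln Rb.
Proof.
have R0 : 0 < Rb by rewrite (lt_trans _ Rb1)// divr_gt0.
move=> /andP[]; rewrite nm_cexp => h1 h2; apply/andP; split.
  by rewrite -ler_expR lnK// posrE divr_gt0.
by rewrite -ler_expR lnK// posrE.
Qed.

Variables (p : {poly R[i]}) (c : R[i]) (a : R) (e : R[i] -> R[i]) (d : nat).
Hypothesis a0 : 0 < a.
Hypothesis d0 : (0 < d)%N.
Hypothesis tau1 : tau <= 1.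
Hypothesis pE : forall z, p.[z] = c + a%:C * (z - c) ^+ d + e z.
Hypothesis ps : size p = d.+1.
Hypothesis csg : nm c + tau <= sg.
Hypothesis e_small : forall z, annulus z -> nm (e z) <= tau.
Hypothesis e_lip : forall z z', annulus z -> annulus z' -> nm (e z - e z') <= tau * nm (z - z').
Hypothesis p_in : forall z, annulus p.[z] -> annulus z.
Hypothesis p_simple : forall z, annulus p.[z] -> ~~ root p^`() z.

(** The last clause is a logarithm of p(e^u) - c - e(e^u) = a (e^u - c)^d. It ties s to u itself and
    not only to e^u: among the 2 pi i translates of s it selects one. *)
Let rel (u s : R[i]) : Prop := [/\ annulus (cexp u), annulus (cexp s),
  p.[cexp u] = cexp s &
  d%:R * (u + shift_log c u) + (ln a)%:C = s + shift_log (c + e (cexp u)) s].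

Let nmc : nm c <= sg.
Proof.
(* Evaluating [e_small] at one point of the annulus yields 0 <= tau. *)
have h : annulus (1 / 2)%:C.
  by rewrite /annulus nm_real ger0_norm ?divr_ge0// lexx ltW.
by have := e_small h; have := nm_ge0 (e (1 / 2)%:C); have := csg; lra.
Qed.

Let nmce z : annulus z -> nm (c + e z) <= sg.
Proof.
by move=> /e_small h; rewrite (le_trans (nmD _ _))//; have := csg; lra.
Qed.

Lemma rel_exists u : annulus p.[cexp u] -> exists s, rel u s.
Proof.
move=> hp; have hu := p_in hp.
have [s0 s0E] : exists s, cexp s = p.[cexp u].
  apply: cexp_surj; rewrite -nm_gt0; move: hp => /andP[+ _].
  by apply: lt_le_trans; rewrite divr_gt0.
have /andP[ru _] := annulus_Re hu.
have /andP[rs _] : ln (1 / 2) <= Re s0 <= ln Rb by apply: annulus_Re; rewrite s0E.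
have [m hm] : exists m, d%:R * (u + shift_log c u) + (ln a)%:C =
    s0 + shift_log (c + e (cexp u)) s0 + tpi R m.
  apply: cexp_inj; rewrite (cexpD (d%:R * _)) mulr_natl cexpMn.
  rewrite (cexp_shift sg0 sg1 nmc ru) (cexp_shift sg0 sg1 (nmce hu) rs) s0E pE.
  have -> : cexp (ln a)%:C = a%:C by rewrite /cexp /= cos0 sin0 lnK ?posrE// mulr1 mulr0.
  ring.
exists (s0 + tpi R m); split => //.
- by rewrite cexpD cexp_tpi mulr1 s0E.
- by rewrite cexpD cexp_tpi mulr1 s0E.
- by rewrite shift_log_tpi hm; ring.
Qed.

(** [shiftC2] makes the left side of the logarithmic equation expand and [shiftC1] bounds the right
    side. The term in u - u' on the right comes from the error e(e^u); 4 * Rb is the Lipschitz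
    constant of [cexp] over the annulus, and [tau] is at most 1. *)
Lemma rel_expanding u s u' s' : rel u s -> rel u' s' ->
  d%:R * nm (u - u') <= C2 * ((1 + C1) * nm (s - s') + C1 * (4 * Rb) * nm (u - u')).
Proof.
move=> [hu hs pu ts] [hu' hs' pu' ts'].
have R0 : 0 < Rb by rewrite (lt_trans _ Rb1)// divr_gt0.
have /andP[ru ru2] := annulus_Re hu; have /andP[ru' ru2'] := annulus_Re hu'.
have /andP[rs _] := annulus_Re hs; have /andP[rs' _] := annulus_Re hs'.
have h2 := shiftC2 nmc ru ru'.
have h1 := shiftC1 (nmce hu) (nmce hu') rs rs'.
set T := nm (u + _ - _) in h2.
have dT : d%:R * T <= nm (s - s') + C1 * (nm (e (cexp u) - e (cexp u')) + nm (s - s')).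
  have -> : d%:R * T = nm (d%:R * (u + shift_log c u - (u' + shift_log c u'))).
    by rewrite nmM normcMn nm1.
  have -> : d%:R * (u + shift_log c u - (u' + shift_log c u')) =
      (s - s') + (shift_log (c + e (cexp u)) s - shift_log (c + e (cexp u')) s').
    transitivity (d%:R * (u + shift_log c u) + (ln a)%:C -
                  (d%:R * (u' + shift_log c u') + (ln a)%:C)); first by ring.
    by rewrite ts ts'; ring.
  apply: (le_trans (nmD _ _)); rewrite lerD2l (le_trans h1)//.
  by have -> : c + e (cexp u) - (c + e (cexp u')) = e (cexp u) - e (cexp u') by ring.
have eu : nm (e (cexp u) - e (cexp u')) <= 4 * Rb * nm (u - u').
  apply: (le_trans (e_lip hu hu')); have := cexp_lipschitz ru2 ru2'; rewrite lnK ?posrE//.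
  apply: le_trans; rewrite ler_piMl ?nm_ge0//.
have dd : 0 <= d%:R :> R by [].
have h3 : d%:R * nm (u - u') <= C2 * (d%:R * T).
  by rewrite mulrCA; apply: ler_wpM2l.
apply: (le_trans h3); rewrite ler_pM2l// (le_trans dT)//.
have : C1 * nm (e (cexp u) - e (cexp u')) <= C1 * (4 * Rb * nm (u - u')) by rewrite ler_pM2l.
lra.
Qed.

(** One turn of u is d turns of s, so only the residue modulo d of the turns of s distinguishes the
    branches. *)
Lemma rel_tpi u s r : rel u s -> rel (u + tpi R r) (s + tpi R (r *+ d)).
Proof.
case=> h1 h2 h3 h4; rewrite /rel !cexpD !cexp_tpi !mulr1 !shift_log_tpi.
split => //; transitivity (d%:R * (u + shift_log c u) + (ln a)%:C + d%:R * tpi R r); first by ring.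
by rewrite h4 tpiMn -mulr_natl; ring.
Qed.

Variable lam : R.
Hypothesis lam0 : 0 < lam.
Hypothesis d_large : C2 * (1 + C1) / lam + C2 * (C1 * (4 * Rb)) <= d%:R.

(** The second summand of [d_large] absorbs the term in u - u' of [rel_expanding]; the first turns
    the remaining factor into [lam]. *)
Lemma rel_contracting u s u' s' : rel u s -> rel u' s' -> nm (u - u') <= lam * nm (s - s').
Proof.
move=> h1 h2; have := rel_expanding h1 h2.
set x := nm (u - u'); set y := nm (s - s') => hxy.
have x0 : 0 <= x by exact: nm_ge0.
have y0 : 0 <= y by exact: nm_ge0.
set A := C2 * (1 + C1).
have A0 : 0 < A by rewrite mulr_gt0// ltr_pwDl ?ltW.
have : (A / lam + C2 * (C1 * (4 * Rb))) * x <= d%:R * x by rewrite ler_wpM2r.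
rewrite mulrDl => h3.
have hxy' : d%:R * x <= A * y + C2 * (C1 * (4 * Rb)) * x.
    by apply: (le_trans hxy); rewrite /A le_eqVlt; apply/orP; left; apply/eqP; ring.
  have h4 : A / lam * x <= A * y by lra.
by move: h4; rewrite mulrAC -mulrA ler_pM2l// ler_pdivrMr// mulrC.
Qed.

(** The equation p = e^s has d distinct roots, and a logarithm of the k-th root is related to s
    translated by some m_k turns. If m_k and m_l agree modulo d, a translation makes them equal, and
    contraction at distance zero identifies the two roots. So the m_k fill all residues; one of them
    is 0, and a last translation removes it. *)
Lemma rel_onto s : annulus (cexp s) -> exists u, rel u s.
Proof.
move=> hs; pose w := cexp s.
have p1 : (1 < size p)%N by rewrite ps ltnS.
have [zs szs pw] := closed_poly_split w p1.
rewrite ps /= in szs.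
have lc0 : lead_coef p != 0 by rewrite lead_coef_eq0 -size_poly_gt0 ps.
have zsr z : z \in zs -> p.[z] = w.
  rewrite -root_prod_XsubC => /eqP hz; apply/eqP; rewrite -subr_eq0.
  have := congr1 (horner^~ z) pw.
  by rewrite hornerD hornerN hornerC hornerZ hz mulr0 => ->.
have uzs : uniq zs.
  apply: uniq_simple_roots => z /zsr hz.
  have := @p_simple z; rewrite hz => /(_ hs); apply: contra.
  move=> /eqP hr; apply/eqP.
  have -> : p^`() = (p - w%:P)^`() by rewrite derivB derivC subr0.
  by rewrite pw derivZ hornerZ hr mulr0.
have /choice[um hum] (k : 'I_d) : exists um : R[i] * int,
    cexp um.1 = nth 0 zs k /\ rel um.1 (s + tpi R um.2).
  have kz : nth 0 zs k \in zs by rewrite mem_nth// szs.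
  have [u uE] : exists u, cexp u = nth 0 zs k.
    apply: cexp_surj; have /andP[+ _] : annulus (nth 0 zs k) by apply: p_in; rewrite zsr.
    by rewrite -nm_gt0; apply: lt_le_trans; rewrite divr_gt0.
  have [|s' hs'] := @rel_exists u; first by rewrite uE zsr.
  have [m hm] : exists m, s' = s + tpi R m.
    by apply: cexp_inj; case: hs' => _ _ <- _; rewrite uE zsr.
  by exists (u, m); split => //=; rewrite -hm.
have dz : (d : int) != 0 by case: (d) d0.
pose f (k : 'I_d) : 'I_d := Ordinal (ltac:(
  by rewrite -ltz_nat gez0_abs ?modz_ge0// ltz_pmod) : (`|(um k).2 %% d|%Z%N < d)%N).
have f_inj : injective f.
  move=> k l /(congr1 val) /= fkl.
  have /eqP : (((um k).2 %% d)%Z == ((um l).2 %% d)%Z).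
    by rewrite -(gez0_abs (modz_ge0 _ dz)) fkl gez0_abs ?modz_ge0.
  move=> mkl; pose r := (((um k).2 %/ d)%Z - ((um l).2 %/ d)%Z)%R.
  have mE : (um k).2 = (um l).2 + r *+ d.
    have ek := divz_eq (um k).2 d; have el := divz_eq (um l).2 d.
    have hk : (um k).2 - ((um k).2 %/ d)%Z * d = ((um l).2 %% d)%Z.
      by rewrite {1}ek mkl addrAC subrr add0r.
    have hl : (um l).2 - ((um l).2 %/ d)%Z * d = ((um l).2 %% d)%Z.
      by rewrite {1}el addrAC subrr add0r.
    apply/eqP; rewrite -subr_eq0 -mulr_natr natz; apply/eqP.
    transitivity ((um k).2 - ((um k).2 %/ d)%Z * d - ((um l).2 - ((um l).2 %/ d)%Z * d)).
      by rewrite /r; ring.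
    by rewrite hk hl subrr.
  have [uk rk] := hum k; have [ul rl] := hum l.
  have := rel_tpi r rl; rewrite -addrA -tpiD -mE => rl'.
  have := rel_contracting rk rl'; rewrite subrr nm0 mulr0 => h0.
  have u0 : (um k).1 = (um l).1 + tpi R r.
    by apply/eqP; rewrite -subr_eq0 -nm_eq0 eq_le h0 nm_ge0.
  apply: val_inj; apply/eqP; rewrite -(nth_uniq 0 _ _ uzs) ?szs ?ltn_ord//.
  by rewrite -uk -ul u0 cexpD cexp_tpi mulr1.
have [k fk] : exists k, f k = Ordinal d0.
  have /codomP[k hk] : Ordinal d0 \in codom f by apply: inj_card_onto.
  by exists k.
have [_ rk] := hum k.
have m0 : ((um k).2 %% d)%Z = 0.
  by have := congr1 val fk => /= /eqP; rewrite absz_eq0 => /eqP.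
pose r := ((um k).2 %/ d)%Z.
have mE : (um k).2 = r *+ d by rewrite -mulr_natr natz {1}(divz_eq (um k).2 d) m0 addr0.
exists ((um k).1 + tpi R (- r)).
have := rel_tpi (- r) rk; rewrite -addrA -tpiD mE mulNrn subrr tpi0 addr0.
exact.
Qed.

(** By contraction at distance zero each s has a single related u. Hence any choice of u is the
    branch, and every u lying over the annulus is one of its values. *)
Lemma lift_exists : exists phi : R[i] -> R[i],
  [/\ forall s, annulus (cexp s) -> annulus (cexp (phi s)) /\ p.[cexp (phi s)] = cexp s,
      forall s s', annulus (cexp s) -> annulus (cexp s') ->
        nm (phi s - phi s') <= lam * nm (s - s') &
      forall u, annulus p.[cexp u] -> exists2 s, cexp s = p.[cexp u] & phi s = u].
Proof.
have /choice[phi hphi] s : exists u, annulus (cexp s) -> rel u s.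
  have [hs|nhs] := pselect (annulus (cexp s)); last by exists 0.
  by have [u hu] := rel_onto hs; exists u.
exists phi; split=> [s /hphi[]//|s s' /hphi h /hphi h'|u hu].
  exact: rel_contracting h h'.
have [s hs] := rel_exists hu; exists s; first by case: hs.
have hs2 : annulus (cexp s) by case: hs.
have := rel_contracting (hphi s hs2) hs; rewrite subrr nm0 mulr0 => h0.
by apply/eqP; rewrite -subr_eq0 -nm_eq0 eq_le h0 nm_ge0.
Qed.

End Lift.

(** * Connectedness of the pieces of the Julia set *)

Section Connectivity.
Variables (R : realType) (n : nat) (eps Rb d1 lam : R).
Variables (P : 'I_n -> bool -> {poly R[i]}) (phi : 'I_n -> bool -> R[i] -> R[i]).
Variable K : set R[i].
Hypothesis eps0 : 0 < eps.
Hypothesis eps1 : eps < 1 / 2.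
Hypothesis Rb1 : 1 / 2 < Rb.
Hypothesis d1_small : d1 <= eps / 16.
Hypothesis K_annulus : forall z, K z -> annulus Rb z.
Hypothesis K_nonempty : exists z, K z.
Hypothesis K_invariant : forall z, K z <-> exists j b, K (P j b).[z].
Hypothesis phi_section : forall j b s, annulus Rb (cexp s) ->
  annulus Rb (cexp (phi j b s)) /\ (P j b).[cexp (phi j b s)] = cexp s.
Hypothesis phi_contract : forall j b s s', annulus Rb (cexp s) -> annulus Rb (cexp s') ->
  nm (phi j b s - phi j b s') <= lam * nm (s - s').
Hypothesis phi_onto : forall j b u, annulus Rb (P j b).[cexp u] ->
  exists2 s, cexp s = (P j b).[cexp u] & phi j b s = u.
Hypothesis P_near_circle : forall j (b : bool) z, annulus Rb (P j b).[z] ->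
  `|nm (z - (if b then eps%:C else 0)) - j.+1%:R| <= d1.

(** Height plus width of a period rectangle of the lifted annulus, hence a bound for the distance of
    two of its points up to translation by turns. *)
Let delta0 : R := pi *+ 2 + (ln Rb - ln (1 / 2)).
Hypothesis lam0 : 0 <= lam.
Hypothesis lam1 : lam <= 1 / 12.
Hypothesis lam2 : lam * delta0 <= 1 / 2.

(* The part of K near the circles of radius j + 1, pulled back to the universal
   cover of the punctured plane. *)
Definition lifted_piece (j : 'I_n) : set R[i] := [set u | exists b, K (P j b).[cexp u]].

Let X j b m := [set u | exists2 s, lifted_piece m s & phi j b s = u].

Lemma lifted_pieceP u : K (cexp u) <-> exists j, lifted_piece j u.
Proof. exact: K_invariant. Qed.

Lemma lifted_piece_annulus j u : lifted_piece j u -> annulus Rb (cexp u).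
Proof. by move=> h; apply: K_annulus; apply/lifted_pieceP; exists j. Qed.

Lemma lifted_piece_tpi j u m : lifted_piece j u -> lifted_piece j (u + tpi R m).
Proof. by move=> [b hb]; exists b; rewrite cexpD cexp_tpi mulr1. Qed.

Lemma lifted_piece_split j u : lifted_piece j u <-> exists b m, X j b m u.
Proof.
split=> [[b hb]|[b [m [s hs <-]]]].
  have [s sE su] := phi_onto (K_annulus hb).
  have [m hm] : exists m, lifted_piece m s by apply/lifted_pieceP; rewrite sE.
  by exists b, m, s.
exists b; have [_ ->] := phi_section j b (lifted_piece_annulus hs).
by apply/lifted_pieceP; exists m.
Qed.

Lemma lifted_piece_nonempty j : exists u, lifted_piece j u.
Proof.
have [z Kz] := K_nonempty.
have z0 : z != 0.
  by rewrite -nm_gt0; have /andP[+ _] := K_annulus Kz; apply: lt_le_trans; rewrite divr_gt0.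
have [s sE] := cexp_surj z0.
have [_ h] : annulus Rb (cexp (phi j true s)) /\ (P j true).[cexp (phi j true s)] = cexp s.
  by apply: phi_section; rewrite sE; exact: K_annulus.
by exists (phi j true s), true; rewrite h sE.
Qed.

(** [phi_onto] presents the translate as a value of [phi] at a logarithm of the same point, which
    differs from the old one by a period, and lifted pieces are periodic. Consequently every
    [X j b m] reaches all heights. *)
Lemma X_tpi j b m u r : X j b m u -> X j b m (u + tpi R r).
Proof.
move=> [s hs su].
have as_ := lifted_piece_annulus hs.
have [_ h] := phi_section j b as_.
have hP : (P j b).[cexp (u + tpi R r)] = cexp s by rewrite cexpD cexp_tpi mulr1 -su h.
have [|s' s'E s'u] := @phi_onto j b (u + tpi R r); first by rewrite hP.
exists s' => //; have [k ->] : exists k, s' = s + tpi R k by apply: cexp_inj; rewrite s'E hP.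
exact: lifted_piece_tpi.
Qed.

Lemma X_low_high j b m : (exists2 u, X j b m u & Im u <= 0) /\
  (exists2 u, X j b m u & pi <= Im u).
Proof.
have [s hs] := lifted_piece_nonempty m.
have Xu : X j b m (phi j b s) by exists s.
set u := phi j b s in Xu; have [r /andP[r1 r2]] := floor_period (Im u).
have P0 := @pi_gt0 R.
have ImD (k : int) : Im (u + tpi R k) = Im u + k%:~R * (pi *+ 2) by case: (u).
split.
  exists (u + tpi R (- (r + 1))); first exact: X_tpi.
  by rewrite ImD rmorphN rmorphD/= mulNr mulrDl mul1r; lra.
exists (u + tpi R (- r + 1)); first exact: X_tpi.
by rewrite ImD rmorphD rmorphN/= mulrDl mulNr mul1r mulr2n in r1 r2 *; lra.
Qed.

Lemma cos_ge_half (t : R) : `|t| <= 1 -> 1 / 2 <= cos t.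
Proof.
move=> t1; have -> : t = (t / 2) *+ 2 by rewrite mulr2n -splitr.
rewrite cos_mulr2n cos2sin2.
have := sin_lipschitz (t / 2) 0; rewrite sin0 !subr0.
have : `|t / 2| <= 1 / 2 by rewrite normrM [`|2^-1|]ger0_norm// ler_wpM2r.
move=> h1 h2; have h3 := le_trans h2 h1.
have : sin (t / 2) ^+ 2 <= 1 / 4.
  rewrite -real_normK ?num_real//; have := normr_ge0 (sin (t / 2)); nra.
by move=> h4; rewrite [(1 - _) *+ 2]mulr2n; lra.
Qed.

Lemma nm_cexp_sub (v : R[i]) : nm (cexp v - eps%:C) ^+ 2 =
  expR (Re v) ^+ 2 - 2 * expR (Re v) * eps * cos (Im v) + eps ^+ 2.
Proof.
rewrite nm_sqr /= subr0.
have := cos2Dsin2 (Im v); move: (cos _) (sin _) (expR _) => x y r h.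
transitivity (r ^+ 2 * (x ^+ 2 + y ^+ 2) - 2 * r * eps * x + eps ^+ 2); first by ring.
by rewrite h mulr1.
Qed.

(** By the law of cosines ([nm_cexp_sub]), moving the center of the circle of radius r to eps
    changes the modulus of its points by about eps cos (Im v): outwards near the positive real axis,
    inwards near the negative one. With r >= 1 and eps < 1/2 the second-order term does not reverse
    this, nor do errors of size d1 <= eps / 16. *)
Lemma circles_side (v : R[i]) (r q : R) (b : bool) : 1 <= r ->
  `|nm (cexp v - eps%:C) - r| <= d1 -> `|q - r| <= d1 ->
  1 / 2 <= (if b then cos (Im v) else - cos (Im v)) ->
  if b then q < expR (Re v) else expR (Re v) < q.
Proof.
move=> r1; rewrite !ler_norml => /andP[N1 N2] /andP[q1 q2] hc.
have NE := nm_cexp_sub v.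
have x0 := expR_gt0 (Re v).
have Nx : nm (cexp v - eps%:C) <= expR (Re v) + eps.
  by rewrite (le_trans (nmB _ _))// nm_cexp nm_real ger0_norm// ltW.
move: N1 N2 NE Nx hc; set N := nm _; set x := expR _ in x0 *; set k := cos _.
have d1b := d1_small; have e0 := eps0; have e1 := eps1.
have dr : r * d1 <= r * (eps / 16) by rewrite ler_wpM2l//; lra.
have re : eps <= r * eps by rewrite ler_peMl// ltW.
move=> N1 N2 NE Nx; case: b => hc; rewrite ltNge; apply/negP => xq.
- have xr : x <= r + d1 by lra.
  have Nr : (r - d1) ^+ 2 <= N ^+ 2 by rewrite ler_sqr ?nnegrE; lra.
  have xk : x * eps * (1 / 2) <= x * eps * k by rewrite ler_pM2l// mulr_gt0.
  have h1 : N ^+ 2 <= x * (x - eps) + eps ^+ 2 by rewrite NE; nra.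
  have h2 : x * (x - eps) <= (r + d1) * (r + d1 - eps).
    rewrite -subr_ge0; have -> : (r + d1) * (r + d1 - eps) - x * (x - eps) =
      (r + d1 - x) * (r + d1 + x - eps) by ring.
    by rewrite mulr_ge0; lra.
  have h3 : eps * eps <= eps * (1 / 2) by rewrite ler_pM2l// ltW.
  have : (r - d1) ^+ 2 <= (r + d1) * (r + d1 - eps) + eps ^+ 2 by lra.
  have : 0 <= d1 by lra.
  nra.
- have xr : r - d1 <= x by lra.
  have N0 : 0 <= N by exact: nm_ge0.
  have Nr : N ^+ 2 <= (r + d1) ^+ 2 by rewrite ler_sqr ?nnegrE; lra.
  have xk : x * eps * (1 / 2) <= x * eps * (- k) by rewrite ler_pM2l// mulr_gt0.
  have h1 : x * (x + eps) + eps ^+ 2 <= N ^+ 2 by rewrite NE; nra.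
  have h2 : (r - d1) * (r - d1 + eps) <= x * (x + eps).
    by apply: ler_pM; lra.
  have : 0 <= d1 by lra.
  have := mulr_gt0 e0 e0.
  nra.
Qed.

Lemma X_cross j m m' d : d <= 1 / 2 ->
  chain_connected d (X j false m) -> chain_connected d (X j true m') ->
  exists u v, [/\ X j false m u, X j true m' v & nm (u - v) <= 6 * d].
Proof.
move=> dd c1 c2; have [l1 h1] := X_low_high j false m; have [l2 h2] := X_low_high j true m'.
have circ b k u : X j b k u -> `|nm (cexp u - (if b then eps%:C else 0)) - j.+1%:R| <= d1.
  move=> [s hs <-]; apply: P_near_circle.
  by have [_ ->] := phi_section j b (lifted_piece_annulus hs); exact: lifted_piece_annulus hs.
have r1 : 1 <= j.+1%:R :> R by rewrite ler1n.
(* Within 1 of height 0 the cosine is at least 1/2, within 1 of height pi it is at most -1/2, so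
   [circles_side] gives opposite orders. *)
apply: chains_cross => // u v Xu Xv hu hv; rewrite -ltr_expR.
- have := @circles_side v j.+1%:R (nm (cexp u)) true r1 (circ _ _ _ Xv).
  rewrite nm_cexp -{1}nm_cexp -[cexp u]subr0; apply; first exact: circ Xu.
  exact: cos_ge_half.
- have := @circles_side v j.+1%:R (nm (cexp u)) false r1 (circ _ _ _ Xv).
  rewrite nm_cexp -{1}nm_cexp -[cexp u]subr0; apply; first exact: circ Xu.
  have -> : - cos (Im v) = cos (Im v - pi) by rewrite cosB cospi sinpi; ring.
  exact: cos_ge_half.
Qed.

Lemma dist_le_sym d (u v : R[i]) : dist_le d u v -> dist_le d v u.
Proof. by rewrite /dist_le nm_distC. Qed.

Lemma chain_connected_half d : 0 <= d -> d <= delta0 ->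
  (forall j, chain_connected d (lifted_piece j)) ->
  forall j, chain_connected (d / 2) (lifted_piece j).
Proof.
move=> dge0 dd0 cc j.
(* The images have step lam d and crossing between them costs 6 lam d, which must not exceed d / 2;
   [ld2] is the condition on the step in [X_cross]. *)
have ld : lam * d <= d / 12 by have := lam1; nra.
have ld2 : lam * d <= 1 / 2 by apply: le_trans lam2; rewrite ler_wpM2l.
have cX b m : chain_connected (lam * d) (X j b m).
  move=> _ _ [s hs <-] [s' hs' <-].
  apply: chain_image (cc m s s' hs hs') => [t ht|t t' ht ht' tt']; first by exists t.
  apply: (le_trans (phi_contract _ _ (lifted_piece_annulus ht) (lifted_piece_annulus ht'))).
  by rewrite ler_wpM2l.
have subX b m : X j b m `<=` lifted_piece j.
  by move=> u hu; apply/lifted_piece_split; exists b, m.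
have within b m u v : X j b m u -> X j b m v -> chain (lifted_piece j) (dist_le (d / 2)) u v.
  move=> hu hv; apply: chain_mono (cX b m u v hu hv); first exact: subX.
  by move=> x y; rewrite /dist_le => h; apply: (le_trans h); lra.
have cross m m' u v : X j false m u -> X j true m' v ->
    chain (lifted_piece j) (dist_le (d / 2)) u v.
  move=> hu hv; have [x [y [hx hy xy]]] := X_cross ld2 (cX false m) (cX true m').
  apply: chain_trans (within _ _ _ _ hu hx) _.
  apply: chain_trans (within _ _ _ _ hy hv).
  by apply: chain1; [exact: subX hx|exact: subX hy|rewrite /dist_le; lra].
have cross' m m' u v : X j true m u -> X j false m' v ->
    chain (lifted_piece j) (dist_le (d / 2)) u v.
  by move=> hu hv; apply: chain_sym; [exact: dist_le_sym|exact: cross hv hu].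
have Xne b m : exists u, X j b m u.
  by have [s hs] := lifted_piece_nonempty m; exists (phi j b s), s.
move=> u v /lifted_piece_split[b [m hu]] /lifted_piece_split[b' [m' hv]].
case: b hu => hu; case: b' hv => hv.
- have [w hw] := Xne false m.
  exact: chain_trans (cross' _ _ _ _ hu hw) (cross _ _ _ _ hw hv).
- exact: cross' hu hv.
- exact: cross hu hv.
- have [w hw] := Xne true m.
  exact: chain_trans (cross _ _ _ _ hu hw) (cross' _ _ _ _ hw hv).
Qed.

Lemma ln_gap_ge0 : 0 <= ln Rb - ln (1 / 2).
Proof.
rewrite subr_ge0 ler_ln ?posrE ?(ltW Rb1) ?divr_gt0//.
by rewrite (lt_trans _ Rb1)// divr_gt0.
Qed.

Lemma chain_connected_base j : chain_connected delta0 (lifted_piece j).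
Proof.
have P0 := @pi_gt0 R; have L0 := ln_gap_ge0.
have stepn u (k : nat) : lifted_piece j u ->
    chain (lifted_piece j) (dist_le delta0) u (u + tpi R k).
  move=> hu; elim: k => [|k IH]; first by rewrite tpi0 addr0; apply: chain_refl.
  apply: chain_trans IH _; apply: chain1; try exact: lifted_piece_tpi.
  rewrite /dist_le -addn1 PoszD tpiD.
  have -> : u + tpi R k - (u + (tpi R k + tpi R 1)) = - tpi R 1 by ring.
  by rewrite nmN nm_tpi1 /delta0; lra.
have step u (k : int) : lifted_piece j u ->
    chain (lifted_piece j) (dist_le delta0) u (u + tpi R k).
  move=> hu; case: k => k; first exact: stepn.
  rewrite NegzE; apply: chain_sym; first exact: dist_le_sym.
  have := stepn (u + tpi R (- k.+1%:Z)) k.+1 (lifted_piece_tpi _ hu).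
  by rewrite tpiN subrK.
(* Whole turns bring u to less than 2 pi below v; one step of length [delta0] then suffices. *)
move=> u v hu hv; have [m /andP[m1 m2]] := floor_period (Im v - Im u).
apply: chain_trans (step u m hu) _; apply: chain1 => //; first exact: lifted_piece_tpi.
apply: (le_trans (nm_le_ReIm _)).
have -> : Re (u + tpi R m - v) = Re u - Re v by case: (u) => a b; case: (v) => a' b' /=; ring.
have -> : Im (u + tpi R m - v) = - (Im v - Im u - m%:~R * (pi *+ 2)).
  by case: (u) => a b; case: (v) => a' b' /=; ring.
rewrite normrN (ger0_norm m1) addrC /delta0 lerD ?(ltW m2)//.
have /andP[a1 a2] := annulus_Re Rb1 (lifted_piece_annulus hu).
have /andP[b1 b2] := annulus_Re Rb1 (lifted_piece_annulus hv).
by rewrite ler_norml; apply/andP; split; lra.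
Qed.

Lemma chain_connected_all k j : chain_connected (delta0 / 2 ^+ k) (lifted_piece j).
Proof.
have D0 : 0 < delta0 by rewrite ltr_pwDl ?ln_gap_ge0// mulrn_wgt0// pi_gt0.
elim: k j => [|k IH] j; first by rewrite expr0 divr1; exact: chain_connected_base.
rewrite exprSr invfM mulrA; apply: chain_connected_half => //.
  by rewrite divr_ge0 ?(ltW D0)// exprn_ge0.
by rewrite ler_pdivrMr ?exprn_gt0// ler_peMr ?(ltW D0)// exprn_ege1// ler1n.
Qed.

Definition piece (j : 'I_n) : set (rsphere R) :=
  [set p | exists2 z, p = Some z & exists b, K (P j b).[z]].

Lemma piece_connected j : compact (piece j) -> connected (piece j).
Proof.
move=> cJ; apply: connected_of_chains => // e e0.
have [d dpos hd] := gap_small e0.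
have R0 : 0 < Rb by rewrite (lt_trans _ Rb1)// divr_gt0.
(* 4 * Rb is the Lipschitz constant of [cexp] over the annulus; below 1, the squared distance that
   bounds the gap is at most the distance. *)
pose t := Num.min 1 (d / 4) / (4 * Rb).
have t0 : 0 < t by rewrite divr_gt0 ?mulr_gt0// lt_min ltr01 divr_gt0.
have [k hk] : exists k, delta0 / 2 ^+ k < t.
  have D0 : 0 < delta0 by rewrite ltr_pwDl ?ln_gap_ge0// mulrn_wgt0// pi_gt0.
  exists (Num.truncn (delta0 / t)).+1; rewrite ltr_pdivrMr ?exprn_gt0// mulrC -ltr_pdivrMr//.
  rewrite (lt_trans (truncnS_gt _))// -natrX ltr_nat; exact: ltn_expl.
move=> x y [z -> [b hb]] [z' -> [b' hb']].
have lift w (c : bool) : K (P j c).[w] -> exists2 u, cexp u = w & lifted_piece j u.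
  move=> hw; have Kw : K w by apply/K_invariant; exists j, c.
  have [u uE] : exists u, cexp u = w.
    apply: cexp_surj; rewrite -nm_gt0; have /andP[+ _] := K_annulus Kw.
    by apply: lt_le_trans; rewrite divr_gt0.
  by exists u => //; exists c; rewrite uE.
have [u <- hu] := lift _ _ hb; have [v <- hv] := lift _ _ hb'.
apply: (@chain_image _ _ (fun u => Some (cexp u)) (lifted_piece j)) (chain_connected_all k hu hv).
- by move=> w [c hc]; exists (cexp w) => //; exists c.
- move=> w w' hw hw' ww'; apply: hd; apply: (le_lt_trans (gap_fin_le _ _)).
  have /andP[_ a2] := annulus_Re Rb1 (lifted_piece_annulus hw).
  have /andP[_ b2] := annulus_Re Rb1 (lifted_piece_annulus hw').
  have := cexp_lipschitz a2 b2; rewrite lnK ?posrE// => h.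
  have h2 : 4 * Rb * nm (w - w') < Num.min 1 (d / 4).
    by rewrite mulrC -ltr_pdivlMr ?mulr_gt0// (le_lt_trans ww').
  have := le_lt_trans h h2; rewrite lt_min => /andP[q1 q2].
  have := nm_ge0 (cexp w - cexp w'); set q := nm _ in q1 q2 * => q0.
  nra.
Qed.

End Connectivity.

(** * Counting the components *)

Section CountComponents.
Variables (R : realType) (n : nat) (J : set (rsphere R)) (Q : 'I_n -> set (rsphere R)).
Hypothesis JE : J = \bigcup_j Q j.
Hypothesis Q_connected : forall j, connected (Q j).
Hypothesis Q_closed : forall j, closed (Q j).
Hypothesis Q_nonempty : forall j, Q j !=set0.
Hypothesis Q_disjoint : forall j k p, Q j p -> Q k p -> j = k.

(** The other pieces are finitely many closed sets disjoint from [Q j], so [Q j] is open and closed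
    in [J] and a connected set through p cannot leave it. *)
Lemma component_of_piece j p : Q j p -> connected_component J p = Q j.
Proof.
move=> Qp; apply/seteqP; split; last first.
  apply: connected_component_max => //.
  by move=> q Qq; rewrite JE; exists j.
move=> q [C [Cp CJ cC] Cq].
have oC : open (~` \bigcup_(k in [set k | k != j]) Q k).
  by apply: closed_openC; apply: closed_bigcup => //; exact: finite_finset.
have CE : C `&` Q j = C `&` ~` \bigcup_(k in [set k | k != j]) Q k.
  apply/seteqP; split => x [Cx hx]; split => //.
    by move=> [k /= kj Qk]; move/eqP: kj; apply; exact: Q_disjoint Qk hx.
  have : J x by exact: CJ.
  rewrite JE => -[k _ Qk]; have [<- //|kj] := eqVneq k j.
  by exfalso; apply: hx; exists k.
have : C `&` Q j = C.
  apply: cC; first by exists p.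
    by exists (~` \bigcup_(k in [set k | k != j]) Q k).
  by exists (Q j).
by move=> CQ; move: Cq; rewrite -CQ => -[].
Qed.

Lemma card_components : (connected_component J @` J #= `I_n)%card.
Proof.
have -> : connected_component J @` J = Q @` [set: 'I_n].
  apply/seteqP; split => [_ [p Jp <-]|_ [j _ <-]].
    by move: (Jp); rewrite {1}JE => -[j _ Qp]; exists j => //; rewrite (component_of_piece Qp).
  have [p Qp] := Q_nonempty j; exists p; first by rewrite JE; exists j.
  exact: component_of_piece.
rewrite (card_eqr card_II); apply: inj_card_eq => j k _ _ jk.
by have [p Qp] := Q_nonempty j; apply: (Q_disjoint Qp); rewrite -jk.
Qed.

End CountComponents.

(** * From estimates on the generators to the number of components *)

Section Assembly.
Variables (R : realType) (n : nat) (eps Rb d1 lam rho : R).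
Variable h : 'I_n -> bool -> cpoly R.
Variable phi : 'I_n -> bool -> R[i] -> R[i].
Hypothesis n0 : (0 < n)%N.
Hypothesis eps0 : 0 < eps.
Hypothesis eps1 : eps < 1 / 2.
Hypothesis Rb1 : 1 / 2 < Rb.
Hypothesis rho1 : rho < 1 / 2.
Hypothesis d1_small : d1 <= eps / 16.
Hypothesis d1_gap : 2 * d1 + 2 * eps < 1.
Hypothesis lam0 : 0 <= lam.
Hypothesis lam1 : lam <= 1 / 12.
Hypothesis lam2 : lam * (pi *+ 2 + (ln Rb - ln (1 / 2))) <= 1 / 2.

Local Notation pol j b := (val (h j b)).

Hypothesis h_inner : forall j b z, nm z <= 1 / 2 -> nm (pol j b).[z] <= rho.
Hypothesis h_contract : forall j b z z', nm z <= 1 / 2 -> nm z' <= 1 / 2 ->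
  nm ((pol j b).[z] - (pol j b).[z']) <= 1 / 2 * nm (z - z').
Hypothesis h_outer : forall j b z, Rb <= nm z -> 2 * nm z <= nm (pol j b).[z].
Hypothesis h_crit : forall j b z, root (pol j b)^`() z -> nm z <= 1 / 2.
Hypothesis h_deg : forall j b, (2 <= cpoly_deg (h j b))%N.
Hypothesis phi_section : forall j b s, annulus Rb (cexp s) ->
  annulus Rb (cexp (phi j b s)) /\ (pol j b).[cexp (phi j b s)] = cexp s.
Hypothesis phi_contract : forall j b s s', annulus Rb (cexp s) -> annulus Rb (cexp s') ->
  nm (phi j b s - phi j b s') <= lam * nm (s - s').
Hypothesis phi_onto : forall j b u, annulus Rb (pol j b).[cexp u] ->
  exists2 s, cexp s = (pol j b).[cexp u] & phi j b s = u.
Hypothesis h_near_circle : forall j (b : bool) z, annulus Rb (pol j b).[z] ->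
  `|nm (z - (if b then eps%:C else 0)) - j.+1%:R| <= d1.

Let hs (i : 'I_n * bool) := h i.1 i.2.
Local Notation G := (semigroup_gen (range hs)).

Lemma assembly : postcritically_bounded G /\ (julia_components G #= `I_n)%card.
Proof.
have i0 : 'I_n * bool := (Ordinal n0, true).
have H1 i : forall z, nm z <= 1 / 2 -> nm (val (hs i)).[z] <= rho by exact: h_inner.
have H2 i : forall z z', nm z <= 1 / 2 -> nm z' <= 1 / 2 ->
  nm ((val (hs i)).[z] - (val (hs i)).[z']) <= 1 / 2 * nm (z - z') by exact: h_contract.
have H3 i : forall z, Rb <= nm z -> 2 * nm z <= nm (val (hs i)).[z] by exact: h_outer.
have H4 i : forall z, root (val (hs i))^`() z -> nm z <= 1 / 2 by exact: h_crit.
have H5 i : (2 <= cpoly_deg (hs i))%N by exact: h_deg.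
split; first exact: (hyperbolic_postcritically_bounded rho1 H1 H4 H5 i0).
have Jann := julia_annulus rho1 Rb1 H1 H2 H3.
have Jc := compact_julia rho1 Rb1 H1 H2 H3.
have Jne := julia_nonempty rho1 Rb1 H1 H3 i0.
pose K : set R[i] := [set z | julia_set G (Some z)].
have Kann z : K z -> annulus Rb z by move=> /Jann[_ [<-]].
have Kne : exists z, K z.
  by have [p Jp] := Jne; have [z pz _] := Jann p Jp; exists z; rewrite /K /= -pz.
have Kinv z : K z <-> exists j b, K (pol j b).[z].
  rewrite /K /= julia_invariant; split=> [[[j b] hz]|[j [b hz]]]; first by exists j, b.
  by exists (j, b).
pose Q := piece (fun j b => pol j b) K.
have Qclosed j : closed (Q j).
  have -> : Q j = (cpoly_map (h j true) @^-1` julia_set G) `|` (cpoly_map (h j false) @^-1` julia_set G).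
    apply/seteqP; split => [_ [z -> [[] hz]]|[z|] [] //= hz]; [by left|by right|..].
    - by exists z => //; exists true.
    - by exists z => //; exists false.
    - by have [] := Jann _ hz.
    - by have [] := Jann _ hz.
  by apply: closedU; apply: preimage_closed => [x _|];
    [exact: cpoly_map_continuous|exact: julia_set_closed|exact: cpoly_map_continuous|exact: julia_set_closed].
have QJ j : Q j `<=` julia_set G.
  by move=> _ [z -> [b hb]]; apply/Kinv; exists j, b.
apply: (card_components (Q := Q)) => //.
- apply/seteqP; split => [p Jp|p [j _ Qp]]; last exact: QJ Qp.
  have [z pz _] := Jann p Jp; move: Jp; rewrite pz => /Kinv[j [b hb]].
  by exists j => //; exists z => //; exists b.
- move=> j; apply: (piece_connected eps0 eps1 Rb1 d1_small Kann Kne Kinv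
    phi_section phi_contract phi_onto h_near_circle lam0 lam1 lam2).
  exact: subclosed_compact (Qclosed j) Jc (QJ j).
- move=> j; have [z Kz] := Kne.
  have z0 : z != 0.
    by rewrite -nm_gt0; have /andP[+ _] := Kann z Kz; apply: lt_le_trans; rewrite divr_gt0.
  have [s sE] := cexp_surj z0.
  have [|_ hh] := @phi_section j true s; first by rewrite sE; exact: Kann.
  by exists (Some (cexp (phi j true s))), (cexp (phi j true s)) => //; exists true; rewrite hh sE.
(* Moving the center from eps to 0 costs at most eps, so piece j lies within d1 + eps of the circle
   of radius j + 1; [d1_gap] keeps consecutive circles apart. *)
- have far j b z : K (pol j b).[z] -> `|nm z - j.+1%:R| <= d1 + eps.
    move=> /Kann/h_near_circle hz.
    have : `|nm z - nm (z - (if b then eps%:C else 0))| <= eps.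
      set c := if b then _ else _; have cE : nm c <= eps.
        by rewrite /c; case: b {hz c}; rewrite ?nm0 ?nm_real ?ger0_norm// ltW.
      rewrite ler_norml; have := nmB z c; have := nmB_ge z (z - c).
      have -> : z - (z - c) = c by ring.
      lra.
    by move: hz; rewrite !ler_norml => /andP[? ?] /andP[? ?]; apply/andP; split; lra.
  move=> j k p [z -> [b hb]] [_ [<-] [b' hb']].
  have := far _ _ _ hb; have := far _ _ _ hb'; rewrite !ler_norml.
  move=> /andP[a1 a2] /andP[b1 b2]; apply/val_inj/eqP; rewrite eqn_leq /=.
  have gap (x y : nat) : x.+1%:R - y.+1%:R < 1 :> R -> (x <= y)%N.
    by rewrite ltrBlDr addrC natr1 ltr_nat !ltnS.
  by apply/andP; split; apply: gap; have := d1_gap; lra.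
Qed.

End Assembly.

(** * Uniform neighbourhoods of polynomial maps *)

Section CauchyEstimates.
Variable R : realType.
Implicit Types (p : {poly R[i]}) (z : R[i]).

Lemma prim_root_exists (N : nat) : (0 < N)%N -> exists z : R[i], N.-primitive_root z.
Proof.
move=> N0; have [s hs] := closed_field_poly_normal ('X^N - 1 : {poly R[i]}).
have lc : lead_coef ('X^N - 1 : {poly R[i]}) = 1.
  by rewrite -polyC1 lead_coefXnsubC.
rewrite lc scale1r in hs.
have us : uniq s.
  apply: uniq_simple_roots => z zs; rewrite -hs derivB derivXn -polyC1 derivC subr0.
  rewrite /root hornerMn hornerXn mulrn_eq0 negb_or -lt0n N0 /= expf_eq0 negb_and.
  apply/orP; right; apply: contraTneq zs => ->; rewrite -root_prod_XsubC -hs.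
  by rewrite /root !hornerE ?hornerXn expr0n gtn_eqF// sub0r oppr_eq0 oner_eq0.
have ss : size s = N.
  have := congr1 (fun q : {poly R[i]} => size q) hs.
  by rewrite -polyC1 size_XnsubC// size_prod_XsubC => -[].
have /hasP[z _ hz] : has N.-primitive_root s.
  apply: cyclic.has_prim_root => //; last by rewrite ss.
  by apply/allP => z zs; rewrite unity_rootE -subr_eq0; move: zs;
    rewrite -root_prod_XsubC -hs /root !hornerE ?hornerXn.
by exists z.
Qed.

Lemma nm_prim_root (N : nat) z i : N.-primitive_root z -> nm (z ^+ i) = 1.
Proof.
move=> hz; have N0 := prim_order_gt0 hz.
have : nm z ^+ N = 1 by rewrite -nmX (prim_expr_order hz) nm1.
by move/eqP; rewrite pexpr_eq1 ?nm_ge0// nmX => /eqP ->; rewrite expr1n.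
Qed.

Lemma sum_prim_root (N m : nat) z : N.-primitive_root z ->
  \sum_(i < N) z ^+ (i * m) = if (N %| m)%N then N%:R else 0.
Proof.
move=> hz; case: ifP => hm.
  rewrite (eq_bigr (fun=> 1)); first by rewrite sumr_const card_ord.
  move=> i _; apply/eqP; rewrite -(prim_order_dvd hz); exact: dvdn_mull.
have x1 : z ^+ m - 1 != 0 by rewrite subr_eq0 -(prim_order_dvd hz) hm.
have hx : (z ^+ m) ^+ N = 1 by rewrite exprAC (prim_expr_order hz) expr1n.
apply: (mulfI x1); rewrite mulr0.
under eq_bigr do rewrite mulnC exprM.
by rewrite -subrX1 hx subrr.
Qed.

(* Averaging over the N-th roots of unity, N > deg p, isolates one coefficient. *)
Lemma coef_cauchy p (r B : R) k : 0 <= r ->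
  (forall z, nm z = r -> nm p.[z] <= B) -> nm p`_k * r ^+ k <= B.
Proof.
move=> r0 hB; have B0 : 0 <= B.
  by apply: le_trans (nm_ge0 _) (hB r%:C _); rewrite nm_real ger0_norm.
have [kp|pk] := ltnP k (size p); last by rewrite nth_default// nm0 mul0r.
pose N := size p; have N0 : (0 < N)%N by exact: leq_ltn_trans kp.
have [z hz] := prim_root_exists N0.
have NR : 0 < N%:R :> R by rewrite ltr0n.
rewrite -(ler_pM2l NR).
(* The weight moves degree j to the exponent j + N - k, which is a multiple of N only for j = k
   because both are below N. *)
have -> : N%:R * (nm p`_k * r ^+ k) = nm (\sum_(i < N) p.[r%:C * z ^+ i] * z ^+ (i * (N - k))).
  have -> : \sum_(i < N) p.[r%:C * z ^+ i] * z ^+ (i * (N - k)) =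
      \sum_(j < N) p`_j * r%:C ^+ j * \sum_(i < N) z ^+ (i * (j + (N - k))).
    rewrite (eq_bigr (fun i : 'I_N => \sum_(j < N) p`_j * r%:C ^+ j * z ^+ (i * (j + (N - k))))).
      by rewrite exchange_big /=; apply: eq_bigr => j _; rewrite mulr_sumr.
    move=> i _; rewrite horner_coef mulr_suml; apply: eq_bigr => j _.
    by rewrite exprMn mulnDr exprD -exprM; ring.
  rewrite (bigD1 (Ordinal kp)) //= [X in _ + X]big1 => [|j jk].
    rewrite addr0 sum_prim_root// subnKC ?(ltnW kp)// dvdnn !nmM nmX nm_real ger0_norm//.
    by rewrite normcMn nm1; ring.
  rewrite sum_prim_root//; case: ifP => [|_]; last by rewrite mulr0.
  move=> /dvdnP[q hq]; exfalso; move/eqP: jk; apply.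
  apply: val_inj => /=; have jN := ltn_ord j.
  have q1 : q = 1%N.
    move: hq kp jN; rewrite -/N; case: q => [|[//|q]]; rewrite ?mul0n ?mulSn; lia.
  by move: hq; rewrite q1 mul1n; move: kp; rewrite -/N; lia.
apply: (le_trans (nm_sum _ _ _)).
rewrite -[N in N%:R]card_ord mulrC mulr_natr -sumr_const; apply: ler_sum => i _.
rewrite nmM (nm_prim_root _ hz) mulr1; apply: hB.
by rewrite nmM (nm_prim_root _ hz) nm_real ger0_norm// mulr1.
Qed.

(* All the roots of p lie in the disk of radius r, so the geometric mean of |p|
   over deg p equidistributed points of the circle is at most
   2 |lead_coef p| r ^ deg p. *)
Lemma lead_coef_lower p (r : R) : (1 < size p)%N -> 0 < r ->
  (forall z, r <= nm z -> p.[z] != 0) -> (forall z, nm z = r -> 1 <= nm p.[z]) ->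
  1 / 2 <= nm (lead_coef p) * r ^+ (size p).-1.
Proof.
move=> p1 r0 nz hp; pose N := (size p).-1.
have N0 : (0 < N)%N by rewrite /N -subn1 subn_gt0.
have [z hz] := prim_root_exists N0.
have [s ss ps] := closed_poly_split 0 p1.
rewrite subr0 in ps.
have sr x : x \in s -> nm x <= r.
  move=> xs; rewrite leNgt; apply/negP => /ltW/nz; rewrite ps hornerZ mulf_eq0 negb_or.
  by move=> /andP[_]; rewrite -/(root _ x) root_prod_XsubC xs.
(* The double product over sample points and roots is regrouped root by root: x contributes |x^N -
   r^N|, at most 2 r^N. *)
have prodE x : \prod_(i < N) (r%:C * z ^+ i - x) =
    (-1) ^+ N * (x ^+ N - r%:C ^+ N).
  have rC : r%:C != 0 by rewrite -nm_gt0 nm_real gtr0_norm.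
  have h y : \prod_(i < N) (y - z ^+ i) = y ^+ N - 1.
    have := congr1 (horner^~ y) (factor_Xn_sub_1 hz).
    rewrite /= big_mkord horner_prod => e.
    transitivity (('X^N - 1 : {poly R[i]}).[y]); last by rewrite !hornerE.
    by rewrite -e; apply: eq_bigr => i _; rewrite hornerXsubC.
  transitivity (\prod_(i < N) (- r%:C * (x / r%:C - z ^+ i))).
    by apply: eq_bigr => i _; field.
  rewrite big_split /= prodr_const card_ord h (exprNn r%:C) expr_div_n.
  by field; rewrite expf_neq0.
have big1le : 1 <= \prod_(i < N) nm p.[r%:C * z ^+ i].
  elim/big_ind: _ => // [x y hx hy|i _]; first by rewrite mulr_ege1.
  by apply: hp; rewrite nmM (nm_prim_root _ hz) nm_real gtr0_norm// mulr1.
have step : \prod_(i < N) nm p.[r%:C * z ^+ i] <= (nm (lead_coef p) * (2 * r ^+ N)) ^+ N.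
  have -> : \prod_(i < N) nm p.[r%:C * z ^+ i] =
      nm (lead_coef p) ^+ N * \prod_(x <- s) nm (x ^+ N - r%:C ^+ N).
    have -> : nm (lead_coef p) ^+ N = \prod_(i < N) nm (lead_coef p).
      by rewrite prodr_const card_ord.
    have -> : \prod_(x <- s) nm (x ^+ N - r%:C ^+ N) =
       \prod_(x <- s) \prod_(i < N) nm (r%:C * z ^+ i - x).
      apply: eq_bigr => x _; rewrite -nm_prod prodE nmM nmX nmN nm1 expr1n mul1r//.
    rewrite exchange_big /= -big_split /=; apply: eq_bigr => i _.
    rewrite [in LHS]ps hornerZ nmM horner_prod nm_prod; congr (_ * _).
    by apply: eq_bigr => x _; rewrite !hornerE.
  rewrite exprMn ler_wpM2l ?exprn_ge0 ?nm_ge0//.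
  rewrite -[X in _ <= _ ^+ X]ss.
  have : forall x, x \in s -> nm (x ^+ N - r%:C ^+ N) <= 2 * r ^+ N.
    move=> x /sr xr; apply: (le_trans (nmB _ _)); rewrite !nmX nm_real gtr0_norm//.
    have : nm x ^+ N <= r ^+ N by apply: lerXn2r; rewrite ?nnegrE ?nm_ge0// ltW.
    lra.
  elim: (s) => [|x t IH] ht; first by rewrite big_nil.
  rewrite big_cons /= exprS ler_pM ?nm_ge0//.
  - by apply: prodr_ge0 => y _; exact: nm_ge0.
  - by apply: ht; rewrite mem_head.
  - by apply: IH => y yt; apply: ht; rewrite inE yt orbT.
have h1 := le_trans big1le step.
have q0 : 0 <= nm (lead_coef p) * (2 * r ^+ N).
  by rewrite mulr_ge0 ?nm_ge0// mulr_ge0// exprn_ge0// ltW.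
have : 1 <= nm (lead_coef p) * (2 * r ^+ N).
  rewrite leNgt; apply/negP => q1; move: h1; rewrite leNgt => /negP; apply.
  by rewrite exprn_ilt1// -lt0n.
lra.
Qed.

(** On a circle beyond which |G| > 2, spherical closeness becomes uniform closeness, and
    [coef_cauchy] bounds the coefficients of F - G. A larger degree of F is excluded by
    [lead_coef_lower]: F has no zero outside the circle, since the gap between 0 and a value of
    modulus above 2 exceeds 1. *)
Lemma cpoly_close (g : cpoly R) (eta : R) : 0 < eta -> exists2 e : R, 0 < e &
  forall f : cpoly R, (forall w : rsphere R, spherical_dist (cpoly_map g w) (cpoly_map f w) < e) ->
    size (val f) = size (val g) /\ forall k, nm ((val f)`_k - (val g)`_k) <= eta.
Proof.
move=> eta0; set G := val g.
have G1 : (1 < size G)%N := valP g.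
have [M hM] := poly_to_infty 2 G1.
pose r := Num.max M 1 + 1.
have r1 : 1 <= r.
  have : 1 <= Num.max M 1 by rewrite le_max lexx orbT.
  by rewrite /r; lra.
have rM : M < r.
  have : M <= Num.max M 1 by rewrite le_max lexx.
  by rewrite /r; lra.
have r0 : 0 < r by lra.
have hG z : r <= nm z -> 2 < nm G.[z] by move=> h; apply: hM; lra.
have [L L0 hL] := poly_lipschitz G r.
pose B := nm G.[0] + L * r.
have hB z : nm z = r -> nm G.[z] <= B.
  move=> zr; have := hL z 0; rewrite zr nm0 subr0 zr lexx => /(_ isT (ltW r0)).
  by have := nmB_ge G.[z] G.[0]; rewrite /B; lra.
have lc0 : 0 < nm (lead_coef G).
  by rewrite nm_gt0 lead_coef_eq0 -size_poly_gt0 (ltn_trans _ G1).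
(* The entries are the requested closeness, a bound below the 1/2 of [lead_coef_lower] against a
   larger degree, and half the leading coefficient of G against a smaller one. *)
pose t := Num.min (Num.min eta (1 / 4)) (nm (lead_coef G) / 2).
have [t0 t1 t2 t3] : [/\ 0 < t, t <= eta, t <= 1 / 4 & t <= nm (lead_coef G) / 2].
  by rewrite /t !lt_min !ge_min !lexx eta0 !divr_gt0// !orbT.
have [e0 e00 he0] := gap_small_fin B t0.
have [e1 e10 he1] := dist_small_gap (ltac:(by rewrite lt_min e00 ltr01) : 0 < Num.min e0 1).
exists e1 => // f hf; set F := val f.
have F1 : (1 < size F)%N := valP f.
have hgap z : gap (Some G.[z]) (Some F.[z]) < Num.min e0 1 by apply: he1; exact: (hf (Some z)).
have close z : nm z = r -> nm ((F - G).[z]) <= t.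
  move=> zr; have := hgap z; rewrite lt_min => /andP[hz _].
  have [_ [<-]] := he0 _ _ (hB z zr) hz.
  by rewrite hornerD hornerN nm_distC => /ltW.
have coef k : nm ((F - G)`_k) * r ^+ k <= t by apply: coef_cauchy close; exact: ltW.
have rk k : 1 <= r ^+ k by rewrite exprn_ege1.
have coef1 k : nm (F`_k - G`_k) <= t.
  apply: le_trans (coef k); rewrite coefB ler_peMr ?nm_ge0//.
split; last by move=> k; exact: le_trans (coef1 k) t1.
apply/eqP; rewrite eqn_leq; apply/andP; split; rewrite leqNgt; apply/negP => hs.
- have Fnz z : r <= nm z -> F.[z] != 0.
    move=> zr; apply/negP => /eqP Fz; have := hgap z; rewrite Fz lt_min => /andP[_].
    rewrite gap_fin subr0 nm0 expr0n /= addr0 mulr1.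
    have g2 := hG z zr; rewrite ltr_pdivrMr ?ltr_pwDl ?sqr_ge0//.
    by set x := nm _ in g2 *; nra.
  have F1le z : nm z = r -> 1 <= nm F.[z].
    move=> zr; have := close z zr; rewrite hornerD hornerN nm_distC.
    have := nmB_ge G.[z] F.[z]; have zr2 : r <= nm z by rewrite zr.
    have := hG z zr2; lra.
  have := lead_coef_lower F1 r0 Fnz F1le.
  have := coef (size F).-1; rewrite coefB [G`__]nth_default ?subr0; last first.
    by rewrite -ltnS prednK// (ltn_trans _ F1).
  rewrite -/(lead_coef F) => h1 h2; have := le_trans h2 h1; lra.
- have := coef1 (size G).-1; rewrite [F`__]nth_default; last first.
    by rewrite -ltnS prednK// (ltn_trans _ G1).
  by rewrite sub0r nmN -/(lead_coef G); lra.
Qed.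

End CauchyEstimates.

Section NeighbourhoodTopology.
Variable R : realType.

Lemma cpoly_nbhs (g : cpoly R) (e : R) : 0 < e ->
  nbhs g [set f : cpoly R | forall z, spherical_dist (cpoly_map g z) (cpoly_map f z) < e].
Proof.
move=> e0.
have h : nbhs (cpoly_map g : {uniform rsphere R -> rsphere R})
    [set f | forall z, spherical_dist (cpoly_map g z) (f z) < e].
  apply/uniform_nbhs; exists [set xy | ball xy.1 e xy.2].
  split; first by rewrite -entourage_ballE; exists e.
  by move=> f hf z; have := hf z I; rewrite /= ball_sphereE.
exact: (@initial_continuous _ _ (@cpoly_map R : cpoly R -> {uniform rsphere R -> rsphere R}) g _ h).
Qed.

Lemma ptws_nbhs (I : finType) (g : {ptws I -> cpoly R}) (U : I -> set (cpoly R)) :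
  (forall i, nbhs (g i) (U i)) -> nbhs g [set f : {ptws I -> cpoly R} | forall i, U i (f i)].
Proof.
move=> hU; apply: (@filter_forall _ I (fun i (f : {ptws I -> cpoly R}) => U i (f i)) (nbhs g)).
by move=> i; exact: (@proj_continuous I (fun=> cpoly R) i g _ (hU i)).
Qed.

End NeighbourhoodTopology.

(** * Perturbations of a (z - c)^d + c *)

Section PolynomialBounds.
Variable R : realType.
Implicit Types (E : {poly R[i]}) (z w : R[i]).

Lemma ler_sum_const (k : nat) (f : 'I_k -> R) (b : R) :
  (forall i, f i <= b) -> \sum_(i < k) f i <= k%:R * b.
Proof.
move=> fb; apply: (@le_trans _ _ (\sum_(i < k) b)); first exact: ler_sum.
by rewrite sumr_const card_ord mulr_natl.
Qed.

Lemma nm_exp_lipschitz (T : R) z w i : nm z <= T -> nm w <= T ->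
  nm (z ^+ i - w ^+ i) <= i%:R * T ^+ i.-1 * nm (z - w).
Proof.
move=> zT wT; have T0 : 0 <= T by exact: le_trans (nm_ge0 z) zT.
case: i => [|i]; first by rewrite !expr0 subrr nm0 !mul0r.
rewrite subrXX nmM mulrC ler_wpM2r ?nm_ge0// (le_trans (nm_sum _ _ _))//.
apply: ler_sum_const => k.
rewrite nmM !nmX /=.
have -> : T ^+ i = T ^+ (i - k) * T ^+ k by rewrite -exprD subnK// -ltnS.
by rewrite ler_pM ?exprn_ge0 ?nm_ge0// lerXn2r ?nnegrE ?nm_ge0.
Qed.

Lemma poly_bound E (N : nat) (eta m : R) z : (size E <= N.+1)%N ->
  (forall k, nm E`_k <= eta) -> 1 <= m -> nm z <= m ->
  nm E.[z] <= eta * N.+1%:R * m ^+ N.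
Proof.
move=> sE hE m1 zm; rewrite (horner_coef_wide _ sE) (le_trans (nm_sum _ _ _))//.
have eta0 : 0 <= eta by apply: le_trans (nm_ge0 _) (hE 0%N).
rewrite mulrAC mulrC; apply: ler_sum_const => k.
rewrite nmM nmX ler_pM ?exprn_ge0 ?nm_ge0//.
rewrite (@le_trans _ _ (m ^+ k))//; first by rewrite lerXn2r ?nnegrE ?nm_ge0 ?(le_trans ler01).
by rewrite ler_weXn2l// -ltnS.
Qed.

Lemma poly_lipschitz_bound E (N : nat) (eta T : R) z w : (size E <= N.+1)%N ->
  (forall k, nm E`_k <= eta) -> 1 <= T -> nm z <= T -> nm w <= T ->
  nm (E.[z] - E.[w]) <= eta * N.+1%:R ^+ 2 * T ^+ N * nm (z - w).
Proof.
move=> sE hE T1 zT wT; rewrite !(horner_coef_wide _ sE) -sumrB.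
have eta0 : 0 <= eta by apply: le_trans (nm_ge0 _) (hE 0%N).
have T0 : 0 <= T by lra.
apply: (le_trans (nm_sum _ _ _)).
have -> : eta * N.+1%:R ^+ 2 * T ^+ N * nm (z - w) =
  N.+1%:R * (eta * (N.+1%:R * T ^+ N * nm (z - w))) by ring.
apply: ler_sum_const => k.
rewrite -mulrBr nmM ler_pM ?nm_ge0// (le_trans (nm_exp_lipschitz _ zT wT))//.
rewrite ler_wpM2r ?nm_ge0// ler_pM ?exprn_ge0// ?ler_nat; first exact: ltnW.
by rewrite ler_weXn2l// (leq_trans (leq_pred _))// -ltnS.
Qed.

Lemma deriv_bound E (N : nat) (eta m : R) z : (0 < N)%N -> (size E <= N.+1)%N ->
  (forall k, nm E`_k <= eta) -> 1 <= m -> nm z <= m ->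
  nm E^`().[z] <= eta * N.+1%:R * N%:R * m ^+ N.-1.
Proof.
move=> N0 sE hE m1 zm; have eta0 : 0 <= eta by apply: le_trans (nm_ge0 _) (hE 0%N).
have := @poly_bound E^`() N.-1 (eta * N.+1%:R) m z; rewrite prednK//; apply => //.
  by rewrite (leq_trans (size_poly _ _))// -ltnS; case: (size E) sE => // k; rewrite ltnS.
move=> k; rewrite coef_deriv.
have [kN|kN] := ltnP k.+1 N.+1.
  rewrite normcMn -[leLHS]mulr_natr ler_pM ?nm_ge0// ler_nat; exact: ltnW.
by rewrite nth_default ?mul0rn ?nm0 ?mulr_ge0// (leq_trans sE).
Qed.

End PolynomialBounds.

Section Iterates.
Variable R : realType.

Lemma iter_square (g : cpoly R) (r c : R[i]) l : r != 0 ->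
  val g = r^-1 *: ('X - c%:P) ^+ 2 + c%:P ->
  val (cpoly_iter l g) = c%:P + (r / r ^+ (2 ^ l)) *: ('X - c%:P) ^+ (2 ^ l).
Proof.
move=> r0 gE; elim: l => [|l IH].
  by rewrite /= expn0 !expr1 divff// scale1r addrC subrK.
rewrite [val _]/= IH gE comp_polyD comp_polyC comp_polyZ rmorphXn /= comp_polyB.
rewrite comp_polyX comp_polyC addrAC subrr add0r exprZn scalerA -exprM -expnSr [RHS]addrC.
congr (_ *: _ + _); rewrite expr_div_n -!exprM expnSr; field.
by rewrite r0 expf_neq0.
Qed.

End Iterates.

(** * Estimates for one perturbed generator *)

Section GoodMap.
Variables (R : realType) (n j d : nat) (eps tau u q Q eta : R) (c : R[i]).
Variables (F E : {poly R[i]}).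
Local Notation r := (j.+1%:R : R).
Local Notation Rb := (n%:R + 1 : R).
Local Notation a := (r / r ^+ d).
Hypothesis jn : (j < n)%N.
Hypothesis eps0 : 0 < eps.
Hypothesis eps1 : eps < 1 / 2.
Hypothesis tauE : tau = (1 / 2 - eps) / 2.
Hypothesis qE : q = 1 / 2 + eps.
Hypothesis QE : Q = 1 + 1 / (2 * n%:R).
Hypothesis u0 : 0 < u.
Hypothesis u1 : u < 1.
Hypothesis d2 : (1 < d)%N.
Hypothesis nc : nm c <= eps.
Hypothesis eta0 : 0 <= eta.
Hypothesis FE : F = c%:P + a%:C *: ('X - c%:P) ^+ d + E.
Hypothesis sE : (size E <= d.+1)%N.
Hypothesis cE : forall k, nm E`_k <= eta.
Hypothesis c1 : n%:R * q ^+ d <= tau / 2.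
Hypothesis c2 : d%:R * q ^+ d.-1 <= 1 / 4.
Hypothesis c3 : 12 <= Q ^+ d.-1.
Hypothesis c4 : Rb + 1 < (1 + u) ^+ d.
Hypothesis c5 : (1 - u) ^+ d < tau / n%:R.
Hypothesis e1 : eta * (d.+1%:R ^+ 2 * Rb ^+ d) <= tau / 2.
Hypothesis e2 : eta * d.+1%:R <= a * (1 / 2) ^+ d / 2.
Hypothesis e3 : eta * d.+1%:R < a * (1 / 2 - eps) ^+ d.-1.

Let r1 : 1 <= r. Proof. by rewrite ler1n. Qed.
Let rn : r <= n%:R. Proof. by rewrite ler_nat. Qed.
Let a0 : 0 < a. Proof. by rewrite divr_gt0 ?exprn_gt0// ltr0n. Qed.
Let d0 : (0 < d)%N. Proof. exact: ltnW. Qed.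

Lemma good_eval z : F.[z] = c + a%:C * (z - c) ^+ d + E.[z].
Proof. by rewrite FE !hornerD hornerC hornerZ horner_exp hornerXsubC. Qed.

Let tau0 : 0 < tau. Proof. by rewrite tauE; move: eps1; lra. Qed.
Let tau1 : tau <= 1 / 4. Proof. by rewrite tauE; move: eps0; lra. Qed.
Let Rb1 : 1 <= Rb. Proof. by rewrite lerDr ler0n. Qed.

Let eW : eta * d.+1%:R ^+ 2 <= tau / 2.
Proof.
apply: le_trans e1; rewrite mulrA ler_peMr ?exprn_ege1//.
by rewrite mulr_ge0// exprn_ge0.
Qed.

Let eW1 : eta * d.+1%:R <= tau / 2.
Proof.
by apply: le_trans eW; rewrite ler_wpM2l// expr2 ler_peMr// ler1n.
Qed.

(** In units of r the unperturbed map is the pure power x^d: the circle of radius r about c is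
    invariant, and large d sharpens the contrast between its two sides. *)
Let aX x : a * x ^+ d = r * (x / r) ^+ d.
Proof. by rewrite expr_div_n; ring. Qed.

Let nmaX z : nm (a%:C * (z - c) ^+ d) = r * (nm (z - c) / r) ^+ d.
Proof. by rewrite nmM nm_real gtr0_norm ?a0// nmX aX. Qed.

Let sub_small z : nm z <= 1 / 2 -> nm (z - c) <= q.
Proof. by move=> h; apply: (le_trans (nmB _ _)); rewrite qE; have := nc; lra. Qed.

Let q0 : 0 <= q. Proof. by rewrite qE; have := eps0; lra. Qed.

Lemma good_inner z : nm z <= 1 / 2 -> nm F.[z] <= eps + tau.
Proof.
move=> z1; rewrite good_eval (le_trans (nmD _ _))//.
have h1 : nm E.[z] <= tau / 2.
  have := @poly_bound R E d eta 1 z sE cE (lexx _); rewrite expr1n mulr1.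
  by move=> h; apply: le_trans (h _) eW1; lra.
have h2 : nm (a%:C * (z - c) ^+ d) <= tau / 2.
  rewrite nmaX (le_trans _ c1)// ler_pM ?exprn_ge0 ?divr_ge0 ?nm_ge0//.
  apply: lerXn2r; rewrite ?nnegrE ?divr_ge0 ?nm_ge0//.
  by rewrite ler_pdivrMr ?ltr0n// (le_trans (sub_small z1))// ler_peMr.
have := nmD c (a%:C * (z - c) ^+ d); have := nc; lra.
Qed.

Lemma good_contract z w : nm z <= 1 / 2 -> nm w <= 1 / 2 ->
  nm (F.[z] - F.[w]) <= 1 / 2 * nm (z - w).
Proof.
move=> z1 w1; rewrite !good_eval.
have -> : c + a%:C * (z - c) ^+ d + E.[z] - (c + a%:C * (w - c) ^+ d + E.[w]) =
  a%:C * ((z - c) ^+ d - (w - c) ^+ d) + (E.[z] - E.[w]) by ring.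
apply: (le_trans (nmD _ _)).
have h1 : nm (E.[z] - E.[w]) <= 1 / 4 * nm (z - w).
  have := @poly_lipschitz_bound R E d eta 1 z w sE cE (lexx _); rewrite expr1n mulr1.
  move=> h; apply: (le_trans (h _ _)); try lra.
  by rewrite ler_wpM2r ?nm_ge0// (le_trans eW)//; have := tau1; lra.
have h2 : nm (a%:C * ((z - c) ^+ d - (w - c) ^+ d)) <= 1 / 4 * nm (z - w).
  rewrite nmM nm_real (gtr0_norm a0).
  have hl := nm_exp_lipschitz d (sub_small z1) (sub_small w1).
  rewrite (_ : z - c - (w - c) = z - w) in hl; last by ring.
  have a1 : a <= 1.
    rewrite ler_pdivrMr ?exprn_gt0 ?ltr0n// mul1r -{1}[r]expr1.
    by rewrite ler_weXn2l.
  rewrite (@le_trans _ _ (1 * (d%:R * q ^+ d.-1 * nm (z - w))))//.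
    by rewrite ler_pM ?nm_ge0// ltW.
  by rewrite mul1r ler_wpM2r ?nm_ge0.
lra.
Qed.

(** Beyond radius n + 1 the relative radius |z - c| / r is at least (n + 1/2) / n = Q, so [c3] makes
    the main term at least 6 |z|. Half of it pays for [E], and c costs less than |z|. *)
Lemma good_outer z : Rb <= nm z -> 2 * nm z <= nm F.[z].
Proof.
move=> zR; have n1 : 1 <= n%:R :> R by exact: le_trans r1 rn.
have zc : nm z - eps <= nm (z - c) by have := nmB_ge z c; have := nc; lra.
have half : nm z / 2 <= nm (z - c) by have := eps1; lra.
set x := nm (z - c) / r; have x0 : 0 <= x by rewrite divr_ge0 ?nm_ge0.
have Qx : Q <= x.
  rewrite QE /x ler_pdivlMr ?ltr0n//.
  apply: (@le_trans _ _ ((1 + 1 / (2 * n%:R)) * n%:R)).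
    by rewrite ler_wpM2l// addr_ge0// divr_ge0// mulr_ge0.
  have -> : (1 + 1 / (2 * n%:R)) * n%:R = n%:R + 1 / 2 :> R by field; rewrite gt_eqF; lra.
  have := eps1; lra.
have Q0 : 0 <= Q by rewrite QE addr_ge0// divr_ge0// mulr_ge0.
have big : 6 * nm z <= r * x ^+ d.
  have -> : r * x ^+ d = nm (z - c) * x ^+ d.-1.
    rewrite -[in LHS](prednK d0) exprS mulrA; congr (_ * _).
    by rewrite /x mulrC divfK// gt_eqF// ltr0n.
  have : Q ^+ d.-1 <= x ^+ d.-1 by rewrite lerXn2r ?nnegrE.
  move=> h; have h12 := le_trans c3 h.
  rewrite (@le_trans _ _ (nm z / 2 * 12))//; first by lra.
  by rewrite ler_pM// divr_ge0 ?nm_ge0.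
have hE : nm E.[z] <= r * x ^+ d / 2.
  have z1 : 1 <= nm z by exact: le_trans Rb1 zR.
  (* [e2] is scaled by (1/2)^d because |z| / 2 <= |z - c| is the comparison available between the
     powers of z and of z - c. *)
  apply: (le_trans (poly_bound sE cE z1 (lexx _))).
  apply: (@le_trans _ _ (a * (1 / 2) ^+ d / 2 * nm z ^+ d)).
    by rewrite ler_wpM2r// exprn_ge0// nm_ge0.
  rewrite -(nmaX z) nmM nm_real gtr0_norm ?a0// nmX.
  rewrite mulrAC ler_pM2r// -!mulrA ler_pM2l ?a0// -exprMn.
  rewrite ler_pM2l ?invr_gt0 ?exprn_gt0 ?ltr0n//.
  by apply: lerXn2r; rewrite ?nnegrE ?mulr_ge0 ?nm_ge0//; lra.
rewrite good_eval.
have := nmB_ge (a%:C * (z - c) ^+ d) (- (c + E.[z])).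
rewrite opprK nmN nmaX -/x.
have -> : a%:C * (z - c) ^+ d + (c + E.[z]) = c + a%:C * (z - c) ^+ d + E.[z] by ring.
have := nmD c E.[z]; have := nc; have := eps1; lra.
Qed.

(** If |z| > 1/2, then |z - c| >= (1/2 - eps) m with m = max(1, |z|), so the derivative of the main
    term is at least a d ((1/2 - eps) m)^(d-1). That of [E] is at most eta (d + 1) d m^(d-1), which
    [e3] makes smaller; the use of m treats bounded and large z at once. *)
Lemma good_crit z : root F^`() z -> nm z <= 1 / 2.
Proof.
rewrite leNgt => /eqP; rewrite FE !derivD derivC add0r derivZ deriv_exp derivXsubC (mul1r (_ ^+ _)).
rewrite hornerD hornerZ hornerMn horner_exp hornerXsubC => hz; apply/negP => z1.
pose m := Num.max 1 (nm z).
have m1 : 1 <= m by rewrite le_max lexx.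
have zm : nm z <= m by rewrite le_max lexx orbT.
have k0 : 0 < 1 / 2 - eps by have := eps1; lra.
have km : (1 / 2 - eps) * m <= nm (z - c).
  have := nmB_ge z c; have := nc; have := eps0; have := eps1.
  rewrite /m; have [h|h] := leP (nm z) 1; first by rewrite mulr1; lra.
  move=> h1 h2 h3 h4; have h5 : 0 <= eps * (nm z - 1) by rewrite mulr_ge0 ?subr_ge0 ?ltW.
  by clear hz; lra.
have hE := deriv_bound d0 sE cE m1 zm.
have : nm (a%:C * ((z - c) ^+ d.-1 *+ d)) = nm E^`().[z].
  by rewrite -nmN; congr nm; apply/eqP; rewrite eq_sym -addr_eq0 addrC hz.
rewrite nmM nm_real gtr0_norm ?a0// normcMn nmX mulrnAr => h.
have hd : 0 < d%:R :> R by rewrite ltr0n.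
have md : 0 < m ^+ d.-1 by rewrite exprn_gt0//; lra.
have t1 : ((1 / 2 - eps) * m) ^+ d.-1 <= nm (z - c) ^+ d.-1.
  by apply: lerXn2r; rewrite ?nnegrE ?nm_ge0// mulr_ge0 ?(ltW k0)//; lra.
have t2 : a * ((1 / 2 - eps) ^+ d.-1 * m ^+ d.-1) * d%:R <= nm E^`().[z].
  by rewrite -h [leLHS]mulr_natr lerMn2r ler_pM2l ?a0// -exprMn t1 orbT.
have := le_trans t2 hE.
have -> : a * ((1 / 2 - eps) ^+ d.-1 * m ^+ d.-1) * d%:R =
  a * (1 / 2 - eps) ^+ d.-1 * (d%:R * m ^+ d.-1) by ring.
have -> : eta * d.+1%:R * d%:R * m ^+ d.-1 = eta * d.+1%:R * (d%:R * m ^+ d.-1) by ring.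
rewrite ler_pM2r ?mulr_gt0//.
by rewrite leNgt e3.
Qed.

Lemma good_in z : annulus Rb F.[z] -> annulus Rb z.
Proof.
move=> /andP[h1 h2]; apply/andP; split; rewrite leNgt; apply/negP => h.
  by have := good_inner (ltW h); rewrite tauE in h1 *; have := eps1; lra.
by have := good_outer (ltW h); have := Rb1; lra.
Qed.

Lemma good_simple z : annulus Rb F.[z] -> ~~ root F^`() z.
Proof.
move=> /andP[h1 _]; apply/negP => /good_crit/good_inner.
by have := eps1; rewrite tauE; lra.
Qed.

Lemma good_error z : annulus Rb z -> nm E.[z] <= tau.
Proof.
move=> /andP[_ h]; apply: (le_trans (poly_bound sE cE Rb1 h)).
have : eta * d.+1%:R * Rb ^+ d <= eta * (d.+1%:R ^+ 2 * Rb ^+ d).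
  rewrite -mulrA ler_wpM2l// ler_wpM2r ?exprn_ge0 ?(le_trans ler01 Rb1)//.
  by rewrite expr2 ler_peMr// ler1n.
by have := tau0; have := e1; lra.
Qed.

Lemma good_error_lipschitz z w : annulus Rb z -> annulus Rb w ->
  nm (E.[z] - E.[w]) <= tau * nm (z - w).
Proof.
move=> /andP[_ h] /andP[_ h']; apply: (le_trans (poly_lipschitz_bound sE cE Rb1 h h')).
by rewrite ler_wpM2r ?nm_ge0// -mulrA; have := tau0; have := e1; lra.
Qed.

(** With x = nm (z - c) / r the main term r x^d lies between tau and n + 2, independently of d, so
    [c4] and [c5] pin x to within u of 1. The lower bound is what is left of 1/2 after removing eps
    and tau. *)
Lemma good_near_circle z : annulus Rb F.[z] -> `|nm (z - c) - r| <= u * n%:R.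
Proof.
move=> hF; have hz := good_in hF; have hE := good_error hz.
have n0 : 0 < n%:R :> R by rewrite ltr0n (leq_ltn_trans _ jn).
have r0 : 0 < r by rewrite ltr0n.
set x := nm (z - c) / r; have x0 : 0 <= x by rewrite divr_ge0 ?nm_ge0.
have xE : r * x ^+ d = nm (F.[z] - (c + E.[z])).
  by rewrite good_eval -nmaX; congr nm; ring.
have /andP[f1 f2] := hF.
have hc := nmD c E.[z].
have lo : tau <= r * x ^+ d.
  by rewrite xE; have := nmB_ge F.[z] (c + E.[z]); have := nc; have := tauE; lra.
have hi : r * x ^+ d <= Rb + 1.
  rewrite xE; apply: (le_trans (nmB _ _)).
  by have := nc; have := eps1; have := tau1; lra.
have ne : nm (z - c) - r = r * (x - 1).
  by rewrite /x; field; rewrite gt_eqF.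
rewrite ne normrM gtr0_norm// mulrC ler_pM//.
rewrite ler_norml; apply/andP; split; rewrite leNgt; apply/negP => hx.
  have xu : x <= 1 - u by lra.
  have : x ^+ d <= (1 - u) ^+ d by rewrite lerXn2r ?nnegrE//; have := u1; lra.
  move=> h; have := le_lt_trans h c5; rewrite ltr_pdivlMr//.
  have : r * x ^+ d <= n%:R * x ^+ d by rewrite ler_wpM2r ?exprn_ge0.
  by rewrite mulrC; lra.
have xu : 1 + u <= x by lra.
have h : (1 + u) ^+ d <= x ^+ d by rewrite lerXn2r ?nnegrE//; have := u0; lra.
have h2 := lt_le_trans c4 h.
have : x ^+ d <= r * x ^+ d by rewrite ler_peMl// exprn_ge0.
lra.
Qed.

End GoodMap.

(** * Inequalities valid for all large degrees *)

Section LargeDegree.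
Variable R : realType.

Lemma bernoulli (x : R) d : 0 <= x -> 1 + d%:R * x <= (1 + x) ^+ d.
Proof.
move=> x0; elim: d => [|d IH]; first by rewrite mul0r addr0 expr0.
rewrite exprS -natr1 mulrDl mul1r.
have h : (1 + x) * (1 + d%:R * x) <= (1 + x) * (1 + x) ^+ d by rewrite ler_wpM2l// addr_ge0.
have : 0 <= d%:R * x * x by rewrite !mulr_ge0.
lra.
Qed.

Lemma near_exp_small (q e : R) : 0 <= q -> q < 1 -> 0 < e ->
  \forall d \near \oo, q ^+ d < e.
Proof.
move=> q0 q1 e0.
have /cvgrPdist_lt/(_ _ e0) h : q ^+ d @[d --> \oo] --> (0 : R).
  by apply: cvg_expr; rewrite ger0_norm.
by apply: filterS h => d; rewrite sub0r normrN ger0_norm// exprn_ge0.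
Qed.

Lemma near_exp_large (x B : R) : 0 < x -> \forall d \near \oo, B < (1 + x) ^+ d.
Proof.
move=> x0; exists (Num.truncn (B / x)).+1 => // d /= hd.
apply: lt_le_trans (bernoulli d (ltW x0)).
rewrite (@lt_trans _ _ (d%:R * x)) ?ltrDr// -ltr_pdivrMr//.
by rewrite (lt_le_trans (truncnS_gt _))// ler_nat.
Qed.

Lemma near_nat_exp_small (q e : R) : 0 < q -> q < 1 -> 0 < e ->
  \forall d \near \oo, d%:R * q ^+ d < e.
Proof.
(* This x keeps (1 + x) q below 1, and by Bernoulli (1 + x)^d outgrows d x. *)
move=> q0 q1 e0; pose x := (1 - q) / 2.
have x0 : 0 < x by rewrite divr_gt0 ?subr_gt0.
have xq0 : 0 <= (1 + x) * q by rewrite mulr_ge0 ?addr_ge0// ltW.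
have xq1 : (1 + x) * q < 1 by rewrite /x; nra.
have := near_exp_small xq0 xq1 (mulr_gt0 e0 x0); apply: filterS => d hd.
rewrite -(ltr_pM2r x0) (le_lt_trans _ hd)// exprMn mulrAC ler_wpM2r ?exprn_ge0 ?(ltW q0)//.
by apply: le_trans (bernoulli d (ltW x0)); rewrite lerDr.
Qed.

Lemma near_pow2 (P : nat -> Prop) :
  (\forall d \near \oo, P d) -> \forall l \near \oo, P (2 ^ l)%N.
Proof.
move=> [N _ hN]; exists N => // l /= Nl; apply: hN => /=.
by rewrite (leq_trans Nl)// ltnW// ltn_expl.
Qed.

Lemma near_large_degree (n : nat) (q Q u tau D : R) : (0 < n)%N ->
  0 < q -> q < 1 -> 1 < Q -> 0 < u -> u < 1 -> 0 < tau ->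
  \forall d \near \oo, [/\ (1 < d)%N, D <= d%:R, n%:R * q ^+ d <= tau / 2,
    d%:R * q ^+ d.-1 <= 1 / 4 &
    [/\ 12 <= Q ^+ d.-1, n%:R + 1 + 1 < (1 + u) ^+ d & (1 - u) ^+ d < tau / n%:R]].
Proof.
move=> n0 q0 q1 Q1 u0 u1 tau0.
have nR : 0 < n%:R :> R by rewrite ltr0n.
have h1 : \forall d \near \oo, (1 < d)%N by exists 2%N.
have h2 : \forall d \near \oo, D < d%:R.
  exists (Num.truncn D).+1 => // d /= hd.
  by rewrite (lt_le_trans (truncnS_gt _))// ler_nat.
have h3 := near_exp_small (ltW q0) q1 (divr_gt0 (divr_gt0 tau0 (ltr0n _ 2)) nR).
(* The extra factor q here, and Q in [h5], pays for the exponent d - 1 in the conclusion. *)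
have h4 := near_nat_exp_small q0 q1 (divr_gt0 q0 (ltr0n _ 4)).
have h5 : \forall d \near \oo, 12 * Q < (1 + (Q - 1)) ^+ d.
  by apply: near_exp_large; rewrite subr_gt0.
have h6 := near_exp_large (n%:R + 1 + 1) u0.
have h7 : \forall d \near \oo, (1 - u) ^+ d < tau / n%:R.
  by apply: near_exp_small; rewrite ?subr_ge0 ?(ltW u1)// ?divr_gt0// ltrBlDr ltrDl.
near=> d; have d1 : (1 < d)%N by near: d.
have dE : d.-1.+1 = d by rewrite prednK// ltnW.
split => //.
- by apply/ltW; near: d.
- have : q ^+ d < tau / 2 / n%:R by near: d.
  by rewrite ltr_pdivlMr// mulrC => /ltW.
- have : d%:R * q ^+ d < q / 4 by near: d.
  rewrite -{2}dE exprS mulrCA -[q / 4]mulr1 -mulrA ltr_pM2l// mulr1 => /ltW.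
  by rewrite mul1r.
- split; [|by near: d|by near: d].
  have : 12 * Q < (1 + (Q - 1)) ^+ d by near: d.
  rewrite addrC subrK -{1}dE exprS mulrC ltr_pM2l; last by rewrite (lt_trans ltr01).
  exact: ltW.
Unshelve. all: by end_near.
Qed.

End LargeDegree.

(** * The unperturbed generators and the choice of the constants *)

Section BaseTuple.
Variables (R : realType) (n : nat) (eps : R).

Definition center (b : bool) : R[i] := if b then eps%:C else 0.

Definition gen_index (j : 'I_n) (b : bool) : 'I_(n + n) :=
  if b then rshift n j else lshift n j.

Lemma base_tupleE l j b : val (base_tuple eps l (gen_index j b)) =
  (center b)%:P + ((j.+1%:R / j.+1%:R ^+ (2 ^ l)) : R)%:C *: ('X - (center b)%:P) ^+ (2 ^ l).
Proof.
have r0 : j.+1%:R != 0 :> R[i] by rewrite pnatr_eq0.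
have -> : ((j.+1%:R / j.+1%:R ^+ (2 ^ l)) : R)%:C = j.+1%:R / j.+1%:R ^+ (2 ^ l) :> R[i].
  by rewrite fmorph_div rmorphXn rmorph_nat.
rewrite /base_tuple /gen_index; case: b.
  by rewrite -[rshift n j]/(unsplit (inr j)) unsplitK; apply: iter_square.
rewrite -[lshift n j]/(unsplit (inl j)) unsplitK; apply: iter_square => //.
by rewrite /= polyC0 subr0 addr0.
Qed.

Lemma gen_index_onto i : exists j b, gen_index j b = i.
Proof.
rewrite -(splitK i); case: (fintype.split i) => j; [exists j, false|exists j, true] => //.
Qed.

End BaseTuple.

Lemma near_base_tuple (R : realType) (n : nat) (eps : R) : (0 < n)%N ->
  0 < eps -> eps < 1 / 2 -> \forall l \near \oo,
  exists2 eta : R, 0 < eta & forall h : 'I_(n + n) -> cpoly R,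
    (forall i, size (val (h i)) = size (val (base_tuple eps l i)) /\
       forall k, nm ((val (h i))`_k - (val (base_tuple eps l i))`_k) <= eta) ->
    postcritically_bounded (semigroup_gen (range h)) /\
    (julia_components (semigroup_gen (range h)) #= `I_n)%card.
Proof.
(* tau is half the room between eps and 1/2: eps + tau bounds the image of the inner disk as well as
   |c| plus the error, and stays below 1/2. *)
move=> n0 eps0 eps1; pose tau := (1 / 2 - eps) / 2; pose sg := eps + tau.
pose q := 1 / 2 + eps; pose Q : R := 1 + 1 / (2 * n%:R).
(* The first entry is for [circles_side], the second gives 2 d1 + 2 eps < 1 and separates the
   pieces; u is d1 relative to the largest radius n. *)
pose d1 := Num.min (eps / 16) ((1 / 2 - eps) / 2); pose u := d1 / n%:R.
pose Rb : R := n%:R + 1.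
have nR : 1 <= n%:R :> R by rewrite ler1n.
have Rb1 : 1 / 2 < Rb by rewrite /Rb; lra.
have tau0 : 0 < tau by rewrite /tau; lra.
have sg0 : 0 <= sg by rewrite /sg; lra.
have sg1 : sg < 1 / 2 by rewrite /sg /tau; lra.
have [C1 C10 hC1] := shift_log_lipschitz sg0 sg1.
have [C2 C20 hC2] := shift_expanding sg0 sg1.
pose L : R := pi *+ 2 + (ln Rb - ln (1 / 2)).
have L0 : 0 < L.
  by apply: ltr_pwDl; [rewrite mulrn_wgt0// pi_gt0|rewrite subr_ge0 ler_ln ?posrE ?ltW// (lt_trans _ Rb1)].
pose lam := Num.min (1 / 12) (1 / 2 / L).
have lam0 : 0 < lam by rewrite lt_min !divr_gt0.
have lam1 : lam <= 1 / 12 by rewrite ge_min lexx.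
have lam2 : lam * L <= 1 / 2 by rewrite -ler_pdivlMr// ge_min lexx orbT.
pose D := C2 * (1 + C1) / lam + C2 * (C1 * (4 * Rb)).
have d1p : 0 < d1 by rewrite lt_min !divr_gt0// subr_gt0.
have d1a : d1 <= eps / 16 by rewrite ge_min lexx.
have d1b : d1 <= (1 / 2 - eps) / 2 by rewrite ge_min lexx orbT.
have u0 : 0 < u by rewrite divr_gt0//; lra.
have u1 : u < 1 by rewrite ltr_pdivrMr; lra.
have q0 : 0 < q by rewrite /q; lra.
have q1 : q < 1 by rewrite /q; lra.
have Q1 : 1 < Q by rewrite ltrDl divr_gt0// mulr_gt0//; lra.
have := near_pow2 (near_large_degree D n0 q0 q1 Q1 u0 u1 tau0).
apply: filterS => l; set d := (2 ^ l)%N => -[dd dD c1 c2 [c3 c4 c5]].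
pose W : R := d.+1%:R ^+ 2 * Rb ^+ d.
have Rb0 : 0 < Rb by rewrite /Rb; lra.
have W0 : 0 < W by rewrite mulr_gt0 ?exprn_gt0.
pose k := (1 / 2 - eps); have k0 : 0 < k by rewrite subr_gt0.
(* A lower bound for all the leading coefficients, so that one [eta] serves every generator. *)
pose am : R := (n%:R ^+ d)^-1; have am0 : 0 < am by rewrite invr_gt0 exprn_gt0//; lra.
pose e2 := am * (1 / 2) ^+ d / 2 / d.+1%:R; pose e3 := am * k ^+ d.-1 / 2 / d.+1%:R.
pose eta := Num.min (tau / 2 / W) (Num.min e2 e3).
have e20 : 0 < e2 by rewrite !divr_gt0// mulr_gt0// exprn_gt0// divr_gt0.
have e30 : 0 < e3 by rewrite !divr_gt0// mulr_gt0// exprn_gt0.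
have eta0 : 0 < eta by rewrite !lt_min e20 e30 !divr_gt0.
exists eta => // h hh.
have etaW : eta * W <= tau / 2 by rewrite -ler_pdivlMr// ge_min lexx.
have eta2 : eta * d.+1%:R <= am * (1 / 2) ^+ d / 2.
  by rewrite -ler_pdivlMr// !ge_min lexx orbT.
have eta3 : eta * d.+1%:R <= am * k ^+ d.-1 / 2.
  by rewrite -ler_pdivlMr// !ge_min lexx !orbT.
have ale (j : 'I_n) : am <= j.+1%:R / j.+1%:R ^+ d.
  rewrite (@le_trans _ _ (j.+1%:R ^+ d)^-1)//.
    rewrite lef_pV2 ?posrE ?exprn_gt0 ?ltr0n//.
    by apply: lerXn2r; rewrite ?nnegrE// ler_nat.
  by rewrite ler_peMl ?invr_ge0 ?exprn_ge0// ler1n.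
have eta2' (j : 'I_n) : eta * d.+1%:R <= j.+1%:R / j.+1%:R ^+ d * (1 / 2) ^+ d / 2.
  by apply: (le_trans eta2); rewrite ler_pM2r// ler_pM2r ?exprn_gt0 ?divr_gt0.
have eta3' (j : 'I_n) : eta * d.+1%:R < j.+1%:R / j.+1%:R ^+ d * (1 / 2 - eps) ^+ d.-1.
  apply: (le_lt_trans eta3); have h1 : 0 < am * k ^+ d.-1 by rewrite mulr_gt0// exprn_gt0.
  apply: (@lt_le_trans _ _ (am * k ^+ d.-1)); first lra.
  by rewrite ler_pM2r ?exprn_gt0.
pose H j b := h (gen_index j b).
pose E j b := val (H j b) - val (base_tuple eps l (gen_index j b)).
have nc b : nm (center eps b) <= eps.
  by rewrite /center; case: b; rewrite ?nm0 ?nm_real ?ger0_norm// ltW.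
have FE j b : val (H j b) = (center eps b)%:P +
    ((j.+1%:R / j.+1%:R ^+ d) : R)%:C *: ('X - (center eps b)%:P) ^+ d + E j b.
  by rewrite -base_tupleE /E addrC subrK.
have a0 (j : 'I_n) : ((j.+1%:R / j.+1%:R ^+ d) : R)%:C != 0 :> R[i].
  by rewrite -nm_gt0 nm_real gtr0_norm ?divr_gt0 ?exprn_gt0 ?ltr0n.
have sB (j : 'I_n) b : size (val (base_tuple eps l (gen_index j b))) = d.+1.
  rewrite base_tupleE addrC size_polyDl size_scale ?size_exp_XsubC//.
  by rewrite (leq_ltn_trans (size_polyC_leq1 _))// ltnS (ltn_trans _ dd).
have sH (j : 'I_n) b : size (val (H j b)) = d.+1 by have [-> _] := hh (gen_index j b); exact: sB.
have sE (j : 'I_n) b : (size (E j b) <= d.+1)%N.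
  by rewrite (leq_trans (size_polyD _ _))// size_polyN sH sB maxnn.
have cE (j : 'I_n) b i : nm (E j b)`_i <= eta by rewrite coefB; have [_] := hh (gen_index j b).
have eta00 := ltW eta0.
have tau1 : tau <= 1 by rewrite /tau; move: eps0; clear; lra.
have Rb00 : n%:R + 1 = Rb by [].
have H1 (j : 'I_n) b z : nm z <= 1 / 2 -> nm (val (H j b)).[z] <= eps + tau.
  by apply: (@good_inner R n j d eps tau q eta (center eps b) _ (E j b)).
have H2 (j : 'I_n) b z z' : nm z <= 1 / 2 -> nm z' <= 1 / 2 ->
    nm ((val (H j b)).[z] - (val (H j b)).[z']) <= 1 / 2 * nm (z - z').
  by apply: (@good_contract R n j d eps tau q eta (center eps b) _ (E j b)).
have H3 (j : 'I_n) b z : Rb <= nm z -> 2 * nm z <= nm (val (H j b)).[z].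
  by apply: (@good_outer R n j d eps Q eta (center eps b) _ (E j b)).
have H4 (j : 'I_n) b z : root (val (H j b))^`() z -> nm z <= 1 / 2.
  by apply: (@good_crit R j d eps eta (center eps b) _ (E j b)).
have H5 (j : 'I_n) b : (2 <= cpoly_deg (H j b))%N by rewrite /cpoly_deg sH.
have H6 (j : 'I_n) b z : annulus Rb (val (H j b)).[z] -> annulus Rb z.
  by apply: (@good_in R n j d eps tau q Q eta (center eps b) _ (E j b)).
have H7 (j : 'I_n) b z : annulus Rb (val (H j b)).[z] -> ~~ root (val (H j b))^`() z.
  by apply: (@good_simple R n j d eps tau q eta (center eps b) _ (E j b)).
have H8 (j : 'I_n) b z : annulus Rb (val (H j b)).[z] ->
    `|nm (z - (if b then eps%:C else 0)) - j.+1%:R| <= d1.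
  have -> : d1 = u * n%:R by rewrite /u divfK// gt_eqF// (lt_le_trans ltr01).
  by apply: (@good_near_circle R n j d eps tau u q Q eta (center eps b) _ (E j b)).
have H9 (j : 'I_n) b z : annulus Rb z -> nm (E j b).[z] <= tau.
  by apply: (@good_error R n d eps tau eta).
have H10 (j : 'I_n) b z z' : annulus Rb z -> annulus Rb z' ->
    nm ((E j b).[z] - (E j b).[z']) <= tau * nm (z - z').
  by apply: (@good_error_lipschitz R n d eps tau eta).
have /choice[phi hphi] (x : 'I_n * bool) : exists phi : R[i] -> R[i],
    [/\ forall s, annulus Rb (cexp s) ->
          annulus Rb (cexp (phi s)) /\ (val (H x.1 x.2)).[cexp (phi s)] = cexp s,
        forall s s', annulus Rb (cexp s) -> annulus Rb (cexp s') ->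
          nm (phi s - phi s') <= lam * nm (s - s') &
        forall w, annulus Rb (val (H x.1 x.2)).[cexp w] ->
          exists2 s, cexp s = (val (H x.1 x.2)).[cexp w] & phi s = w].
  case: x => j b /=.
  apply: (@lift_exists R sg Rb tau C1 C2 sg0 sg1 Rb1 C10 C20 hC1 hC2 (val (H j b))
    (center eps b) (j.+1%:R / j.+1%:R ^+ d) (fun z => (E j b).[z]) d) => //.
  - exact: ltnW.
  - by move=> z; apply: (good_eval (FE j b)).
  - by rewrite lerD2r.
  - exact: H9.
  - exact: H10.
  - exact: H6.
  - exact: H7.
have -> : range h = [set H i.1 i.2 | i in [set: 'I_n * bool]].
  apply/seteqP; split => _ [i _ <-]; last by exists (gen_index i.1 i.2).
  by have [j [b <-]] := gen_index_onto i; exists (j, b).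
apply: (@assembly R n eps Rb d1 lam (eps + tau) H (fun j b => phi (j, b))) => //.
- by move: d1b eps1; clear; lra.
- exact: ltW.
- by move=> j b s; have [+ _ _] := hphi (j, b); apply.
- by move=> j b s s'; have [_ + _] := hphi (j, b); apply.
- by move=> j b s; have [_ _ +] := hphi (j, b); apply.
Qed.

Theorem proposition2p26 (R : realType) (n : nat) (hn : (1 < n)%N) :
  (exists h : 'I_(n + n) -> cpoly R,
     postcritically_bounded (semigroup_gen (range h)) /\
     (julia_components (semigroup_gen (range h)) #= `I_n)%card) /\
  (forall eps : R, 0 < eps -> eps < 1 / 2 ->
   \forall l \near \oo,
     exists V : set {ptws 'I_(n + n) -> cpoly R},
       [/\ open V, V (base_tuple eps l) &
           forall h, V h ->
             postcritically_bounded (semigroup_gen (range h)) /\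
             (julia_components (semigroup_gen (range h)) #= `I_n)%card]).
Proof.
have n0 : (0 < n)%N by exact: ltnW.
have main (eps : R) : 0 < eps -> eps < 1 / 2 ->
   \forall l \near \oo,
     exists V : set {ptws 'I_(n + n) -> cpoly R},
       [/\ open V, V (base_tuple eps l) &
           forall h, V h ->
             postcritically_bounded (semigroup_gen (range h)) /\
             (julia_components (semigroup_gen (range h)) #= `I_n)%card].
  move=> eps0 eps1; have := near_base_tuple n0 eps0 eps1.
  apply: filterS => l [eta eta0 hl].
  have ex (i : 'I_(n + n)) : exists e : R, 0 < e /\ forall f : cpoly R,
      (forall w, spherical_dist (cpoly_map (base_tuple eps l i) w) (cpoly_map f w) < e) ->
      size (val f) = size (val (base_tuple eps l i)) /\
      forall k, nm ((val f)`_k - (val (base_tuple eps l i))`_k) <= eta.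
    by have [e e0 hf] := cpoly_close (base_tuple eps l i) eta0; exists e.
  have [e he] := boolp.choice ex.
  pose U i := [set f : cpoly R | forall w,
    spherical_dist (cpoly_map (base_tuple eps l i) w) (cpoly_map f w) < e i].
  pose W : set {ptws 'I_(n + n) -> cpoly R} := [set f | forall i, U i (f i)].
  (* [W] is only shown to be a neighborhood of the base tuple; its interior is the required open
     set. *)
  exists (interior W); split.
  - exact: open_interior.
  - by apply: ptws_nbhs => i; apply: cpoly_nbhs; have [] := he i.
  - move=> h /interior_subset Wh; apply: hl => i.
    by have [_] := he i; apply; exact: Wh.
split; last exact: main.
have [|N _ hN] := main (1 / 4) (ltac:(by rewrite divr_gt0)); first by lra.
have [V [_ VB hV]] := hN N (leqnn N).
by exists (base_tuple (1 / 4) N); exact: hV.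
Qed.
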